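(* Let $G=(X,w,\kappa,\mu)$ be a graph. The following statements are equivalent: (i) $G$ satisfies stochastic completeness at infinity. (ii) For every $T>0$, every $u_0\in\ell^\infty(X)$ and every $\phi\in\mathcal I$, (GPME) with initial datum $u_0$ has a unique bounded pointwise solution on $[0,T]\times X$. (iii) There exist $T_0>0$, $u_0\in\ell^\infty(X)$ and $\phi\in\mathcal I$ such that (GPME) with initial datum $u_0$ has at most one bounded pointwise solution on $[0,T_0]\times X$. (iv) There exist $T_0>0$ and $\phi\in\mathcal I$ such that $u=0$ is the only bounded pointwise solution of (GPME) on $[0,T_0]\times X$ with initial datum $u_0=0$. (v) There exist $T_0>0$ and $\phi\in\mathcal I$ such that the following global bounded comparison principle holds: if $u,v\colon[0,T_0]\times X\to\mathbb R$ are bounded functions with $u(\cdot,x),v(\cdot,x)\in C([0,T_0])\cap C^1((0,T_0))$ for every $x\in X$, with $\partial_tu+\Delta(\phi\circ u)\le\partial_tv+\Delta(\phi\circ v)$ on $(0,T_0)\times X$ and with $u(0,\cdot)\le v(0,\cdot)$ on $X$, then $u\le v$ on $[0,T_0]\times X$. (vi) For every $u_0\in\ell^\infty(X)$ and every $\phi\in\mathcal I$, (GPME) with initial datum $u_0$ has a unique global bounded pointwise solution. If one of these conditions holds, then, for every $\phi\in\mathcal I$, the comparison principle described in (v) holds for every $T>0$ in place of $T_0$. If $G$ does not satisfy stochastic completeness at infinity, then, for every $u_0\in\ell^\infty(X)$ and every $\phi\in\mathcal I$, there are infinitely many global bounded pointwise solutions of (GPME) with initial datum $u_0$ whose restrictions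 to every $[0,T]\times X$, $T>0$, are pairwise distinct. For $u_0=0$, such an infinite family can be chosen of one sign: all its members nonnegative when $\phi$ is nonconstant on $[0,\infty)$, and all nonpositive otherwise.
   Context: Graph: $G=(X,w,\kappa,\mu)$ where $X$ is a countable set, $\mu\colon X\to(0,\infty)$, $w\colon X\times X\to[0,\infty)$ is symmetric with $w(x,x)=0$ and $\sum_{y\in X}w(x,y)<\infty$ for every $x\in X$, and $\kappa\colon X\to[0,\infty)$ (killing term). Graphs are always assumed connected: any $x,y\in X$ are joined by a finite path $x=x_0,\dots,x_N=y$ with $w(x_i,x_{i+1})>0$ for all $i$. No local finiteness is assumed. $\ell^\infty(X)$ denotes the bounded functions $X\to\mathbb R$. Laplacian: $\mathcal F$ is the set of $f\colon X\to\mathbb R$ with $\sum_{y}w(x,y)|f(y)|<\infty$ for every $x$; for $f\in\mathcal F$, $\Delta f(x)=\frac1{\mu(x)}\sum_{y\in X}w(x,y)(f(x)-f(y))+\frac{\kappa(x)}{\mu(x)}f(x)$. Stochastic completeness at infinity: let $L$ be the positive self-adjoint operator on $\ell^2(X,\mu)$ associated with the closure of the form $Q(f,g)=\frac12\sum_{x,y}w(x,y)(f(x)-f(y))(g(x)-g(y))+\sum_x\kappa(x)f(x)g(x)$ defined on finitely supported functions. The semigroup $e^{-tL}$ is positivity preserving and is extended to functions $f\ge0$ by $e^{-tL}f=\lim_n e^{-tL}f_n\in[0,\infty]$ for finitely supported $0\le f_n\uparrow f$. $G$ satisfies stochastic completeness at infinity if for some (and hence all) $t>0$, $e^{-tL}1+\int_0^te^{-sL}(\kappa/\mu)\,ds=1$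 pointwise on $X$. Nonlinearities: $\mathcal I$ is the set of continuous, increasing (in the weak sense: $s_1<s_2$ implies $\phi(s_1)\le\phi(s_2)$), nonconstant $\phi\colon\mathbb R\to\mathbb R$ with $\phi(0)=0$. Pointwise solutions: (GPME) is the Cauchy problem $\partial_tu+\Delta(\phi\circ u)=0$, $u|_{t=0}=u_0$. A pointwise solution on $[0,T]\times X$ with initial datum $u_0\colon X\to\mathbb R$ is a function $u\colon[0,T]\times X\to\mathbb R$ such that $\phi\circ u(t,\cdot)\in\mathcal F$ for every $t\in(0,T)$; $u(\cdot,x)\in C([0,T])\cap C^1((0,T))$ for every $x$; $\partial_tu(t,x)+\Delta(\phi\circ u(t,\cdot))(x)=0$ for all $(t,x)\in(0,T)\times X$; and $u(0,x)=u_0(x)$ for all $x$. It is bounded if $u$ is a bounded function. A function $u\colon[0,\infty)\times X\to\mathbb R$ is a global pointwise solution if its restriction to $[0,T]\times X$ is a pointwise solution for every $T>0$; it is a global bounded pointwise solution if in addition $u$ is bounded on $[0,\infty)\times X$. *)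

(* Defs.v *)
From HB Require Import structures.
From mathcomp Require Import all_boot all_order all_algebra.
From mathcomp Require Import all_classical all_reals all_analysis.
Import Order.TTheory GRing.Theory Num.Theory numFieldNormedType.Exports.
Set Implicit Arguments.
Unset Strict Implicit.
Unset Printing Implicit Defensive.
Local Open Scope classical_set_scope.
Local Open Scope ring_scope.

(* The value of an absolutely convergent real series over a countable index
   type; [esum] is a sum only for nonnegative families. Meaningless when the
   family is not summable. *)
Definition rsum (R : realType) (I : countType) (f : I -> R) : R :=
  fine (\esum_(i in [set: I]) (f^\+ i)%:E) -
  fine (\esum_(i in [set: I]) (f^\- i)%:E).

Definition rsummable (R : realType) (I : countType) (f : I -> R) : Prop :=
  summable [set: I] (fun i => (f i)%:E).

Record graph (R : realType) (X : countType) := Graph {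
  weight : X -> X -> R ;
  killing : X -> R ;
  mass : X -> R ;
  weight_ge0 : forall x y, 0 <= weight x y ;
  weight_sym : forall x y, weight x y = weight y x ;
  weight_diag : forall x, weight x x = 0 ;
  weight_summable : forall x, rsummable (weight x) ;
  killing_ge0 : forall x, 0 <= killing x ;
  mass_gt0 : forall x, 0 < mass x ;
  graph_connected : forall x y, exists2 p : seq X,
    path (fun a b => 0 < weight a b) x p & last x p = y
}.

Section Graphs.
Variables (R : realType) (X : countType) (G : graph R X).
Local Notation w := (weight G).
Local Notation kappa := (killing G).
Local Notation mu := (mass G).
Implicit Types (f g h : X -> R) (S : R -> (X -> R) -> X -> R).

Definition laplacian_dom f : Prop :=
  forall x, rsummable (fun y => w x y * `|f y|).

Definition laplacian f x : R :=
  (mu x)^-1 * rsum (fun y => w x y * (f x - f y)) + kappa x / mu x * f x.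

Definition ell2 f : Prop := rsummable (fun x => mu x * f x ^+ 2).

Definition inner f g : R := rsum (fun x => mu x * (f x * g x)).

Definition norm2 f : R := Num.sqrt (inner f f).

Definition finitely_supported f : Prop := finite_set [set x | f x != 0].

Definition form f g : R :=
  2^-1 * rsum (fun p : X * X =>
           w p.1 p.2 * (f p.1 - f p.2) * (g p.1 - g p.2)) +
  rsum (fun x => kappa x * f x * g x).

(* The closure of [form]: [f] is in its domain when it is the ell^2-limit of
   form-Cauchy finitely supported functions, and its values are the limits of
   the values along such sequences. *)
Definition form_approx (fn : nat -> X -> R) f : Prop :=
  [/\ forall n, finitely_supported (fn n),
      ell2 f,
      norm2 (fn n \- f) @[n --> \oo] --> 0
    & forall e : R, 0 < e -> exists N, forall m n, (N <= m)%N -> (N <= n)%N ->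
        form (fn m \- fn n) (fn m \- fn n) < e].

Definition closed_form_dom f : Prop := exists fn, form_approx fn f.

Definition closed_form f g (q : R) : Prop :=
  exists fn gn, [/\ form_approx fn f, form_approx gn g &
                    form (fn n) (gn n) @[n --> \oo] --> q].

(* The graph of the self-adjoint operator L associated with the closed form:
   [form_operator f h] says that f lies in D(L) and L f = h. *)
Definition form_operator f h : Prop :=
  [/\ closed_form_dom f, ell2 h &
      forall g, closed_form_dom g -> closed_form f g (inner h g)].

(* S t = e^{-tL} on ell^2: the strongly continuous contraction semigroup with
   generator -L. Values of S at t < 0 or outside ell^2 are irrelevant. *)
Definition heat_semigroup S : Prop :=
  [/\ forall t f, 0 <= t -> ell2 f -> ell2 (S t f) /\ norm2 (S t f) <= norm2 f,
      forall t (a : R) f g, 0 <= t -> ell2 f -> ell2 g ->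
        S t (fun x => a * f x + g x) = (fun x => a * S t f x + S t g x),
      forall f, ell2 f -> S 0 f = f /\
        forall s t, 0 <= s -> 0 <= t -> S (s + t) f = S s (S t f),
      forall f, ell2 f -> norm2 (S t f \- f) @[t --> 0^'+] --> 0
    & forall f h, ell2 f -> ell2 h ->
        (form_operator f h <->
         norm2 (fun x => t^-1 * (S t f x - f x) + h x) @[t --> 0^'+] --> 0)].

(* A finitely supported exhaustion of f, since [pickle] is injective. *)
Definition truncation (n : nat) f : X -> R :=
  fun x => if (pickle x < n)%N then f x else 0.

(* Extension of a positivity preserving semigroup to functions f >= 0. *)
Definition extended S (t : R) f (x : X) : \bar R :=
  limn (fun n => (S t (truncation n f) x)%:E).

Definition stochastically_complete_at_infinity : Prop :=
  exists2 S, heat_semigroup S &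
  exists2 t : R, 0 < t & forall x,
    (extended S t (cst 1%R) x +
     \int[lebesgue_measure]_(s in `[0%R, t])
        extended S s (fun y => kappa y / mu y)%R x = 1)%E.

Definition nonlinearity (phi : R -> R) : Prop :=
  [/\ continuous phi, {homo phi : s t / s <= t},
      exists s t, phi s != phi t & phi 0 = 0].

(* Functions on [0, T] x X are represented by total functions on R x X whose
   values outside [0, T] x X are never used; [eq_upto] is their equality. *)
Implicit Types (u v : R -> X -> R) (phi : R -> R) (T : R).

Definition time_regular T u : Prop := forall x : X,
  [/\ {within `[0, T], continuous (fun t => u t x)},
      forall t, 0 < t < T -> derivable (fun s => u s x) t 1
    & forall t, 0 < t < T -> {for t, continuous (derive1 (fun s => u s x))}].

Definition bounded_upto T u : Prop :=
  exists M : R, forall t x, 0 <= t <= T -> `|u t x| <= M.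

Definition bounded_global u : Prop :=
  exists M : R, forall t x, 0 <= t -> `|u t x| <= M.

Definition eq_upto T u v : Prop :=
  forall t x, 0 <= t <= T -> u t x = v t x.

Definition eq_global u v : Prop :=
  forall t x, 0 <= t -> u t x = v t x.

Definition gpme_operator phi u (t : R) (x : X) : R :=
  derive1 (fun s => u s x) t + laplacian (fun y => phi (u t y)) x.

Definition pointwise_solution phi (u0 : X -> R) T u : Prop :=
  [/\ forall t, 0 < t < T -> laplacian_dom (fun y => phi (u t y)),
      time_regular T u,
      forall t x, 0 < t < T -> gpme_operator phi u t x = 0
    & forall x, u 0 x = u0 x].

Definition bounded_solution phi (u0 : X -> R) T u : Prop :=
  pointwise_solution phi u0 T u /\ bounded_upto T u.

Definition global_bounded_solution phi (u0 : X -> R) u : Prop :=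
  (forall T, 0 < T -> pointwise_solution phi u0 T u) /\ bounded_global u.

Definition comparison_principle phi T : Prop :=
  forall u v, bounded_upto T u -> bounded_upto T v ->
    time_regular T u -> time_regular T v ->
    (forall t x, 0 < t < T -> gpme_operator phi u t x <= gpme_operator phi v t x) ->
    (forall x, u 0 x <= v 0 x) ->
    forall t x, 0 <= t <= T -> u t x <= v t x.

(* Infinitely many global bounded solutions, pairwise distinct on every
   [0, T] x X. *)
Definition separated_solutions phi (u0 : X -> R) (U : nat -> R -> X -> R) : Prop :=
  (forall n, global_bounded_solution phi u0 (U n)) /\
  (forall m n, m != n -> forall T, 0 < T -> ~ eq_upto T (U m) (U n)).

End Graphs.

Definition bounded_function (R : realType) (X : Type) (f : X -> R) : Prop :=
  exists M : R, forall x, `|f x| <= M.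

(* Main.v *)
(* Everything reduces to bounded subsolutions: functions f with 0 <= f <= 1,
   f <> 0 and Delta f <= - a f for some a > 0. Stochastic completeness at
   infinity fails exactly when one exists. Indeed, let rho be the increasing
   limit of the resolvents (1 + h L)^-1 of the truncations of 1 + h kappa / mu.
   Its defect v = 1 - rho satisfies Delta v = - v / h and dominates every
   subsolution with a = 1 / h, and integrating d/ds e^{-sL} rho shows that
   e^{-tL} 1 + int_0^t e^{-sL} (kappa / mu) ds = 1 if and only if v = 0. (The
   semigroup is obtained from the resolvents by the backward Euler method, and it
   is determined by its generator.)

   Without subsolutions comparison holds: for u, v as in (v), the time integral V
   of (phi(u) - phi(v))^+ against the weight 1 + T - t satisfies Delta V <= - W,
   where W is (u - v)^+ at time T plus its time integral. Since V <= e + C_e W for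
   every e > 0, the function (V - s)^+ would be a subsolution for some s > 0
   unless V = 0; hence V = 0 and W = 0.

   Solutions are ultrafilter limits of explicit monotone Euler schemes on an
   exhaustion by finite sets, with a constant value M imposed on the complement.
   The time integral of phi(u) has a bounded Laplacian there and equals
   T phi(M) on the complement. Comparing it with a subsolution cut off just below
   its supremum, whose Laplacian is very negative, shows that the time average of
   phi(u) is close to phi(M) where the subsolution peaks. So different values of
   phi(M) give different solutions. *)
Require Import Defs.
From HB Require Import structures.
From mathcomp Require Import all_boot all_order all_algebra.
From mathcomp Require Import all_classical all_reals all_analysis.
From mathcomp Require Import ring lra.
Import Order.TTheory GRing.Theory Num.Theory numFieldNormedType.Exports.
Set Implicit Arguments.
Unset Strict Implicit.
Unset Printing Implicit Defensive.
Local Open Scope classical_set_scope.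
Local Open Scope ring_scope.

(** * Absolutely convergent sums *)

(** The hypotheses are weak: vertex rates may be unbounded, and [phi] is only continuous and may be
    flat. An explicit Euler step is monotone only if its length is tied to the rates on a finite set
    and to a Lipschitz constant; so [phi] is replaced by [n]-Lipschitz inf-convolutions and the step
    shrinks with [n]. The source [1 + h kappa / mu] is [(1 + h Delta) 1]: the constant 1 solves the
    resolvent equation, and the defect [v] is what the minimal solution lacks. Completeness at one
    time [t] suffices to kill it: the integrated identity gives [v <= theta e^{-tL} v] with
    [theta < 1], which iterates to [v <= theta^n]. In the comparison, no constant relates
    [phi(u) - phi(v)] to [u - v]; uniform continuity only gives [V <= e + C_e W], whence the cut at
    a level [s]. The weight comes from [\int (1 + T - t) F' = F(T) + \int F] for [F(0) = 0]: the
    first term is the quantity to be bounded, the second dominates [V] up to [e]. The peak argument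
    controls time averages only, so the time at which two schemes differ depends on [n]; the limit
    is therefore taken jointly in [n] and in time. *)

Lemma cvg_sum_nat (R : realType) (T : Type) (F : set_system T) {FF : Filter F}
    (h : T -> nat -> R) (f : nat -> R) n :
  (forall k, h t k @[t --> F] --> f k) ->
  \sum_(0 <= k < n) h t k @[t --> F] --> \sum_(0 <= k < n) f k.
Proof.
move=> hf; elim: n => [|n IHn].
  by rewrite big_nil; under eq_fun do rewrite big_nil; exact: cvg_cst.
rewrite big_nat_recr//=; under eq_fun do rewrite big_nat_recr//=.
exact: cvgD.
Qed.

Section PartialSums.
Variables (R : realType) (I : countType).
Implicit Types (f g : I -> R).

(** Sums run over the codes given by [pickle], so that no enumeration of [I] is needed; a code
    without preimage contributes 0. *)
Definition term f (k : nat) : R := oapp f 0 (pickle_inv k).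
Definition psum f (n : nat) : R := \sum_(0 <= k < n) term f k.

Lemma term_pickle f i : term f (pickle i) = f i.
Proof. by rewrite /term pickleK_inv. Qed.

Lemma le_psum f g n : (forall i, f i <= g i) -> psum f n <= psum g n.
Proof. by move=> fg; apply: ler_sum => k _; rewrite /term; case: pickle_inv. Qed.

Lemma psum_ge0 f n : (forall i, 0 <= f i) -> 0 <= psum f n.
Proof.
by move=> f0; apply: sumr_ge0 => k _; rewrite /term; case: pickle_inv => /=.
Qed.

Lemma psum_linear (a : R) f g n :
  psum (fun i => a * f i + g i) n = a * psum f n + psum g n.
Proof.
rewrite /psum mulr_sumr -big_split; apply: eq_bigr => k _ /=.
by rewrite /term; case: pickle_inv => //=; rewrite mulr0 addr0.
Qed.

Lemma psum_homo f : (forall i, 0 <= f i) -> nondecreasing_seq (psum f).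
Proof.
move=> f0; apply/nondecreasing_seqP => n; rewrite /psum big_nat_recr//= lerDl.
by rewrite /term; case: pickle_inv => /=.
Qed.

Lemma psum_split f (n m : nat) : (n <= m)%N ->
  psum f m = psum f n + psum (fun i => if (pickle i < n)%N then 0 else f i) m.
Proof.
move=> nm; rewrite /psum.
have E k : term (fun i => if (pickle i < n)%N then 0 else f i) k =
    if (k < n)%N then 0 else term f k.
  rewrite /term; have := @pickle_invK I k; case: pickle_inv => [i|] /=.
    by move=> ->.
  by case: ifP.
rewrite (eq_bigr _ (fun k _ => E k)).
rewrite (@big_cat_nat _ _ _ n)//=; congr (_ + _).
rewrite [RHS](@big_cat_nat _ _ _ n)//= [X in _ = X + _]big1_seq ?add0r.
  by apply: eq_big_nat => k /andP[nk _]; rewrite ltnNge nk.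
by move=> k /andP[_]; rewrite mem_index_iota => /andP[_ ->].
Qed.

Lemma psum_stable f (n m : nat) : (n <= m)%N ->
  (forall i, (n <= pickle i)%N -> f i = 0) -> psum f m = psum f n.
Proof.
move=> nm f0; rewrite (psum_split f nm) -[RHS]addr0; congr (_ + _).
rewrite /psum big1// => k _; rewrite /term; case: pickle_inv => //= i.
by case: ltnP => // /f0.
Qed.

Lemma esum_term f : (forall i, 0 <= f i) ->
  (\esum_(i in [set: I]) (f i)%:E = \sum_(0 <= k <oo) (term f k)%:E)%E.
Proof.
move=> f0; rewrite nneseries_esumT; last first.
  by move=> k; rewrite lee_fin /term; case: pickle_inv => /=.
transitivity (\esum_(j in pickle @` [set: I]) (term f j)%:E)%E.
  rewrite (esum_image [set: I] pickle (fun j => (term f j)%:E)).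
    by apply: eq_esum => i _; rewrite term_pickle.
  by move=> x y _ _; exact: (pcan_inj pickleK).
rewrite esum_mkcond; apply: eq_esum => k _.
case: ifPn => // /negP kI; rewrite /term.
have := @pickle_invK I k; case: pickle_inv => [i|] //= ik.
by exfalso; apply: kI; rewrite inE; exists i.
Qed.

Lemma rsummableP f :
  rsummable f <-> exists M, forall n, psum (fun i => `|f i|) n <= M.
Proof.
rewrite /rsummable /summable.
under eq_esum do rewrite abse_EFin.
rewrite esum_term//.
have t0 k : (0 <= (term (fun i => `|f i|) k)%:E)%E.
  by rewrite lee_fin /term; case: pickle_inv => /=.
have E n : (\sum_(0 <= k < n) (term (fun i => `|f i|) k)%:E)%E =
    (psum (fun i => `|f i|) n)%:E by rewrite sumEFin.
split=> [fi|[M fM]].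
- exists (fine (\sum_(0 <= k <oo) (term (fun i => `|f i|) k)%:E)%E) => n.
  rewrite -lee_fin fineK; last by rewrite ge0_fin_numE// nneseries_ge0.
  by rewrite -E; apply: nneseries_lim_ge => k _ _.
- apply: (@le_lt_trans _ _ M%:E); last by rewrite ltry.
  apply: lime_le; first by apply: is_cvg_nneseries.
  by apply: nearW => n; rewrite E lee_fin.
Qed.

Lemma ge0_rsum_cvg f : rsummable f -> (forall i, 0 <= f i) ->
  psum f @ \oo --> fine (\esum_(i in [set: I]) (f i)%:E)%E.
Proof.
move=> /rsummableP[M fM] f0; rewrite esum_term//.
have E : (fun n => \sum_(0 <= k < n) (term f k)%:E)%E = EFin \o psum f.
  by apply/funext => n /=; rewrite sumEFin.
have fM' n : psum f n <= M.
  by apply: le_trans (fM n); apply: le_psum => i; rewrite ler_norm.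
have cf : cvgn (psum f).
  apply: nondecreasing_is_cvgn; first exact: psum_homo.
  by exists M => _ [n _ <-].
by rewrite E EFin_lim.
Qed.

Lemma rsummable_le f g : (forall i, `|f i| <= g i) -> rsummable g -> rsummable f.
Proof.
move=> fg /rsummableP[M gM]; apply/rsummableP; exists M => n.
apply: le_trans (gM n); apply: le_psum => i.
by apply: (le_trans (fg i)); rewrite ler_norm.
Qed.

Lemma rsummable_norm f : rsummable f -> rsummable (fun i => `|f i|).
Proof.
move=> /rsummableP[M fM]; apply/rsummableP; exists M => n.
by apply: le_trans (fM n); apply: le_psum => i; rewrite normr_id.
Qed.

Lemma rsum_cvg f : rsummable f -> psum f @ \oo --> rsum f.
Proof.
move=> sf; rewrite /rsum.
have -> : psum f = psum f^\+ \- psum f^\-.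
  apply/funext => n /=; rewrite /psum -sumrB; apply: eq_bigr => k _.
  rewrite /term; case: pickle_inv => [i|] /=; last by rewrite subr0.
  by rewrite -[in LHS](funrposBneg f).
have sn := rsummable_norm sf.
apply: cvgB; apply: ge0_rsum_cvg => //.
- apply: rsummable_le sn => i; rewrite ger0_norm// /funrpos.
  by rewrite ge_max normr_ge0 ler_norm.
- apply: rsummable_le sn => i; rewrite ger0_norm// /funrneg.
  by rewrite ge_max normr_ge0 -normrN ler_norm.
Qed.

Lemma rsummable_linear (a : R) f g : rsummable f -> rsummable g ->
  rsummable (fun i => a * f i + g i).
Proof.
move=> /rsummableP[M fM] /rsummableP[N gN]; apply/rsummableP.
exists (`|a| * M + N) => n.
apply: (@le_trans _ _ (psum (fun i => `|a| * `|f i| + `|g i|) n)).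
  by apply: le_psum => i; rewrite (le_trans (ler_normD _ _))// normrM.
rewrite psum_linear lerD// ler_wpM2l//.
Qed.

Lemma rsum_linear (a : R) f g : rsummable f -> rsummable g ->
  rsum (fun i => a * f i + g i) = a * rsum f + rsum g.
Proof.
move=> sf sg; have := rsum_cvg (rsummable_linear a sf sg).
have -> : psum (fun i => a * f i + g i) = (fun n => a * psum f n + psum g n).
  by apply/funext => n; exact: psum_linear.
move=> /cvg_unique; apply => //; apply: cvgD; last exact: rsum_cvg.
by apply: cvgMl_tmp; exact: rsum_cvg.
Qed.

Lemma rsummable0 : rsummable (fun _ : I => 0 : R).
Proof.
apply/rsummableP; exists 0 => n; rewrite /psum big1// => k _.
by rewrite /term; case: pickle_inv => //= _; rewrite normr0.
Qed.

Lemma rsum_finite n f : (forall i, (n <= pickle i)%N -> f i = 0) ->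
  rsummable f /\ rsum f = psum f n.
Proof.
move=> f0; have sf : rsummable f.
  apply/rsummableP; exists (psum (fun i => `|f i|) n) => m.
  have a0 i : (n <= pickle i)%N -> `|f i| = 0 by move=> /f0 ->; rewrite normr0.
  case: (leqP n m) => nm; first by rewrite (psum_stable nm a0).
  by apply: psum_homo => //; exact: ltnW.
split=> //; have := rsum_cvg sf; move=> /cvg_unique; apply => //.
apply: cvg_near_cst; exists n => // m /= nm.
by rewrite (psum_stable nm f0).
Qed.

Lemma rsum0 : rsum (fun _ : I => 0 : R) = 0.
Proof.
have [_ ->] := @rsum_finite 0%N (fun _ : I => 0) (fun _ _ => erefl).
by rewrite /psum big_nil.
Qed.

Lemma rsummableZ (a : R) f : rsummable f -> rsummable (fun i => a * f i).
Proof.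
move=> sf; have := rsummable_linear a sf rsummable0.
by congr rsummable; apply/funext => i; rewrite addr0.
Qed.

Lemma rsumZ (a : R) f : rsummable f -> rsum (fun i => a * f i) = a * rsum f.
Proof.
move=> sf; have := rsum_linear a sf rsummable0; rewrite rsum0 addr0 => <-.
by congr rsum; apply/funext => i; rewrite addr0.
Qed.

Lemma rsummableD f g : rsummable f -> rsummable g ->
  rsummable (fun i => f i + g i).
Proof.
move=> sf sg; have := rsummable_linear 1 sf sg.
by congr rsummable; apply/funext => i; rewrite mul1r.
Qed.

Lemma rsumD f g : rsummable f -> rsummable g ->
  rsum (fun i => f i + g i) = rsum f + rsum g.
Proof.
move=> sf sg; have := rsum_linear 1 sf sg; rewrite mul1r => <-.
by congr rsum; apply/funext => i; rewrite mul1r.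
Qed.

Lemma rsummableN f : rsummable f -> rsummable (fun i => - f i).
Proof.
move=> /(rsummableZ (-1)); by congr rsummable; apply/funext => i; rewrite mulN1r.
Qed.

Lemma rsumN f : rsummable f -> rsum (fun i => - f i) = - rsum f.
Proof.
move=> /(rsumZ (-1)); rewrite mulN1r => <-.
by congr rsum; apply/funext => i; rewrite mulN1r.
Qed.

Lemma rsumB f g : rsummable f -> rsummable g ->
  rsum (fun i => f i - g i) = rsum f - rsum g.
Proof.
by move=> sf sg; rewrite (rsumD sf (rsummableN sg)) rsumN.
Qed.

Lemma rsummableB f g : rsummable f -> rsummable g ->
  rsummable (fun i => f i - g i).
Proof. by move=> sf sg; apply: rsummableD => //; exact: rsummableN. Qed.

Lemma psum_le_rsum f n : rsummable f -> (forall i, 0 <= f i) -> psum f n <= rsum f.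
Proof.
move=> /rsum_cvg cf f0; have <- := cvg_lim (@Rhausdorff R) cf.
by apply: nondecreasing_cvgn_le; [exact: psum_homo|apply/cvg_ex; exists (rsum f)].
Qed.

Lemma rsum_ge0 f : (forall i, 0 <= f i) -> rsummable f -> 0 <= rsum f.
Proof. by move=> f0 sf; rewrite -(_ : psum f 0 = 0) ?psum_le_rsum// /psum big_nil. Qed.

Lemma le_rsum f g : (forall i, f i <= g i) -> rsummable f -> rsummable g ->
  rsum f <= rsum g.
Proof.
move=> fg sf sg; rewrite -subr_ge0 -rsumB// rsum_ge0//; last exact: rsummableB.
by move=> i; rewrite subr_ge0.
Qed.

Lemma rsum_le_bound f M : rsummable f -> (forall n, psum f n <= M) -> rsum f <= M.
Proof.
move=> /rsum_cvg cf fM; have <- := cvg_lim (@Rhausdorff R) cf.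
by apply: limr_le; [apply/cvg_ex; exists (rsum f)|apply: nearW].
Qed.

Lemma rsummable_bound f M : (forall i, 0 <= f i) -> (forall n, psum f n <= M) ->
  rsummable f.
Proof.
move=> f0 fM; apply/rsummableP; exists M => n; apply: le_trans (fM n).
by apply: le_psum => i; rewrite ger0_norm.
Qed.

Lemma le_rsum1 f i : rsummable f -> (forall i, 0 <= f i) -> f i <= rsum f.
Proof.
move=> sf f0; apply: le_trans (@psum_le_rsum f (pickle i).+1 sf f0).
by rewrite /psum big_nat_recr//= term_pickle lerDr psum_ge0.
Qed.

Lemma ler_norm_rsum f : rsummable f -> `|rsum f| <= rsum (fun i => `|f i|).
Proof.
move=> sf; have sn := rsummable_norm sf; rewrite ler_norml -rsumN//.
apply/andP; split; apply: le_rsum => //.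
- by move=> i; rewrite lerNl -normrN ler_norm.
- exact: rsummableN.
- by move=> i; rewrite ler_norm.
Qed.

Lemma rsum_tail f (e : R) : rsummable f -> (forall i, 0 <= f i) -> 0 < e ->
  exists n, rsum (fun i => if (pickle i < n)%N then 0 else f i) < e.
Proof.
move=> sf f0 e0; have /cvgrPdist_lt/(_ _ e0) [n _ /(_ n (leqnn n)) nf] := rsum_cvg sf.
exists n; apply: le_lt_trans nf.
have st : rsummable (fun i => if (pickle i < n)%N then 0 else f i).
  by apply: rsummable_le sf => i; case: ifP; rewrite ?normr0 ?ger0_norm.
apply: rsum_le_bound => // m; rewrite ger0_norm ?subr_ge0 ?psum_le_rsum//.
case: (leqP n m) => nm.
  by rewrite lerBrDl -psum_split// psum_le_rsum.
apply: (@le_trans _ _ 0); last by rewrite subr_ge0 psum_le_rsum.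
rewrite /psum big1_seq// => k /andP[_]; rewrite mem_index_iota => /andP[_ km].
rewrite /term; have := @pickle_invK I k; case: pickle_inv => //= i ->.
by rewrite (ltn_trans km nm).
Qed.

(** Dominated convergence along an arbitrary proper filter, used for sequences, ultrafilters, times
    and product filters alike: the tail of the dominating series is small uniformly in [t], and the
    finite rest converges termwise. *)
Lemma rsum_dominated (T : Type) (F : set_system T) {FF : ProperFilter F}
    (h : T -> I -> R) f g :
  rsummable g -> (\forall t \near F, forall i, `|h t i| <= g i) ->
  (forall i, h t i @[t --> F] --> f i) ->
  rsum (h t) @[t --> F] --> rsum f.
Proof.
move=> sg hg hf.
have g0 i : 0 <= g i.
  by near F => t; apply: le_trans (near hg t _ i); rewrite ?normr_ge0.
have fg i : `|f i| <= g i.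
  apply: (cvgr_to_le (cvg_norm (hf i))).
  by near=> t; apply: (near hg t).
have sf : rsummable f by exact: rsummable_le fg sg.
apply/cvgrPdist_lt => e e0; have e4 : 0 < e / 4 by lra.
have [n gn] := rsum_tail sg g0 e4.
have cp : psum (h t) n @[t --> F] --> psum f n.
  apply: cvg_sum_nat => k; rewrite /term; case: pickle_inv => //=; exact: cvg_cst.
move/cvgrPdist_lt: cp => /(_ _ e4) cp.
near=> t.
have ht i : `|h t i| <= g i by apply: (near hg t).
have sh : rsummable (h t) by exact: rsummable_le ht sg.
have split0 u : rsummable u -> (forall i, `|u i| <= g i) -> `|rsum u - psum u n| <= e / 4.
  move=> su ug.
  pose u1 i := if (pickle i < n)%N then u i else 0.
  pose u2 i := if (pickle i < n)%N then 0 else u i.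
  have s2 : rsummable u2.
    apply: rsummable_le sg => i; rewrite /u2; case: ifP => // _.
    by rewrite normr0.
  have [s1 E1] : rsummable u1 /\ rsum u1 = psum u1 n.
    by apply: rsum_finite => i; rewrite /u1 ltnNge => ->.
  have -> : psum u n = psum u1 n.
    rewrite /psum; apply: eq_big_nat => k kn; rewrite /term.
    have := @pickle_invK I k; case: pickle_inv => //= i ik.
    by rewrite /u1 ik; case/andP: kn => _ ->.
  have -> : u = (fun i => u1 i + u2 i).
    by apply/funext => i; rewrite /u1 /u2; case: ifP; rewrite ?addr0 ?add0r.
  rewrite rsumD// -E1 addrAC subrr add0r.
  apply: le_trans (ler_norm_rsum s2) _; apply: le_trans (ltW gn).
  apply: le_rsum.
  - by move=> i; rewrite /u2; case: ifP => // _; rewrite normr0.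
  - exact: rsummable_norm.
  - by apply: rsummable_le sg => i; case: ifP; rewrite ?normr0 ?ger0_norm.
have h1 := split0 _ sf fg; have h2 := split0 _ sh ht.
have h3 : `|psum f n - psum (h t) n| < e / 4 by apply: (near cp t).
move: h1 h2 h3; rewrite !ltr_norml !ler_norml => /andP[? ?] /andP[? ?] /andP[? ?].
by apply/andP; split; lra.
Unshelve. all: by end_near. Qed.

End PartialSums.

(** Reduces a sum over pairs of vertices that is supported on one row or one column to a sum over
    vertices. *)
Lemma rsum_embed (R : realType) (I J : countType) (e : I -> J) (f : J -> R) :
  injective e -> (forall j, (forall i, e i <> j) -> f j = 0) ->
  (rsummable (f \o e) -> rsummable f) /\ rsum f = rsum (f \o e).
Proof.
move=> inje f0.
have E (h : J -> \bar R) : (forall j, f j = 0 -> h j = 0%E) ->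
    (\esum_(j in [set: J]) h j = \esum_(i in [set: I]) h (e i))%E.
  move=> hf; rewrite -(esum_image [set: I] e h); last by move=> x y _ _; exact: inje.
  rewrite [RHS]esum_mkcond; apply: eq_esum => j _.
  case: ifPn => // /negP nj; apply: hf; apply: f0 => i ij; apply: nj.
  by rewrite inE; exists i.
split.
  rewrite /rsummable /summable (E (fun j => `|(f j)%:E|%E))// => j ->.
  by rewrite abse0.
rewrite /rsum (E (fun j => (f^\+ j)%:E))//; last first.
  by move=> j fj; rewrite /funrpos fj maxxx.
rewrite (E (fun j => (f^\- j)%:E))//.
by move=> j fj; rewrite /funrneg fj oppr0 maxxx.
Qed.

(** * The Laplacian on bounded functions and Green's formula *)

Section BoundedFunctions.
Variables (R : realType) (X : Type).
Implicit Types f g : X -> R.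

Lemma bounded_linear (a : R) f g : bounded_function f -> bounded_function g ->
  bounded_function (fun x => a * f x + g x).
Proof.
move=> [M fM] [N gN]; exists (`|a| * M + N) => x.
rewrite (le_trans (ler_normD _ _))// lerD// normrM ler_wpM2l//.
Qed.

Lemma bounded_cst (c : R) : bounded_function (fun _ : X => c).
Proof. by exists `|c|. Qed.

Lemma bounded_between f a b : (forall x, a <= f x <= b) -> bounded_function f.
Proof.
move=> fab; exists (`|a| + `|b|) => x; have /andP[ha hb] := fab x.
rewrite ler_norml; apply/andP; split.
  by apply: le_trans ha; rewrite lerNl -normrN (le_trans (ler_norm _))// lerDl.
by apply: (le_trans hb); rewrite (le_trans (ler_norm _))// lerDr.
Qed.

End BoundedFunctions.

Section FiniteSupport.
Variables (R : realType) (X : countType).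
Implicit Types f g : X -> R.

(** Finite support as a bound on codes, which is the form that partial sums and inductions on the
    support can use. *)
Definition fsupp f := exists n, forall x, (n <= pickle x)%N -> f x = 0.

Lemma finitely_supportedP f : finitely_supported f <-> fsupp f.
Proof.
split=> [/finite_fsetP[F EF]|[n fn]].
  exists (\max_(x <- finmap.enum_fset F) (pickle x)).+1 => x nx.
  apply/eqP; apply: contraTT nx => fx.
  have xF : x \in finmap.enum_fset F.
    by have : [set x | f x != 0] x by []; rewrite EF.
  by rewrite -ltnNge ltnS leq_bigmax_seq.
apply: (@sub_finite_set _ _ (pickle @^-1` `I_n)).
  move=> x /= fx; rewrite ltnNge; apply: contra_neqN fx; exact: fn.
apply: finite_preimage; last exact: finite_II.
by move=> x y _ _; exact: (pcan_inj pickleK).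
Qed.

Lemma fsupp_linear (a : R) f g : fsupp f -> fsupp g ->
  fsupp (fun x => a * f x + g x).
Proof.
move=> [n fn] [m gm]; exists (maxn n m) => x; rewrite geq_max => /andP[nx mx].
by rewrite fn// gm// mulr0 addr0.
Qed.

Lemma fsupp_le f g : (forall x, g x = 0 -> f x = 0) -> fsupp g -> fsupp f.
Proof. by move=> fg [n gn]; exists n => x /gn /fg. Qed.

Lemma fsupp0 : fsupp (fun=> 0 : R). Proof. by exists 0%N. Qed.

Lemma fsupp_rsummable f : fsupp f -> rsummable f.
Proof. by move=> [n /rsum_finite[]]. Qed.

Lemma fsupp_bounded f : fsupp f -> bounded_function f.
Proof.
move=> [n fn]; exists (psum (fun x => `|f x|) n) => x.
case: (ltnP (pickle x) n) => [xn|/fn ->]; last by rewrite normr0 psum_ge0.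
apply: (@le_trans _ _ (psum (fun x => `|f x|) (pickle x).+1)).
  by rewrite /psum big_nat_recr//= term_pickle lerDr psum_ge0.
exact: psum_homo.
Qed.

Definition delta (z : X) : X -> R := fun x => (x == z)%:R.

Lemma fsupp_delta z : fsupp (delta z).
Proof.
exists (pickle z).+1 => x; rewrite /delta; case: eqP => // ->.
by rewrite ltnn.
Qed.

Lemma fsupp_truncation n f : fsupp (truncation n f).
Proof. by exists n => x nx; rewrite /truncation ltnNge nx. Qed.

End FiniteSupport.

Section Form.
Variables (R : realType) (X : countType) (G : graph R X).
Local Notation w := (weight G).
Local Notation kappa := (killing G).
Local Notation mu := (mass G).
Local Notation form := (Defs.form G).
Implicit Types (f g h : X -> R).

Lemma mass_neq0 x : mu x != 0. Proof. by rewrite gt_eqF// mass_gt0. Qed.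

Lemma rsummable_weight_bounded f x : bounded_function f ->
  rsummable (fun y => w x y * f y).
Proof.
move=> [M fM]; apply: rsummable_le (rsummableZ M (weight_summable G x)) => y.
by rewrite normrM ger0_norm ?weight_ge0// mulrC ler_wpM2r ?weight_ge0.
Qed.

Lemma rsummable_weight_diff f x : bounded_function f ->
  rsummable (fun y => w x y * (f x - f y)).
Proof.
move=> bf; apply: (@rsummable_weight_bounded (fun y => f x - f y)).
have := bounded_linear (-1) bf (@bounded_cst _ X (f x)).
by congr bounded_function; apply/funext => y; rewrite mulN1r addrC.
Qed.

Definition degree x := rsum (w x).

Lemma degree_ge0 x : 0 <= degree x.
Proof. by apply: rsum_ge0; [exact: weight_ge0|exact: weight_summable]. Qed.

Lemma laplacianE f x : bounded_function f ->
  mu x * laplacian G f x =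
  (degree x + kappa x) * f x - rsum (fun y => w x y * f y).
Proof.
move=> bf; rewrite /laplacian.
have -> : rsum (fun y => w x y * (f x - f y)) =
    f x * degree x - rsum (fun y => w x y * f y).
  rewrite -rsumZ; last exact: weight_summable.
  rewrite -rsumB; last exact: rsummable_weight_bounded.
    by congr rsum; apply/funext => y; ring.
  exact/rsummableZ/weight_summable.
have := mass_neq0 x; move: (mu x) => m m0; field; exact: m0.
Qed.

Lemma laplacian_eq f x : bounded_function f ->
  laplacian G f x =
  ((degree x + kappa x) * f x - rsum (fun y => w x y * f y)) / mu x.
Proof. by move=> bf; rewrite -laplacianE// mulrC mulKf// mass_neq0. Qed.

Lemma laplacian_linear (a : R) f g x : bounded_function f -> bounded_function g ->
  laplacian G (fun y => a * f y + g y) x = a * laplacian G f x + laplacian G g x.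
Proof.
move=> bf bg; rewrite !laplacian_eq//; last exact: bounded_linear.
have -> : rsum (fun y => w x y * (a * f y + g y)) =
    a * rsum (fun y => w x y * f y) + rsum (fun y => w x y * g y).
  rewrite -rsum_linear; try exact: rsummable_weight_bounded.
  by congr rsum; apply/funext => y; ring.
have := mass_neq0 x; move: (mu x) => m m0; field; exact: m0.
Qed.

Lemma laplacian_cst (c : R) x : laplacian G (fun=> c) x = kappa x / mu x * c.
Proof.
rewrite /laplacian; under eq_fun do rewrite subrr mulr0.
by rewrite rsum0 mulr0 add0r.
Qed.

Let eterm f g (p : X * X) := w p.1 p.2 * (f p.1 - f p.2) * (g p.1 - g p.2).

(** Only the row and the column of [z] contribute, and the symmetry of the weight makes their sums
    equal. *)
Let eterm_delta f z : bounded_function f ->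
  rsummable (eterm f (delta R z)) /\
  rsum (eterm f (delta R z)) = 2 * rsum (fun y => w z y * (f z - f y)).
Proof.
move=> bf; have sz := rsummable_weight_diff z bf.
pose A (p : X * X) := if p.1 == z then w z p.2 * (f z - f p.2) else 0.
pose B (p : X * X) := if p.2 == z then w z p.1 * (f z - f p.1) else 0.
have EAB : eterm f (delta R z) = (fun p => A p + B p).
  apply/funext => -[x y]; rewrite /eterm /A /B /delta/=.
  case: (eqVneq x z) => [->|xz]; case: (eqVneq y z) => [->|yz].
  - by rewrite weight_diag; ring.
  - by rewrite /=; ring.
  - by rewrite weight_sym /=; ring.
  - by rewrite /=; ring.
have [sA EA] : (rsummable (A \o pair z) -> rsummable A) /\ rsum A = rsum (A \o pair z).
  apply: rsum_embed; first by move=> x y [].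
  move=> [x y] nxy; rewrite /A/=; case: eqP => // xz.
  by have := nxy y; rewrite -xz.
have [sB EB] : (rsummable (B \o (fun x => (x, z))) -> rsummable B) /\
    rsum B = rsum (B \o (fun x => (x, z))).
  apply: rsum_embed; first by move=> x y [].
  move=> [x y] nxy; rewrite /B/=; case: eqP => // yz.
  by have := nxy x; rewrite -yz.
have oA : A \o pair z = fun y => w z y * (f z - f y).
  by apply/funext => y; rewrite /A/= eqxx.
have oB : B \o (fun x => (x, z)) = fun y => w z y * (f z - f y).
  by apply/funext => y; rewrite /B/= eqxx.
move: sA EA sB EB; rewrite oA oB => /(_ sz) sA EA /(_ sz) sB EB.
by rewrite EAB; split; [exact: rsummableD|rewrite rsumD// EA EB; ring].
Qed.

Let eterm_fsupp f g n : bounded_function f ->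
  (forall x, (n <= pickle x)%N -> g x = 0) ->
  rsummable (eterm f g) /\
  rsum (eterm f g) = 2 * psum (fun z => g z * rsum (fun y => w z y * (f z - f y))) n.
Proof.
move=> bf; elim: n g => [|n IHn] g gn.
  have -> : g = fun=> 0 by apply/funext => x; exact: gn.
  rewrite /psum big_nil mulr0.
  have -> : eterm f (fun=> 0) = fun=> 0.
    by apply/funext => p; rewrite /eterm subr0 mulr0.
  by split; [exact: rsummable0|exact: rsum0].
pose g' := truncation n g.
have g'n x : (n <= pickle x)%N -> g' x = 0 by move=> nx; rewrite /g' /truncation ltnNge nx.
have [s' E'] := IHn g' g'n.
have P' : psum (fun z => g' z * rsum (fun y => w z y * (f z - f y))) n =
    psum (fun z => g z * rsum (fun y => w z y * (f z - f y))) n.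
  apply: eq_big_nat => k /andP[_ kn]; rewrite /term.
  have := @pickle_invK X k; case: pickle_inv => //= z zk.
  by rewrite /g' /truncation zk kn.
have sE := @pickle_invK X n.
rewrite /psum big_nat_recr//= -/(psum _ n) -P' mulrDr -E' /term.
case En: (pickle_inv n) sE => [z|] /= zn.
  have [sd Ed] := eterm_delta z bf.
  have -> : eterm f g = fun p => g z * eterm f (delta R z) p + eterm f g' p.
    have Eg x : g x = g z * delta R z x + g' x.
      rewrite /g' /truncation /delta; case: eqVneq => [->|xz].
        by rewrite zn ltnn mulr1 addr0.
      rewrite mulr0 add0r; case: ltnP => // nx; apply: gn.
      rewrite ltn_neqAle nx andbT -zn; apply: contra_neq xz => xz.
      exact/esym/(pcan_inj pickleK).
    by apply/funext => p; rewrite /eterm (Eg p.1) (Eg p.2); ring.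
  split; first exact: rsummable_linear.
  by rewrite rsum_linear// Ed; ring.
rewrite mulr0 addr0; have -> // : g = g'.
apply/funext => x; rewrite /g' /truncation; case: ltnP => // nx; apply: gn.
rewrite ltn_neqAle nx andbT; apply/eqP => nE.
by have := @pickleK_inv X x; rewrite -nE En.
Qed.

Lemma rsummable_energy f g : bounded_function f -> fsupp g ->
  rsummable (fun p : X * X => w p.1 p.2 * (f p.1 - f p.2) * (g p.1 - g p.2)).
Proof. by move=> bf [n gn]; have [] := eterm_fsupp bf gn. Qed.

(** Here [f] is bounded but need not be finitely supported. The formula holds for delta functions
    and extends by induction on the support of [g], so no double series has to be rearranged. *)
Lemma form_green f g : bounded_function f -> fsupp g ->
  form f g = inner G (laplacian G f) g.
Proof.
move=> bf [n gn]; have [_ E] := eterm_fsupp bf gn.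
rewrite /Defs.form /inner [rsum (fun p : X * X => _)]E mulrA mulVf// mul1r.
have [_ ->] : rsummable (fun x => kappa x * f x * g x) /\
    rsum (fun x => kappa x * f x * g x) = psum (fun x => kappa x * f x * g x) n.
  by apply: rsum_finite => x /gn ->; rewrite mulr0.
have [_ ->] : rsummable (fun x => mu x * (laplacian G f x * g x)) /\
    rsum (fun x => mu x * (laplacian G f x * g x)) =
    psum (fun x => mu x * (laplacian G f x * g x)) n.
  by apply: rsum_finite => x /gn ->; rewrite !mulr0.
have -> : (fun x => mu x * (laplacian G f x * g x)) =
    (fun x => 1 * (g x * rsum (fun y => w x y * (f x - f y))) + kappa x * f x * g x).
  apply/funext => x; rewrite /laplacian; have := mass_neq0 x.
  by move: (mu x) => m m0; field; exact: m0.
by rewrite psum_linear mul1r.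
Qed.

Lemma form_sym f g : form f g = form g f.
Proof.
by rewrite /Defs.form; congr (_ * _ + _); congr rsum; apply/funext => x; rewrite mulrAC.
Qed.

Lemma form_linear (a : R) f g h : bounded_function f -> bounded_function g ->
  fsupp h -> form (fun x => a * f x + g x) h = a * form f h + form g h.
Proof.
move=> bf bg sh; have sk u : bounded_function u -> rsummable (fun x => kappa x * u x * h x).
  by move=> _; apply: fsupp_rsummable; apply: fsupp_le sh => x ->; rewrite mulr0.
have bfg := bounded_linear a bf bg.
rewrite /Defs.form.
have -> : (fun p : X * X => w p.1 p.2 * (a * f p.1 + g p.1 - (a * f p.2 + g p.2)) *
    (h p.1 - h p.2)) = (fun p => a * eterm f h p + eterm g h p).
  by apply/funext => p; rewrite /eterm; ring.
rewrite (rsum_linear a (rsummable_energy bf sh) (rsummable_energy bg sh)).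
have -> : (fun x => kappa x * (a * f x + g x) * h x) =
    (fun x => a * (kappa x * f x * h x) + kappa x * g x * h x).
  by apply/funext => x; ring.
rewrite rsum_linear; [|exact: sk|exact: sk].
by rewrite /eterm; ring.
Qed.

Lemma form_ge0 f : fsupp f -> 0 <= form f f.
Proof.
move=> sf; have bf := fsupp_bounded sf; rewrite /Defs.form addr_ge0//.
  rewrite mulr_ge0// rsum_ge0//; last exact: rsummable_energy.
  by move=> p; rewrite -mulrA mulr_ge0 ?weight_ge0// -expr2 sqr_ge0.
apply: rsum_ge0.
  by move=> x; rewrite -mulrA mulr_ge0 ?killing_ge0// -expr2 sqr_ge0.
by apply: fsupp_rsummable; apply: fsupp_le sf => x ->; rewrite mulr0.
Qed.

End Form.

(** * The Hilbert space of square-summable functions *)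

Section Squeeze.
Context (R : realType) (T : Type) (F : set_system T) {FF : ProperFilter F}.

Lemma cvg0_le (h k : T -> R) : (\forall t \near F, 0 <= h t <= k t) ->
  k t @[t --> F] --> 0 -> h t @[t --> F] --> 0.
Proof. by move=> hk k0; apply: (squeeze_cvgr hk) => //; exact: cvg_cst. Qed.

Lemma cvg_sub0_norm (h : T -> R) l : `|h t - l| @[t --> F] --> 0 ->
  h t @[t --> F] --> l.
Proof.
move=> /cvgrPdist_lt hl; apply/cvgrPdist_lt => e /hl; apply: filterS => t.
by rewrite sub0r normrN normr_id distrC.
Qed.

Lemma cvg0Z (a : R) (h : T -> R) : h t @[t --> F] --> 0 ->
  a * h t @[t --> F] --> 0.
Proof. by move=> h0; rewrite -(mulr0 a); apply: cvgMl_tmp. Qed.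

Lemma cvg0D (h k : T -> R) : h t @[t --> F] --> 0 -> k t @[t --> F] --> 0 ->
  h t + k t @[t --> F] --> 0.
Proof. by move=> h0 k0; rewrite -[X in _ --> X](addr0 (0 : R)); apply: cvgD. Qed.

Lemma cvg_ext (h k : T -> R) (l : R) : (forall t, h t = k t) ->
  h t @[t --> F] --> l -> k t @[t --> F] --> l.
Proof. by move=> /funext ->. Qed.

End Squeeze.

(* [ev] gives coordinates of vectors; it reduces module identities to [ring]. *)
Record hilbert (R : realType) := Hilbert {
  hcar :> lmodType R ;
  hidx : Type ;
  ev : hcar -> hidx -> R ;
  ip : hcar -> hcar -> R ;
  ev_linear : forall (a : R) u v x, ev (a *: u + v) x = a * ev u x + ev v x ;
  ev_ext : forall u v, (forall x, ev u x = ev v x) -> u = v ;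
  ipC : forall u v, ip u v = ip v u ;
  ip_linear : forall (a : R) u v z, ip (a *: u + v) z = a * ip u z + ip v z ;
  ip_ge0 : forall u, 0 <= ip u u ;
  ip_eq0 : forall u, ip u u = 0 -> u = 0 ;
  ip_complete : forall u : nat -> hcar,
    (forall e : R, 0 < e -> exists N, forall m n, (N <= m)%N -> (N <= n)%N ->
       Num.sqrt (ip (u m - u n) (u m - u n)) < e) ->
    exists v, Num.sqrt (ip (u n - v) (u n - v)) @[n --> \oo] --> 0
}.

Section Hilbert.
Variables (R : realType) (H : hilbert R).
Implicit Types (u v z : H).

Definition nrm u := Num.sqrt (ip u u).

Lemma evD u v x : ev (u + v) x = ev u x + ev v x.
Proof. by rewrite -[u]scale1r ev_linear mul1r scale1r. Qed.
Lemma ev0 x : ev (0 : H) x = 0.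
Proof. by apply: (addrI (ev (0 : H) x)); rewrite -evD !addr0. Qed.
Lemma evZ (a : R) u x : ev (a *: u) x = a * ev u x.
Proof. by rewrite -[a *: u]addr0 ev_linear ev0 addr0. Qed.
Lemma evN u x : ev (- u) x = - ev u x.
Proof. by rewrite -scaleN1r evZ mulN1r. Qed.
Definition evE := (evD, evN, evZ, ev0).

Lemma ipDl u v z : ip (u + v) z = ip u z + ip v z.
Proof. by rewrite -[u]scale1r ip_linear mul1r scale1r. Qed.
Lemma ip0l z : ip (0 : H) z = 0.
Proof. by apply: (addrI (ip (0 : H) z)); rewrite -ipDl !addr0. Qed.
Lemma ipZl a u z : ip (a *: u) z = a * ip u z.
Proof. by rewrite -[a *: u]addr0 ip_linear ip0l addr0. Qed.
Lemma ipNl u z : ip (- u) z = - ip u z.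
Proof. by rewrite -scaleN1r ipZl mulN1r. Qed.
Lemma ipDr z u v : ip z (u + v) = ip z u + ip z v.
Proof. by rewrite !(ipC z) ipDl. Qed.
Lemma ipZr a z u : ip z (a *: u) = a * ip z u.
Proof. by rewrite !(ipC z) ipZl. Qed.
Lemma ipNr z u : ip z (- u) = - ip z u.
Proof. by rewrite !(ipC z) ipNl. Qed.
Definition ipE := (ipDl, ipDr, ipZl, ipZr, ipNl, ipNr).

Lemma nrm_ge0 u : 0 <= nrm u. Proof. exact: sqrtr_ge0. Qed.
Lemma sqr_nrm u : nrm u ^+ 2 = ip u u. Proof. by rewrite sqr_sqrtr ?ip_ge0. Qed.

Lemma nrm_eq0 u : nrm u = 0 -> u = 0.
Proof. by move=> u0; apply: ip_eq0; rewrite -sqr_nrm u0 expr0n. Qed.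

Lemma nrm0 : nrm (0 : H) = 0. Proof. by rewrite /nrm ip0l sqrtr0. Qed.

Lemma nrmZ a u : nrm (a *: u) = `|a| * nrm u.
Proof. by rewrite /nrm ipZl ipZr mulrA -expr2 sqrtrM ?sqr_ge0// sqrtr_sqr. Qed.

Lemma nrmN u : nrm (- u) = nrm u.
Proof. by rewrite -scaleN1r nrmZ normrN1 mul1r. Qed.

Lemma nrmBC u v : nrm (u - v) = nrm (v - u).
Proof. by rewrite -nrmN opprB. Qed.

Lemma cauchy_schwarz u v : `|ip u v| <= nrm u * nrm v.
Proof.
have [v0|v0] := eqVneq (nrm v) 0.
  by rewrite (nrm_eq0 v0) ipC ip0l normr0 nrm0 mulr0.
have vp : 0 < nrm v by rewrite lt_def v0 nrm_ge0.
have vv : 0 < ip v v by rewrite -sqr_nrm exprn_gt0.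
rewrite -(@ler_pXn2r _ 2%N)// ?nnegrE ?mulr_ge0 ?nrm_ge0//.
rewrite exprMn !sqr_nrm -normrX ger0_norm ?sqr_ge0//.
have := ip_ge0 (u - (ip u v / ip v v) *: v); rewrite !ipE (ipC v u).
move: (ip u u) (ip u v) (ip v v) vv => a b c c0.
rewrite (_ : a + _ + _ = a - b ^+ 2 / c); last by field; exact: lt0r_neq0.
by rewrite subr_ge0 ler_pdivrMr.
Qed.

Lemma ler_nrmD u v : nrm (u + v) <= nrm u + nrm v.
Proof.
rewrite -(@ler_pXn2r _ 2%N)// ?nnegrE ?addr_ge0 ?nrm_ge0//.
rewrite sqrrD !sqr_nrm !ipE (ipC v u).
by have := le_trans (ler_norm _) (cauchy_schwarz u v); lra.
Qed.

Lemma ler_nrmB u v z : nrm (u - z) <= nrm (u - v) + nrm (v - z).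
Proof.
have -> : u - z = (u - v) + (v - z) by apply: ev_ext => x; rewrite !evE; ring.
exact: ler_nrmD.
Qed.

Lemma nrm_cvg_unique (u : nat -> H) v v' : nrm (u n - v) @[n --> \oo] --> 0 ->
  nrm (u n - v') @[n --> \oo] --> 0 -> v = v'.
Proof.
move=> uv uv'; apply/eqP; rewrite -subr_eq0; apply/eqP/nrm_eq0/le_anti.
rewrite nrm_ge0 andbT -[leRHS](addr0 (0 : R)).
apply: (cvgr_to_ge (cvgD uv uv')); apply: nearW => n /=.
by rewrite (le_trans (ler_nrmB v (u n) v'))// nrmBC.
Qed.

End Hilbert.

Section Ell2.
Variables (R : realType) (X : countType) (G : graph R X).
Local Notation mu := (mass G).
Implicit Types (f g : X -> R).

Lemma ell2_linear (a : R) f g : ell2 G f -> ell2 G g ->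
  ell2 G (fun x => a * f x + g x).
Proof.
move=> sf sg; apply: rsummable_le (rsummable_linear (2 * a ^+ 2) sf (rsummableZ 2 sg)) => x.
rewrite ger0_norm; last exact: mulr_ge0 (ltW (mass_gt0 _ _)) (sqr_ge0 _).
rewrite [leRHS](_ : _ = mu x * (2 * a ^+ 2 * f x ^+ 2 + 2 * g x ^+ 2)); last by ring.
rewrite ler_wpM2l ?(ltW (mass_gt0 _ _))//.
by have := sqr_ge0 (a * f x - g x); lra.
Qed.

Lemma fsupp_ell2 f : fsupp f -> ell2 G f.
Proof. by move=> sf; apply: fsupp_rsummable; apply: fsupp_le sf => x ->;
    rewrite expr0n/= mulr0. Qed.

Lemma rsummable_inner f g : ell2 G f -> ell2 G g ->
  rsummable (fun x => mu x * (f x * g x)).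
Proof.
move=> sf sg; apply: rsummable_le (rsummableD sf sg) => x.
rewrite -mulrDr normrM ger0_norm ?(ltW (mass_gt0 _ _))//.
rewrite ler_wpM2l ?(ltW (mass_gt0 _ _))// ler_norml.
have := sqr_ge0 (f x - g x); have := sqr_ge0 (f x + g x).
have := sqr_ge0 (f x); have := sqr_ge0 (g x).
by move=> *; apply/andP; split; nra.
Qed.

Lemma ell20 : ell2 G (fun=> 0).
Proof. exact/fsupp_ell2/fsupp0. Qed.

Definition ell2_pred : {pred X -> R} := fun f => `[< ell2 G f >].

Lemma ell2_submod_closed : submod_closed ell2_pred.
Proof.
split=> [|a f g]; first exact/asboolP/ell20.
by move=> /asboolP sf /asboolP sg; apply/asboolP; exact: ell2_linear.
Qed.

HB.instance Definition _ := GRing.isSubmodClosed.Build R (X -> R) ell2_pred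
    ell2_submod_closed.

Record l2 := L2 { l2val :> X -> R ; l2P : l2val \in ell2_pred }.
HB.instance Definition _ := [isSub for l2val].
HB.instance Definition _ := [Choice of l2 by <:].
HB.instance Definition _ := [SubChoice_isSubLmodule of l2 by <:].

Lemma l2_ell2 (u : l2) : ell2 G u.
Proof. exact/asboolP/l2P. Qed.

(** The default 0 outside ell^2 makes this total, and with it [heat] is defined on all functions. *)
Definition to_l2 f : l2 :=
  if pselect (ell2 G f) is left sf then L2 (introT (asboolP _) sf) else 0.

Lemma to_l2E f : ell2 G f -> l2val (to_l2 f) = f.
Proof. by rewrite /to_l2; case: pselect. Qed.

Lemma l2valK (u : l2) : to_l2 u = u.
Proof. by apply: val_inj => /=; rewrite to_l2E//; exact: l2_ell2. Qed.

Lemma l2_ext (u v : l2) : (forall x, u x = v x) -> u = v.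
Proof. by move=> uv; apply/val_inj/funext. Qed.

Lemma l2D (u v : l2) x : (u + v) x = u x + v x. Proof. by []. Qed.
Lemma l2N (u : l2) x : (- u) x = - u x. Proof. by []. Qed.
Lemma l2Z (a : R) (u : l2) x : (a *: u) x = a * u x. Proof. by []. Qed.
Lemma l20 x : (0 : l2) x = 0. Proof. by []. Qed.
Definition l2E := (l2D, l2N, l2Z, l20).

Lemma inner_sym f g : inner G f g = inner G g f.
Proof. by congr rsum; apply/funext => x; rewrite [f x * _]mulrC. Qed.

Lemma inner_linear (a : R) f g h : ell2 G f -> ell2 G g -> ell2 G h ->
  inner G (fun x => a * f x + g x) h = a * inner G f h + inner G g h.
Proof.
move=> sf sg sh; rewrite /inner -rsum_linear; try by apply: rsummable_inner.
by congr rsum; apply/funext => x; ring.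
Qed.

Lemma inner_ge0 f : ell2 G f -> 0 <= inner G f f.
Proof.
move=> sf; apply: rsum_ge0; last exact: rsummable_inner.
by move=> x; rewrite mulr_ge0 -?expr2 ?sqr_ge0// ltW// mass_gt0.
Qed.

Lemma ler_point_norm2 f x : ell2 G f -> `|f x| <= (Num.sqrt (mu x))^-1 * norm2 G f.
Proof.
move=> sf; have m0 : 0 < mu x by exact: mass_gt0.
rewrite ler_pdivlMl ?sqrtr_gt0// -(@ler_pXn2r _ 2%N)// ?nnegrE ?mulr_ge0 ?sqrtr_ge0//.
rewrite exprMn sqr_sqrtr ?(ltW m0)// sqr_sqrtr ?inner_ge0// real_normK ?num_real//.
rewrite expr2 /inner; apply: (@le_rsum1 _ _ (fun x => mu x * (f x * f x)) x).
  exact: rsummable_inner.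
by move=> y; rewrite mulr_ge0 -?expr2 ?sqr_ge0// ltW// mass_gt0.
Qed.

(** Fatou's lemma on partial sums: the Cauchy bound passes to the pointwise limit in each finite
    sum, then to the whole series. *)
Lemma ell2_limit (fn : nat -> X -> R) f : (forall n, ell2 G (fn n)) ->
  (forall x, fn n x @[n --> \oo] --> f x) ->
  (forall e : R, 0 < e -> exists N, forall m n, (N <= m)%N -> (N <= n)%N ->
     inner G (fn m \- fn n) (fn m \- fn n) < e) ->
  ell2 G f /\ norm2 G (fn n \- f) @[n --> \oo] --> 0.
Proof.
move=> sfn fnf fnC.
have sB m n : ell2 G (fn m \- fn n).
  have := ell2_linear (-1) (sfn n) (sfn m); congr ell2.
  by apply/funext => x /=; ring.
have key e : 0 < e -> exists N, forall n, (N <= n)%N ->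
    rsummable (fun x => mu x * ((fn n \- f) x * (fn n \- f) x)) /\
    inner G (fn n \- f) (fn n \- f) <= e.
  move=> e0; have [N NC] := fnC _ e0; exists N => n Nn.
  have pb k : psum (fun x => mu x * ((fn n \- f) x * (fn n \- f) x)) k <= e.
    pose h m := psum (fun x => mu x * ((fn n \- fn m) x * (fn n \- fn m) x)) k.
    have ch : h m @[m --> \oo] --> psum (fun x => mu x * ((fn n \- f) x * (fn n \- f) x)) k.
      rewrite /h /psum; apply: cvg_sum_nat => i; rewrite /term.
      case: pickle_inv => /= [x|]; last exact: cvg_cst.
      have c : fn n x - fn m x @[m --> \oo] --> fn n x - f x.
        by apply: cvgB; [exact: cvg_cst|exact: fnf].
      by apply: cvgMl_tmp; apply: cvgM.
    apply: (cvgr_to_le ch); exists N => // m /= Nm; apply: le_trans (ltW (NC _ _ Nn Nm)).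
    apply: psum_le_rsum; first by apply: rsummable_inner.
    by move=> x; rewrite mulr_ge0 -?expr2 ?sqr_ge0// ltW// mass_gt0.
  have s : rsummable (fun x => mu x * ((fn n \- f) x * (fn n \- f) x)).
    apply: (rsummable_bound _ pb) => x.
    by rewrite mulr_ge0 -?expr2 ?sqr_ge0// ltW// mass_gt0.
  by split=> //; exact: rsum_le_bound.
split.
  have [N /(_ N (leqnn N)) [s _]] := key 1 ltr01.
  have sd : ell2 G (fn N \- f).
    by move: s; congr rsummable; apply/funext => x; rewrite expr2.
  have := ell2_linear (-1) sd (sfn N); congr ell2; apply/funext => x /=; ring.
apply/cvgrPdist_le => e e0.
have [N Nk] := key (e ^+ 2) (exprn_gt0 _ e0); exists N => // n /= /Nk[_ le].
rewrite sub0r normrN ger0_norm ?sqrtr_ge0//.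
by rewrite -[leRHS](ger0_norm (ltW e0)) -[leRHS]sqrtr_sqr ler_wsqrtr.
Qed.

Lemma l2_complete (u : nat -> l2) :
  (forall e : R, 0 < e -> exists N, forall m n, (N <= m)%N -> (N <= n)%N ->
     norm2 G (u m - u n) < e) ->
  exists v, norm2 G (u n - v) @[n --> \oo] --> 0.
Proof.
move=> uC.
have pc x : cvgn (fun n => u n x).
  apply/cauchy_cvgP; apply: cauchy_exP => e e0.
  have s0 : 0 < Num.sqrt (mu x) by rewrite sqrtr_gt0 mass_gt0.
  have [N NC] := uC _ (mulr_gt0 e0 s0); exists (u N x); exists N => // n /= Nn.
  rewrite /ball/= -l2N -l2D; apply: (le_lt_trans (ler_point_norm2 _ (l2_ell2 _))).
  by rewrite ltr_pdivrMl// mulrC NC.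
have [sv uv] : ell2 G (fun x => limn (fun n => u n x)) /\
    norm2 G (l2val (u n) \- (fun x => limn (fun n => u n x))) @[n --> \oo] --> 0.
  apply: ell2_limit => //; first by move=> n; exact: l2_ell2.
  move=> e e0; have s0 : 0 < Num.sqrt e by rewrite sqrtr_gt0.
  have [N NC] := uC _ s0; exists N => m n Nm Nn.
  have := NC _ _ Nm Nn; rewrite -(@ltr_pXn2r _ 2%N)// ?nnegrE ?sqrtr_ge0//.
  by rewrite !sqr_sqrtr ?(ltW e0) ?inner_ge0//; exact: l2_ell2.
exists (to_l2 (fun x => limn (fun n => u n x))).
move: uv; apply: cvg_ext => n.
congr norm2; apply/funext => x /=.
by rewrite to_l2E.
Qed.

Lemma l2_hilbert_ip_eq0 (u : l2) : inner G u u = 0 -> u = 0.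
Proof.
move=> u0; apply: l2_ext => x; apply/eqP; rewrite -normr_le0.
by rewrite (le_trans (ler_point_norm2 x (l2_ell2 u)))// /norm2 u0 sqrtr0 mulr0.
Qed.

Definition l2h : hilbert R := @Hilbert R l2 X l2val (fun u v => inner G u v)
  (fun a u v x => erefl) l2_ext (fun u v => inner_sym u v)
  (fun a u v z => inner_linear a (l2_ell2 u) (l2_ell2 v) (l2_ell2 z))
  (fun u => inner_ge0 (l2_ell2 u)) l2_hilbert_ip_eq0 l2_complete.

Lemma norm2_nrm (u : l2h) : norm2 G (l2val u) = nrm u. Proof. by []. Qed.

Lemma ler_point_nrm (u : l2h) x : `|l2val u x| <= (Num.sqrt (mu x))^-1 * nrm u.
Proof. by rewrite -norm2_nrm; apply: ler_point_norm2; exact: l2_ell2. Qed.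

Lemma nrm_cvg_point (T : Type) (F : set_system T) {FF : ProperFilter F}
    (u : T -> l2h) (v : l2h) x : nrm (u t - v) @[t --> F] --> 0 ->
  l2val (u t) x @[t --> F] --> l2val v x.
Proof.
move=> uv; apply: cvg_sub0_norm.
apply: (cvg0_le _ (cvg0Z (Num.sqrt (mu x))^-1 uv)).
by apply: nearW => t; rewrite normr_ge0; exact: (ler_point_nrm (u t - v) x).
Qed.

Lemma nrm_truncation (f : X -> R) : ell2 G f ->
  nrm ((to_l2 (truncation n f) : l2h) - to_l2 f) @[n --> \oo] --> 0.
Proof.
move=> sf; have st n : ell2 G (truncation n f) by exact/fsupp_ell2/fsupp_truncation.
have c0 : inner G (truncation n f \- f) (truncation n f \- f) @[n --> \oo] --> 0.
  rewrite -[X in _ --> X](@rsum0 R X).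
  apply: (@rsum_dominated _ _ _ _ _ _ _ (fun x => mu x * f x ^+ 2)) => //.
    apply: nearW => n x /=; rewrite /truncation.
    have m0 := ltW (mass_gt0 G x).
    case: ifP => _; first by rewrite subrr !mulr0 normr0 mulr_ge0 ?sqr_ge0.
    by rewrite sub0r mulrNN -expr2 ger0_norm// mulr_ge0 ?sqr_ge0.
  move=> x; apply: cvg_near_cst; exists (pickle x).+1 => // n /= xn.
  by rewrite /truncation xn subrr !mulr0.
have := cvg_comp _ _ c0 (@sqrt_continuous R 0); rewrite sqrtr0.
apply: cvg_ext => n /=.
have E : l2val (to_l2 (truncation n f) - to_l2 f) = truncation n f \- f.
  by apply/funext => x; rewrite !l2E !to_l2E.
by rewrite -norm2_nrm /norm2 E.
Qed.

End Ell2.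

(** * Semigroups generated by maximal monotone operators *)

Section Monotone.
Variable R : realType.
Implicit Types (D : R -> R) (a b e : R).

(** The upper right Dini derivative is nonpositive and [D] does not jump upwards from the left.
    Hence the supremum of the times up to which [D s <= D a + e * (s - a)] holds throughout is
    itself such a time and cannot be smaller than [b]. Only right derivatives are needed, which is
    what semigroups and positive parts provide. *)
Lemma dini_nonincreasing D a b : a <= b ->
  (forall t, a < t <= b -> forall e, 0 < e -> exists2 d, 0 < d &
     forall s, t - d < s < t -> a <= s -> D t <= D s + e) ->
  (forall t, a <= t < b -> forall e, 0 < e -> exists2 d, 0 < d &
     forall s, t < s < t + d -> s <= b -> D s <= D t + e * (s - t)) ->
  D b <= D a.
Proof.
move=> ab lc rd; apply/ler_addgt0Pr => e' e'0.
have [e e0 ee'] : exists2 e, 0 < e & e * (b - a) <= e'.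
  exists (e' / (b - a + 1)); first by rewrite divr_gt0//; lra.
  rewrite mulrAC ler_pdivrMr; last by lra.
  by rewrite ler_wpM2l ?ltW//; lra.
pose A := [set t | a <= t <= b /\ forall s, a <= s <= t -> D s <= D a + e * (s - a)].
have Aa : A a.
  split; first by rewrite lexx.
  move=> s /andP[sa as']; have -> : s = a by apply/le_anti; rewrite sa as'.
  by rewrite subrr mulr0 addr0.
have hA : has_sup A by split; [exists a|exists b => t [/andP[]]].
pose c := sup A.
have ac : a <= c by apply: sup_upper_bound.
have cb : c <= b by apply: ge_sup; [exists a|move=> t [/andP[]]].
have below s : a <= s -> s < c -> D s <= D a + e * (s - a).
  move=> as' sc; have cs : 0 < c - s by lra.
  have [t [_ At] st] := sup_adherent cs hA.
  by apply: At; rewrite as' /=; move: st; rewrite -/c; lra.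
have Dc : D c <= D a + e * (c - a).
  have [<-|ac'] := eqVneq a c; first by rewrite subrr mulr0 addr0.
  have alc : a < c by rewrite lt_neqAle ac'.
  apply/ler_addgt0Pr => n n0.
  have [|d d0 dD] := lc c _ n n0; first by rewrite alc.
  pose s := Num.max a (c - d / 2).
  have sc : s < c by rewrite gt_max alc/=; lra.
  have as' : a <= s by rewrite le_max lexx.
  have sd : c - d < s by rewrite lt_max; apply/orP; right; lra.
  have h1 := dD s _ as'; have h2 := below s as' sc.
  have {}h1 : D c <= D s + n by apply: h1; rewrite sd sc.
  have h3 : e * (s - a) <= e * (c - a) by rewrite ler_wpM2l ?ltW//; lra.
  by lra.
have [cbE|cb'] := eqVneq c b.
  by rewrite -cbE in ee' *; apply: (le_trans Dc); rewrite lerD2l.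
have clb : c < b by rewrite lt_neqAle cb'.
have [|d d0 dD] := rd c _ e e0; first by rewrite ac.
pose t := Num.min b (c + d / 2).
have ct : c < t by rewrite lt_min clb/=; lra.
have tb : t <= b by rewrite ge_min lexx.
have At : A t.
  split; first by rewrite tb (le_trans ac) ?ltW.
  move=> s /andP[as' st]; case: (ltgtP s c) => [sc|cs|->] //; first exact: below.
  have sd : s < c + d by apply: (le_lt_trans st); rewrite gt_min; apply/orP; right; lra.
  have := dD s; rewrite cs sd => /(_ isT (le_trans st tb)) h.
  by apply: (le_trans h); move: Dc; lra.
by have := sup_upper_bound hA At; rewrite -/c leNgt ct.
Qed.

End Monotone.

Section LimitBounds.
Context (R : realType) (T : Type) (F : set_system T) {FF : ProperFilter F}.

Lemma le_cvg0 (c d : R) (k : T -> R) : (\forall t \near F, c <= d + k t) ->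
  k t @[t --> F] --> 0 -> c <= d.
Proof.
move=> cd k0; rewrite -subr_le0; apply: (cvgr_to_ge k0).
by apply: filterS cd => t; rewrite lerBlDl.
Qed.

End LimitBounds.

Section Resolvent.
Variables (R : realType) (H : hilbert R).
Variable A : H -> H -> Prop.
Hypothesis A_lin : forall (a : R) (u v u' v' : H), A u u' -> A v v' ->
  A (a *: u + v) (a *: u' + v').
Hypothesis A_mono : forall u u' : H, A u u' -> 0 <= ip u' u.
Hypothesis A_range : forall (h : R) (f : H), 0 < h -> exists u, A u (h^-1 *: (f - u)).
Hypothesis A_dense : forall (f : H) (e : R), 0 < e -> exists u u', A u u' /\ nrm (f
    - u) < e.
Implicit Types (f g u v : H) (h : R).

Ltac hring := apply: ev_ext => ?; rewrite !evE; ring.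

Definition resolvent h f : H := xget 0 [set u | A u (h^-1 *: (f - u))].
Local Notation J := resolvent.

Lemma JP h f : 0 < h -> A (J h f) (h^-1 *: (f - J h f)).
Proof.
move=> /(A_range f)[u Au].
by apply: (@xgetPex _ 0 [set u | A u (h^-1 *: (f - u))]); exists u.
Qed.

Lemma A0 : A 0 0.
Proof.
have [u [u' [Au _]]] := A_dense 0 ltr01.
by have := A_lin (-1) Au Au; rewrite !scaleN1r !addNr.
Qed.

Lemma AZ (a : R) u u' : A u u' -> A (a *: u) (a *: u').
Proof. by move=> /(A_lin a)/(_ A0); rewrite !addr0. Qed.

Lemma AB u v u' v' : A u u' -> A v v' -> A (u - v) (u' - v').
Proof.
move=> Au Av; have := A_lin (-1) Av Au; rewrite !scaleN1r.
by rewrite addrC [- v' + _]addrC.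
Qed.

Lemma J_uniq h f u : 0 < h -> A u (h^-1 *: (f - u)) -> u = J h f.
Proof.
move=> h0 Au; apply/eqP; rewrite -subr_eq0; apply/eqP/nrm_eq0.
have := A_mono (AB Au (JP f h0)).
have -> : h^-1 *: (f - u) - h^-1 *: (f - J h f) = (- h^-1) *: (u - J h f) by hring.
rewrite ipZl mulNr oppr_ge0 pmulr_rle0 ?invr_gt0// -sqr_nrm => le0.
by apply/eqP; rewrite -sqrf_eq0 eq_le le0 sqr_ge0.
Qed.

Lemma J_lin h (a : R) f g : 0 < h -> J h (a *: f + g) = a *: J h f + J h g.
Proof.
move=> h0; apply/esym/J_uniq => //.
have := A_lin a (JP f h0) (JP g h0); congr A; hring.
Qed.

Lemma J0 h : 0 < h -> J h 0 = 0.
Proof.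
move=> h0; apply/esym/J_uniq => //.
by rewrite subrr scaler0; exact: A0.
Qed.

Lemma JB h f g : 0 < h -> J h (f - g) = J h f - J h g.
Proof.
move=> h0; have -> : f - g = (-1) *: g + f by hring.
by rewrite J_lin//; hring.
Qed.

Lemma JZ h (a : R) f : 0 < h -> J h (a *: f) = a *: J h f.
Proof. by move=> h0; rewrite -[a *: f]addr0 J_lin// J0// addr0. Qed.

Lemma J_contr h f : 0 < h -> nrm (J h f) <= nrm f.
Proof.
move=> h0; have := A_mono (JP f h0).
rewrite ipZl pmulr_rge0 ?invr_gt0// ipDl ipNl -sqr_nrm subr_ge0 => le.
have := le_trans le (le_trans (ler_norm _) (cauchy_schwarz _ _)).
have [->|n0] := eqVneq (nrm (J h f)) 0; first by rewrite nrm_ge0.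
by rewrite expr2 ler_pM2r// lt_def n0 nrm_ge0.
Qed.

(** Apply [(1 + h A)^-1] to [f = (1 + h A) f - h k]. *)
Lemma J_eq h f k : 0 < h -> A f k -> J h f = f - h *: J h k.
Proof.
move=> h0 Af; apply/esym/J_uniq => //; have n0 := lt0r_neq0 h0.
have := AB Af (AZ h (JP k h0)); congr A; apply: ev_ext => x; rewrite !evE; field; exact: n0.
Qed.

Lemma J_comm h f k : 0 < h -> A f k -> A (J h f) (J h k).
Proof.
move=> h0 Af; have n0 := lt0r_neq0 h0.
have := JP f h0; congr A; rewrite [in LHS](J_eq h0 Af).
by apply: ev_ext => x; rewrite !evE; field; exact: n0.
Qed.

Lemma J_bound h f k : 0 < h -> A f k -> nrm (J h f - f) <= h * nrm k.
Proof.
move=> h0 Af; rewrite (J_eq h0 Af).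
have -> : f - h *: J h k - f = (- h) *: J h k by hring.
by rewrite nrmZ normrN gtr0_norm// ler_wpM2l ?(ltW h0)// J_contr.
Qed.

(** From [(1 + a A)^2 = (1 + 2 a A) + a^2 A^2]: the two sides differ by [a^2] times a product of
    three resolvents, all contractions, applied to [A^2 f]. *)
Lemma J_half (a : R) f f1 f2 : 0 < a -> A f f1 -> A f1 f2 ->
  nrm (J a (J a f) - J (2 * a) f) <= a ^+ 2 * nrm f2.
Proof.
move=> a0 Af Af1; have n0 := lt0r_neq0 a0; have a20 : 0 < 2 * a by lra.
pose u := J a (J a f); pose u1 := J a (J a f1); pose u2 := J a (J a f2).
have Au : A u u1 by apply: J_comm => //; exact: J_comm.
have E1 : J a f1 = u1 + a *: u2.
  by rewrite /u1 (J_eq a0 (J_comm a0 Af1)) -/u2; hring.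
have E : u = f - (2 * a) *: u1 - a ^+ 2 *: u2.
  rewrite /u (J_eq a0 (J_comm a0 Af)) -/u1 (J_eq a0 Af) E1; hring.
rewrite -/u; have -> : u = J (2 * a) (f - a ^+ 2 *: u2).
  apply: J_uniq => //; move: Au; congr A.
  by rewrite E; apply: ev_ext => x; rewrite !evE; field; exact: n0.
rewrite JB// JZ//.
have -> : J (2 * a) f - a ^+ 2 *: J (2 * a) u2 - J (2 * a) f = (- a ^+ 2) *: J (2 *
    a) u2 by hring.
rewrite nrmZ normrN ger0_norm ?sqr_ge0// ler_wpM2l ?sqr_ge0//.
by do 2 (apply: le_trans (J_contr _ _) _ => //); exact: J_contr.
Qed.

Definition itJ h n f := iter n (J h) f.

Lemma itJ_lin h n (a : R) f g : 0 < h ->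
  itJ h n (a *: f + g) = a *: itJ h n f + itJ h n g.
Proof. by move=> h0; elim: n => //= n ->; rewrite J_lin. Qed.

Lemma itJB h n f g : 0 < h -> itJ h n (f - g) = itJ h n f - itJ h n g.
Proof. by move=> h0; elim: n => //= n ->; rewrite JB. Qed.

Lemma itJ_contr h n f : 0 < h -> nrm (itJ h n f) <= nrm f.
Proof. by move=> h0; elim: n => //= n; apply: le_trans; exact: J_contr. Qed.

Lemma itJ_comm h n f k : 0 < h -> A f k -> A (itJ h n f) (itJ h n k).
Proof. by move=> h0 Af; elim: n => //= n; exact: J_comm. Qed.

Lemma itJ_bound h n f k : 0 < h -> A f k -> nrm (itJ h n f - f) <= n%:R * h * nrm k.
Proof.
move=> h0 Af; elim: n => [|n IHn] /=; first by rewrite subrr nrm0 !mul0r.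
apply: le_trans (ler_nrmB _ (itJ h n f) _) _.
rewrite -[n.+1%:R]natr1 !mulrDl mul1r addrC lerD//.
apply: le_trans (J_bound h0 (itJ_comm n h0 Af)) _.
by rewrite ler_wpM2l ?(ltW h0)// itJ_contr.
Qed.

(* Halving the step changes the Euler iterates by the order of the step, so the
   iterates with steps [2^-m] form a Cauchy sequence. *)
Lemma itJ_half (a : R) n f f1 f2 : 0 < a -> A f f1 -> A f1 f2 ->
  nrm (itJ a (n + n) f - itJ (2 * a) n f) <= n%:R * (a ^+ 2 * nrm f2).
Proof.
move=> a0 Af Af1; have a20 : 0 < 2 * a by lra.
elim: n => [|n IHn]; first by rewrite subrr nrm0 mul0r.
rewrite addSn addnS /=; apply: le_trans (ler_nrmB _ (J a (J a (itJ (2 * a) n f))) _) _.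
rewrite -[n.+1%:R]natr1 [leRHS]mulrDl mul1r lerD//.
  by rewrite -!JB//; do 2 (apply: le_trans (J_contr _ _) _ => //).
apply: le_trans (J_half a0 (itJ_comm n a20 Af) (itJ_comm n a20 Af1)) _.
by rewrite ler_wpM2l ?sqr_ge0// itJ_contr.
Qed.

(** Each step subtracts [h] times an iterate of [f1], and [itJ_bound] keeps that iterate within the
    elapsed time multiplied by [nrm f2] of [f1]. *)
Lemma itJ_taylor h n f f1 f2 : 0 < h -> A f f1 -> A f1 f2 ->
  nrm (itJ h n f - f + (n%:R * h) *: f1) <= (n%:R * h) ^+ 2 * nrm f2.
Proof.
move=> h0 Af Af1; elim: n => [|n IHn].
  by rewrite /= subrr mul0r scale0r addr0 nrm0 expr0n/= mul0r.
have -> : itJ h n.+1 f - f + (n.+1%:R * h) *: f1 =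
    (itJ h n f - f + (n%:R * h) *: f1) + (- h) *: (itJ h n.+1 f1 - f1).
  rewrite /= (J_eq h0 (itJ_comm n h0 Af)) -[n.+1%:R]natr1; hring.
apply: le_trans (ler_nrmD _ _) _; rewrite nrmZ normrN gtr0_norm//.
have := itJ_bound n.+1 h0 Af1.
move: IHn (nrm_ge0 f2); rewrite -[n.+1%:R]natr1; move: (nrm f2) => q.
set x := nrm (itJ h n f - f + _); set y := nrm (itJ h n.+1 f1 - f1).
move=> hx q0 hy.
have n0 : 0 <= n%:R :> R by [].
have hy' : h * y <= h * ((n%:R + 1) * h * q) by rewrite (ler_wpM2l (ltW h0)).
move: (n%:R) n0 x hx hy hy' => N N0 x hx hy hy'.
have h1 : 0 <= N * (h ^+ 2 * q) by apply: mulr_ge0 => //; apply: mulr_ge0 => //;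
    exact: sqr_ge0.
have -> : ((N + 1) * h) ^+ 2 * q = (N * h) ^+ 2 * q + 2 * (N * (h ^+ 2 * q)) + h ^+
    2 * q by ring.
apply: (le_trans (lerD hx hy')).
have -> : h * ((N + 1) * h * q) = N * (h ^+ 2 * q) + h ^+ 2 * q by ring.
by lra.
Qed.

Lemma J_dense f e : 0 < e -> exists2 h, 0 < h & nrm (J h f - f) < e.
Proof.
move=> e0; have e4 : 0 < e / 4 by lra.
have [g [k [Ag fg]]] := A_dense f e4; have k0 := nrm_ge0 k.
pose h := e / 4 / (nrm k + 1).
have h0 : 0 < h by rewrite divr_gt0//; lra.
have hk : h * nrm k <= e / 4.
  by rewrite /h mulrAC ler_pdivrMr; [rewrite ler_wpM2l ?ltW//; lra|lra].
clearbody h; exists h => //; have := ler_nrmB (J h f) (J h g) f;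
    have := ler_nrmB (J h g) g f.
have := J_bound h0 Ag; have := J_contr (f - g) h0; rewrite -JB// (nrmBC g f).
by lra.
Qed.

(** The domain of [A^2], where the second-order estimates are available, is reached by applying a
    resolvent with small [h] to an element of the domain of [A]. *)
Lemma A2_dense f e : 0 < e -> exists g g1 g2, [/\ A g g1, A g1 g2 & nrm (f - g) < e].
Proof.
move=> e0; have e2 : 0 < e / 2 by lra.
have [g [k [Ag fg]]] := A_dense f e2; have [h h0 hg] := J_dense g e2.
exists (J h g), (J h k), (h^-1 *: (k - J h k)); split; [exact: J_comm|exact: JP|].
by have := ler_nrmB f g (J h g); rewrite (nrmBC g); lra.
Qed.

Definition step (m : nat) : R := 2^-1 ^+ m.
(** Dyadic steps let [itJ_half] compare consecutive approximations; the last incomplete step is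
    dropped. *)
Definition backward_euler m (t : R) f := itJ (step m) (Num.truncn (t / step m)) f.
Local Notation T := backward_euler.

Lemma TE m t f : T m t f = itJ (step m) (Num.truncn (t / step m)) f.
Proof. by []. Qed.

Lemma step_gt0 m : 0 < step m. Proof. by rewrite exprn_gt0. Qed.
Lemma stepS m : step m = 2 * step m.+1.
Proof. by rewrite /step exprS; field. Qed.
Lemma step_cvg0 : step m @[m --> \oo] --> 0.
Proof. by apply: cvg_expr; rewrite ger0_norm//; lra. Qed.
#[local] Hint Resolve step_gt0 : core.

Lemma truncn_step m t : 0 <= t ->
  (Num.truncn (t / step m))%:R * step m <= t < ((Num.truncn (t / step m))%:R + 1) * step m.
Proof.
move=> t0; rewrite natr1 -ler_pdivlMr// -ltr_pdivrMr//.
by rewrite truncn_itv// divr_ge0// ltW.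
Qed.

Lemma T_lin m t (a : R) f g : T m t (a *: f + g) = a *: T m t f + T m t g.
Proof. exact: itJ_lin. Qed.
Lemma TB m t f g : T m t (f - g) = T m t f - T m t g.
Proof. exact: itJB. Qed.
Lemma T_contr m t f : nrm (T m t f) <= nrm f.
Proof. exact: itJ_contr. Qed.

Lemma itJ_succ h n f k : 0 < h -> A f k ->
  nrm (itJ h n.+1 f - itJ h n f) <= h * nrm k.
Proof.
move=> h0 Af; apply: le_trans (J_bound h0 (itJ_comm n h0 Af)) _.
by rewrite (ler_wpM2l (ltW h0))// itJ_contr.
Qed.

(** With half the step, the number of steps is twice the old one, which is the case of [itJ_half],
    or one more; the extra step accounts for the term in [nrm f1]. *)
Lemma T_succ m t f f1 f2 : 0 <= t -> A f f1 -> A f1 f2 ->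
  nrm (T m.+1 t f - T m t f) <= step m * (t * nrm f2 + nrm f1).
Proof.
move=> t0 Af Af1; rewrite !TE.
have := truncn_step m.+1 t0; have := truncn_step m t0.
set N := Num.truncn (t / step m); set N' := Num.truncn (t / step m.+1).
rewrite stepS; have := step_gt0 m.+1; move: (step m.+1) => a a0.
have a20 : 0 < 2 * a by lra.
move=> /andP[h1 h2] /andP[h3 h4].
have NN : (N + N <= N')%N.
  rewrite -ltnS -(ltr_nat R) -natr1 natrD -(ltr_pM2r a0); nra.
have NN2 : (N' <= (N + N).+1)%N.
  rewrite -ltnS -(ltr_nat R) -natr1 -natr1 natrD -(ltr_pM2r a0); nra.
apply: le_trans (ler_nrmB _ (itJ a (N + N) f) _) _.
have := itJ_half N a0 Af Af1.
have hN : nrm (itJ a N' f - itJ a (N + N) f) <= a * nrm f1.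
  move: NN2; rewrite leq_eqVlt => /orP[/eqP ->|]; first exact: itJ_succ.
  rewrite ltnS => NN2; have -> : N' = (N + N)%N by apply/eqP; rewrite eqn_leq NN NN2.
  by rewrite subrr nrm0 mulr_ge0 ?nrm_ge0 ?(ltW a0).
move=> hH; apply: (le_trans (lerD hN hH)).
have q0 := nrm_ge0 f2; have p0 := nrm_ge0 f1.
have : N%:R * (a ^+ 2 * nrm f2) <= a * (t * nrm f2).
  have -> : N%:R * (a ^+ 2 * nrm f2) = a * (N%:R * a * nrm f2) by ring.
  rewrite (ler_wpM2l (ltW a0))// ler_wpM2r//.
  have : 0 <= N%:R * a by rewrite mulr_ge0 ?(ltW a0).
  by lra.
have : 0 <= a * (t * nrm f2) by rewrite !mulr_ge0 ?(ltW a0).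
have : 0 <= a * nrm f1 by rewrite !mulr_ge0 ?(ltW a0).
by lra.
Qed.

Lemma T_cauchy2 m k t f f1 f2 : 0 <= t -> A f f1 -> A f1 f2 ->
  nrm (T (m + k) t f - T m t f) <=
    (2 * step m - 2 * step (m + k)) * (t * nrm f2 + nrm f1).
Proof.
move=> t0 Af Af1; elim: k => [|k IHk].
  by rewrite addn0 !subrr nrm0 mul0r.
rewrite addnS; apply: le_trans (ler_nrmB _ (T (m + k) t f) _) _.
apply: (le_trans (lerD (T_succ _ t0 Af Af1) IHk)).
by rewrite -mulrDl (stepS (m + k)) le_eqVlt; apply/orP; left; apply/eqP; ring.
Qed.

Lemma T_cauchy t f (e : R) : 0 <= t -> 0 < e -> exists N, forall m n,
  (N <= m)%N -> (N <= n)%N -> nrm (T m t f - T n t f) < e.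
Proof.
move=> t0 e0; have e8 : 0 < e / 8 by lra.
have [g [g1 [g2 [Ag Ag1 fg]]]] := A2_dense f e8.
pose C := t * nrm g2 + nrm g1.
have C0 : 0 <= C by rewrite addr_ge0 ?mulr_ge0 ?nrm_ge0.
have /cvgrPdist_lt/(_ (e / (8 * (C + 1)))) := step_cvg0.
case; first by rewrite divr_gt0//; lra.
move=> N _ Nstep; exists N => m n Nm Nn.
have sN : step N * C <= e / 8.
  have := Nstep N (leqnn N); rewrite /= sub0r normrN gtr0_norm// => hN.
  apply: (@le_trans _ _ (e / (8 * (C + 1)) * C)); first by rewrite ler_wpM2r// ltW.
  rewrite mulrAC ler_pdivrMr; last by lra.
  rewrite (_ : e / 8 * (8 * (C + 1)) = e * (C + 1)); last by field.
  by rewrite (ler_wpM2l (ltW e0))//; lra.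
have key k : (N <= k)%N -> nrm (T k t g - T N t g) <= e / 4.
  move=> Nk; have := T_cauchy2 N (k - N) t0 Ag Ag1; rewrite subnKC// -/C => h.
  apply: (le_trans h); have := mulr_ge0 (ltW (step_gt0 k)) C0; lra.
have hm := key m Nm; have hn := key n Nn.
have := ler_nrmB (T m t f) (T m t g) (T n t f).
have := ler_nrmB (T m t g) (T N t g) (T n t f).
have := ler_nrmB (T N t g) (T n t g) (T n t f).
rewrite (nrmBC (T N t g) (T n t g)) -!TB.
have := T_contr m t (f - g); have := T_contr n t (g - f); rewrite (nrmBC g f).
by lra.
Qed.

Definition semigroup (t : R) f : H :=
  xget 0 [set v | nrm (T n t f - v) @[n --> \oo] --> 0].
Local Notation S := semigroup.

Lemma S_cvg t f : 0 <= t -> nrm (T n t f - S t f) @[n --> \oo] --> 0.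
Proof.
move=> t0; have [v fv] := ip_complete (fun e e0 => @T_cauchy t f e t0 e0).
by apply: (@xgetPex _ 0 [set v | nrm (T n t f - v) @[n --> \oo] --> 0]); exists v.
Qed.

Lemma S_lim t f v : 0 <= t -> nrm (T n t f - v) @[n --> \oo] --> 0 -> S t f = v.
Proof. by move=> t0; apply: nrm_cvg_unique; exact: S_cvg. Qed.

Lemma S_le t f z (c : R) : 0 <= t -> (forall n, nrm (T n t f - z) <= c) ->
  nrm (S t f - z) <= c.
Proof.
move=> t0 Tc; apply: (le_cvg0 _ (S_cvg f t0)); apply: nearW => n.
by have := ler_nrmB (S t f) (T n t f) z; rewrite (nrmBC (S t f) (T n t f));
    have := Tc n; lra.
Qed.

Lemma S_contr t f : 0 <= t -> nrm (S t f) <= nrm f.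
Proof.
move=> t0; rewrite -[S t f]subr0; apply: S_le => // n.
by rewrite subr0 T_contr.
Qed.

Lemma S_lin t (a : R) f g : 0 <= t -> S t (a *: f + g) = a *: S t f + S t g.
Proof.
move=> t0; apply: S_lim => //.
have c : `|a| * nrm (T n t f - S t f) + nrm (T n t g - S t g) @[n --> \oo] --> 0.
  by apply: cvg0D; [apply: cvg0Z|]; exact: S_cvg.
apply: (cvg0_le _ c); apply: nearW => n; rewrite nrm_ge0 T_lin -nrmZ.
have -> : a *: T n t f + T n t g - (a *: S t f + S t g) =
  a *: (T n t f - S t f) + (T n t g - S t g) by hring.
exact: ler_nrmD.
Qed.

Lemma SB t f g : 0 <= t -> S t (f - g) = S t f - S t g.
Proof.
move=> t0; have -> : f - g = (-1) *: g + f by hring.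
by rewrite S_lin//; hring.
Qed.

Lemma S_0 f : S 0 f = f.
Proof.
apply: S_lim => //; apply: cvg_near_cst; apply: nearW => n.
by rewrite TE mul0r truncn0 /= subrr nrm0.
Qed.

Lemma S_bound t f k : 0 <= t -> A f k -> nrm (S t f - f) <= t * nrm k.
Proof.
move=> t0 Af; apply: S_le => // n; rewrite TE.
apply: le_trans (itJ_bound _ (step_gt0 n) Af) _.
by rewrite ler_wpM2r ?nrm_ge0//; have /andP[] := truncn_step n t0.
Qed.

Lemma S_taylor t f f1 f2 : 0 <= t -> A f f1 -> A f1 f2 ->
  nrm (S t f - f + t *: f1) <= t ^+ 2 * nrm f2.
Proof.
move=> t0 Af Af1; have q0 := nrm_ge0 f2.
have -> : S t f - f + t *: f1 = S t f - (f - t *: f1) by hring.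
have c : nrm (T n t f - S t f) + nrm f1 * step n @[n --> \oo] --> 0.
  apply: cvg0D; first exact: S_cvg.
  exact: cvg0Z step_cvg0.
apply: (le_cvg0 _ c); apply: nearW => m.
have := ler_nrmB (S t f) (T m t f) (f - t *: f1); rewrite (nrmBC (S t f) (T m t f)).
have := itJ_taylor (Num.truncn (t / step m)) (step_gt0 m) Af Af1; rewrite -TE.
have /andP[] := truncn_step m t0; set N := Num.truncn _ => h1 h2.
have N0 : 0 <= N%:R * step m by rewrite mulr_ge0 ?(ltW (step_gt0 m)).
have -> : T m t f - (f - t *: f1) =
  (T m t f - f + (N%:R * step m) *: f1) + (t - N%:R * step m) *: f1 by hring.
have := ler_nrmD (T m t f - f + (N%:R * step m) *: f1) ((t - N%:R * step m) *: f1).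
rewrite nrmZ ger0_norm ?subr_ge0//.
have : (t - N%:R * step m) * nrm f1 <= nrm f1 * step m.
  by rewrite mulrC ler_wpM2l ?nrm_ge0//; lra.
have : (N%:R * step m) ^+ 2 * nrm f2 <= t ^+ 2 * nrm f2.
  by rewrite ler_wpM2r// ler_pXn2r// nnegrE.
by lra.
Qed.

(** On the domain of [A]: the step count for [s + t] exceeds the sum of those for [s] and [t] by at
    most one, which costs [step n * nrm k]. Density and contractivity give the general case. *)
Lemma S_semigroup s t f : 0 <= s -> 0 <= t -> S (s + t) f = S s (S t f).
Proof.
move=> s0 t0; have st0 : 0 <= s + t by exact: addr_ge0.
have onD g k : A g k -> S (s + t) g = S s (S t g).
  move=> Ag; apply: S_lim => //.
  have c : nrm k * step n + (nrm (T n t g - S t g) + nrm (T n s (S t g) - S s (S t g)))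
      @[n --> \oo] --> 0.
    apply: cvg0D; first exact: cvg0Z step_cvg0.
    apply: cvg0D; exact: S_cvg.
  apply: (cvg0_le _ c); apply: nearW => m; rewrite nrm_ge0/=.
  have := ler_nrmB (T m (s + t) g) (T m s (T m t g)) (S s (S t g)).
  have := ler_nrmB (T m s (T m t g)) (T m s (S t g)) (S s (S t g)).
  rewrite -TB; have := T_contr m s (T m t g - S t g).
  suff : nrm (T m (s + t) g - T m s (T m t g)) <= nrm k * step m by lra.
  rewrite !TE /itJ -iterD.
  have := truncn_step m s0; have := truncn_step m t0; have := truncn_step m st0.
  set N1 := Num.truncn _; set N2 := Num.truncn _; set N3 := Num.truncn _.
  have h0 := step_gt0 m; move: (step m) h0 => h h0.
  move=> /andP[a1 a2] /andP[a3 a4] /andP[a5 a6].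
  have NN : (N3 + N2 <= N1)%N.
    rewrite -ltnS -(ltr_nat R) -natr1 natrD -(ltr_pM2r h0); nra.
  have NN2 : (N1 <= (N3 + N2).+1)%N.
    rewrite -ltnS -(ltr_nat R) -natr1 -natr1 natrD -(ltr_pM2r h0); nra.
  move: NN2; rewrite leq_eqVlt => /orP[/eqP ->|].
    by rewrite mulrC; exact: itJ_succ.
  rewrite ltnS => NN2; have -> : N1 = (N3 + N2)%N by apply/eqP; rewrite eqn_leq NN NN2.
  by rewrite subrr nrm0 mulr_ge0 ?nrm_ge0 ?(ltW h0).
apply/eqP; rewrite -subr_eq0; apply/eqP/nrm_eq0/le_anti; rewrite nrm_ge0 andbT.
apply/ler_addgt0Pr => e e0; rewrite add0r; have e2 : 0 < e / 2 by lra.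
have [g [k [Ag fg]]] := A_dense f e2.
have -> : S (s + t) f - S s (S t f) = S (s + t) (f - g) - S s (S t (f - g)).
  rewrite (SB f g st0) (SB f g t0) (SB (S t f) (S t g) s0) (onD g k Ag).
  by rewrite opprB addrA subrK.
have := ler_nrmB (S (s + t) (f - g)) 0 (S s (S t (f - g))).
rewrite subr0 sub0r nrmN.
have := S_contr (f - g) st0; have := S_contr (S t (f - g)) s0; have := S_contr (f - g) t0.
by lra.
Qed.

Lemma S_cont0 f : nrm (S t f - f) @[t --> 0^'+] --> 0.
Proof.
apply/cvgrPdist_le => e e0; have e4 : 0 < e / 4 by lra.
have [g [k [Ag fg]]] := A_dense f e4; have k0 := nrm_ge0 k.
near=> t.
have t0 : 0 < t by [].
have tk : t * (nrm k + 1) <= e / 4.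
  by rewrite -ler_pdivlMr; [near: t; apply: nbhs_right_le; rewrite divr_gt0//; lra|lra].
rewrite sub0r normrN ger0_norm ?nrm_ge0//.
have := ler_nrmB (S t f) (S t g) f; have := ler_nrmB (S t g) g f;
    rewrite -(SB f g (ltW t0)).
have := S_contr (f - g) (ltW t0); have := S_bound (ltW t0) Ag; rewrite (nrmBC g f).
by lra.
Unshelve. all: by end_near. Qed.

(** The second-order expansion applies to [g = J h f]. The difference quotient of [f - g] is bounded
    by the norm of its image [k - J h k], which is small for a suitable [h]. *)
Lemma S_generator f k : A f k -> nrm (t^-1 *: (S t f - f) + k) @[t --> 0^'+] --> 0.
Proof.
move=> Af; apply/cvgrPdist_le => e e0; have e4 : 0 < e / 4 by lra.
have [h h0 hk] := J_dense k e4.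
pose g := J h f; pose g1 := J h k; pose g2 := h^-1 *: (k - J h k).
have Ag : A g g1 by exact: J_comm.
have Ag1 : A g1 g2 by exact: JP.
have q0 := nrm_ge0 g2.
near=> t.
have t0 : 0 < t by [].
have tk : t * (nrm g2 + 1) <= e / 4.
  by rewrite -ler_pdivlMr; [near: t; apply: nbhs_right_le; rewrite divr_gt0//; lra|lra].
rewrite sub0r normrN ger0_norm ?nrm_ge0//.
have tn := lt0r_neq0 t0.
have -> : t^-1 *: (S t f - f) + k =
  t^-1 *: (S t (f - g) - (f - g)) + (t^-1 *: (S t g - g + t *: g1) + (k - g1)).
  by rewrite SB ?(ltW t0)//; apply: ev_ext => x; rewrite !evE; field; exact: tn.
have := ler_nrmD (t^-1 *: (S t (f - g) - (f - g))) (t^-1 *: (S t g - g + t *: g1) +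
    (k - g1)).
have := ler_nrmD (t^-1 *: (S t g - g + t *: g1)) (k - g1).
rewrite !nrmZ gtr0_norm ?invr_gt0//.
have h1 : t^-1 * nrm (S t (f - g) - (f - g)) <= nrm (k - g1).
  by rewrite ler_pdivrMl//; apply: S_bound (ltW t0) _; exact: AB.
have h2 : t^-1 * nrm (S t g - g + t *: g1) <= t * nrm g2.
  rewrite ler_pdivrMl// mulrA -expr2; exact: S_taylor (ltW t0) Ag Ag1.
have := hk; rewrite nrmBC -/g1.
by lra.
Unshelve. all: by end_near. Qed.

Lemma S_dissipative t u : 0 <= t -> ip (S t u - u) u <= 0.
Proof.
move=> t0; rewrite ipDl ipNl -sqr_nrm subr_le0 expr2.
apply: le_trans (ler_norm _) _; apply: le_trans (cauchy_schwarz _ _) _.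
by rewrite ler_wpM2r ?nrm_ge0// S_contr.
Qed.

(** Maximality of [A]: with [g = J 1 (f + k)], the difference [d = g - f] satisfies [B d = d] for
    the generator [B] of the semigroup, and [B] is dissipative, so [d = 0]. *)
Lemma S_generator_inv f k :
  nrm (t^-1 *: (S t f - f) + k) @[t --> 0^'+] --> 0 -> A f k.
Proof.
move=> Sf; pose g := J 1 (f + k).
have Ag : A g (f + k - g) by have := JP (f + k) ltr01; rewrite invr1 scale1r.
have Sg := S_generator Ag.
have c : nrm (t^-1 *: (S t g - g) + (f + k - g)) + nrm (t^-1 *: (S t f - f) + k)
    @[t --> 0^'+] --> 0 by exact: cvg0D.
pose d := g - f.
have dd : nrm d ^+ 2 <= 0.
  apply: (le_cvg0 _ (cvg0Z (nrm d) c)); near=> t.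
  have t0 : 0 < t by [].
  have tn := lt0r_neq0 t0.
  rewrite add0r.
  have E : t^-1 *: (S t d - d) - d =
    (t^-1 *: (S t g - g) + (f + k - g)) - (t^-1 *: (S t f - f) + k).
    by rewrite SB ?(ltW t0)//; rewrite /d; hring.
  have := ler_nrmB (t^-1 *: (S t g - g) + (f + k - g)) 0 (t^-1 *: (S t f - f) + k).
  rewrite subr0 sub0r nrmN -E => h.
  have h2 : nrm d ^+ 2 <= ip (d - t^-1 *: (S t d - d)) d.
    rewrite ipDl ipNl ipZl sqr_nrm lerDl oppr_ge0 pmulr_rle0 ?invr_gt0//.
    by apply: S_dissipative; rewrite ltW.
  apply: (le_trans h2); apply: le_trans (ler_norm _) _.
  apply: le_trans (cauchy_schwarz _ _) _; rewrite mulrC ler_wpM2l ?nrm_ge0//.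
  by rewrite nrmBC.
have d0 : g = f.
  apply/eqP; rewrite -subr_eq0; apply/eqP/nrm_eq0/eqP; rewrite -sqrf_eq0.
  by rewrite eq_le dd sqr_ge0.
by move: Ag; rewrite d0 addrAC subrr add0r.
Unshelve. all: by end_near. Qed.

(** Vector form of [heat_semigroup], shared by the semigroup just constructed and by an arbitrary
    competitor in the uniqueness proof. *)
Record semigroup_of (W : R -> H -> H) : Prop := SemigroupOf {
  sg_contr : forall t f, 0 <= t -> nrm (W t f) <= nrm f ;
  sg_lin : forall t (a : R) f g, 0 <= t -> W t (a *: f + g) = a *: W t f + W t g ;
  sg_0 : forall f, W 0 f = f ;
  sg_D : forall s t f, 0 <= s -> 0 <= t -> W (s + t) f = W s (W t f) ;
  sg_cont0 : forall f, nrm (W t f - f) @[t --> 0^'+] --> 0 ;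
  sg_gen : forall f k, A f k <-> nrm (t^-1 *: (W t f - f) + k) @[t --> 0^'+] --> 0
}.

Lemma S_semigroup_of : semigroup_of S.
Proof.
split; [exact: S_contr|exact: S_lin|exact: S_0|exact: S_semigroup|exact: S_cont0|].
by move=> f k; split; [exact: S_generator|exact: S_generator_inv].
Qed.

(** * Time regularity and uniqueness of the semigroup *)

Section SemigroupOf.
Variable W : R -> H -> H.
Hypothesis sgW : semigroup_of W.

Lemma sgB t f g : 0 <= t -> W t (f - g) = W t f - W t g.
Proof.
move=> t0; have -> : f - g = (-1) *: g + f by hring.
by rewrite (sg_lin sgW)//; hring.
Qed.

Lemma sg_right t f k (e : R) : 0 <= t -> A f k -> 0 < e -> exists2 d, 0 < d &
  forall s, t < s < t + d -> nrm (W s f - W t f + (s - t) *: W t k) <= (s - t) * e.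
Proof.
move=> t0 Af e0; have /cvgrPdist_le/(_ _ e0) := (sg_gen sgW f k).1 Af.
rewrite near_withinE => -[d /= d0 dP]; exists d => // s /andP[ts std].
have st0 : 0 < s - t by lra.
have sn := lt0r_neq0 st0.
have -> : W s f - W t f + (s - t) *: W t k =
    (s - t) *: W t ((s - t)^-1 *: (W (s - t) f - f) + k).
  have -> : W s f = W t (W (s - t) f).
    by rewrite -(sg_D sgW) ?(ltW st0)//; congr W; ring.
  rewrite (sg_lin sgW)// sgB//.
  by apply: ev_ext => x; rewrite !evE; field; exact: sn.
rewrite nrmZ gtr0_norm// (ler_wpM2l (ltW st0))//.
apply: le_trans (sg_contr sgW _ t0) _.
have := dP (s - t); rewrite /ball/= sub0r normrN gtr0_norm// => /(_ _ st0).
by rewrite sub0r normrN ger0_norm ?nrm_ge0//; apply; lra.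
Qed.

Lemma sg_left t f (e : R) : 0 < e -> exists2 d, 0 < d &
  forall s, t - d < s < t -> 0 <= s -> nrm (W t f - W s f) <= e.
Proof.
move=> e0; have /cvgrPdist_le/(_ _ e0) := sg_cont0 sgW f.
rewrite near_withinE => -[d /= d0 dP]; exists d => // s /andP[ts std] s0.
have st0 : 0 < t - s by lra.
have -> : W t f - W s f = W s (W (t - s) f - f).
  by rewrite sgB// -(sg_D sgW) ?(ltW st0)//; congr (W _ _ - _); ring.
apply: le_trans (sg_contr sgW _ s0) _.
have := dP (t - s); rewrite /ball/= sub0r normrN gtr0_norm// => /(_ _ st0).
by rewrite sub0r normrN ger0_norm ?nrm_ge0//; apply; lra.
Qed.

Lemma sg_right_cont t f (e : R) : 0 <= t -> 0 < e -> exists2 d, 0 < d &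
  forall s, t < s < t + d -> nrm (W s f - W t f) <= e.
Proof.
move=> t0 e0; have /cvgrPdist_le/(_ _ e0) := sg_cont0 sgW f.
rewrite near_withinE => -[d /= d0 dP]; exists d => // s /andP[ts std].
have st0 : 0 < s - t by lra.
have -> : W s f - W t f = W t (W (s - t) f - f).
  by rewrite sgB// -(sg_D sgW) ?(ltW st0)//; congr (W _ _ - _); ring.
apply: le_trans (sg_contr sgW _ t0) _.
have := dP (s - t); rewrite /ball/= sub0r normrN gtr0_norm// => /(_ _ st0).
by rewrite sub0r normrN ger0_norm ?nrm_ge0//; apply; lra.
Qed.

(** To the left of [t], factor out [W s]: contractivity transports the difference quotient at 0, and
    left continuity of [W t k] replaces [W s k] by it. *)
Lemma sg_deriv t f k (e : R) : 0 < t -> A f k -> 0 < e -> exists2 d, 0 < d &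
  forall s, `|s - t| < d -> nrm (W s f - W t f + (s - t) *: W t k) <= `|s - t| * e.
Proof.
move=> t0 Af e0; have e2 : 0 < e / 2 by lra.
have [d1 d10 h1] := sg_right (ltW t0) Af e0; have [d3 d30 h3] := sg_left t k e2.
have /cvgrPdist_le/(_ _ e2) := (sg_gen sgW f k).1 Af.
rewrite near_withinE => -[d2 /= d20 h2].
exists (Num.min (Num.min d1 d2) (Num.min d3 t)) => [|s].
  by rewrite !lt_min d10 d20 d30.
rewrite !lt_min => /andP[/andP[s1 s2] /andP[s3 s4]].
case: (ltgtP s t) => [st|ts|->].
- have tau0 : 0 < t - s by lra.
  have E : `|s - t| = t - s by rewrite distrC gtr0_norm.
  rewrite E in s1 s2 s3 s4 *; have s0 : 0 <= s by lra.
  have tn := lt0r_neq0 tau0.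
  have -> : W s f - W t f + (s - t) *: W t k =
    (- (t - s)) *: (W s ((t - s)^-1 *: (W (t - s) f - f) + k) + (W t k - W s k)).
    have -> : W t f = W s (W (t - s) f).
      by rewrite -(sg_D sgW) ?(ltW tau0)//; congr W; ring.
    rewrite (sg_lin sgW)// sgB//.
    by apply: ev_ext => x; rewrite !evE; field; exact: tn.
  rewrite nrmZ normrN gtr0_norm// (ler_wpM2l (ltW tau0))//.
  apply: le_trans (ler_nrmD _ _) _.
  have k1 : nrm (W t k - W s k) <= e / 2 by apply: h3 => //; apply/andP; split; lra.
  have k2 : nrm ((t - s)^-1 *: (W (t - s) f - f) + k) <= e / 2.
    have := h2 (t - s); rewrite /ball/= sub0r normrN gtr0_norm// => /(_ s2 tau0).
    by rewrite sub0r normrN ger0_norm ?nrm_ge0.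
  have := sg_contr sgW ((t - s)^-1 *: (W (t - s) f - f) + k) s0.
  by lra.
- have E : `|s - t| = s - t by rewrite gtr0_norm// subr_gt0.
  by rewrite E in s1 *; apply: h1; apply/andP; split; lra.
- by rewrite !subrr scale0r addr0 nrm0 normr0 mul0r.
Qed.

Lemma sg_dom t f k : 0 <= t -> A f k -> A (W t f) (W t k).
Proof.
move=> t0 Af; apply/(sg_gen sgW); have := (sg_gen sgW f k).1 Af.
apply: cvg0_le; near=> s.
have s0 : 0 < s by [].
rewrite nrm_ge0 /=; apply: le_trans (sg_contr sgW _ t0).
by rewrite (sg_lin sgW)// sgB// -!(sg_D sgW) ?(ltW s0)// [t + s]addrC.
Unshelve. all: by end_near. Qed.

End SemigroupOf.

Lemma sqr_nrm_shift u v z (a : R) : nrm (u + (v - a *: z)) ^+ 2 =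
  nrm u ^+ 2 + 2 * ip u v - 2 * (a * ip u z) + nrm (v - a *: z) ^+ 2.
Proof. by rewrite !sqr_nrm !ipE !(ipC _ u); ring. Qed.

(** Energy argument: for [g] in the domain, the square of [nrm (V s g - W s g)] vanishes at 0 and
    has right derivative [- 2 * ip (d s) (c s)], which is nonpositive by monotonicity. Density does
    the rest. *)
Lemma semigroup_unique V W : semigroup_of V -> semigroup_of W ->
  forall t f, 0 <= t -> V t f = W t f.
Proof.
move=> sV sW t f t0.
have onD g k : A g k -> V t g = W t g.
  move=> Ag; pose d s := V s g - W s g; pose c s := V s k - W s k.
  pose D s := nrm (d s) ^+ 2.
  have Ad s : 0 <= s -> A (d s) (c s) by move=> s0; apply: AB; exact: sg_dom.
  have dM s : 0 <= s -> nrm (d s) <= 2 * nrm g.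
    move=> s0; have := ler_nrmB (V s g) 0 (W s g); rewrite subr0 sub0r nrmN.
    by have := sg_contr sV g s0; have := sg_contr sW g s0; rewrite -/(d s); lra.
  have : D t <= D 0.
    apply: dini_nonincreasing => //.
    - move=> s /andP[s0 st] e e0; have M0 := nrm_ge0 g.
      (* For [0 <= y <= 2 |g|] and [e1 <= 1] one has [(y + 2 e1)^2 <= y^2 + e1 (8 |g| + 4)]. *)
      pose e1 := Num.min 1 (e / (8 * nrm g + 4)).
      have e10 : 0 < e1 by rewrite lt_min ltr01 divr_gt0//; lra.
      have e11 : e1 <= 1 by rewrite ge_min lexx.
      have e12 : e1 * (8 * nrm g + 4) <= e.
        rewrite -ler_pdivlMr; last by lra.
        by rewrite ge_min lexx orbT.
      have [d1 d10 h1] := sg_left sV s g e10; have [d2 d20 h2] := sg_left sW s g e10.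
      exists (Num.min d1 d2) => [|r]; first by rewrite lt_min d10.
      move=> /andP[sr rs] r0.
      have /andP[r1 r2] : (s - d1 < r) && (s - d2 < r).
        by move: sr; rewrite ltrBlDr -ltrBlDl lt_min => /andP[? ?]; apply/andP; split; lra.
      have {h1} := h1 r; rewrite r1 rs => /(_ isT r0) h1.
      have {h2} := h2 r; rewrite r2 rs => /(_ isT r0) h2.
      have : nrm (d s) <= nrm (d r) + 2 * e1.
        have -> : d s = d r + ((V s g - V r g) - (W s g - W r g)) by rewrite /d; hring.
        apply: le_trans (ler_nrmD _ _) _; rewrite lerD2l.
        have := ler_nrmB (V s g - V r g) 0 (W s g - W r g).
        by rewrite subr0 sub0r nrmN; lra.
      have := dM r r0; have := nrm_ge0 (d s); have := nrm_ge0 (d r); rewrite /D.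
      by move: (nrm (d s)) (nrm (d r)) => x y; nra.
    - move=> s /andP[s0 st] e e0.
      have q0 := nrm_ge0 (d s); have p0 := nrm_ge0 (c s).
      pose e1 := e / (8 * (nrm (d s) + 1)).
      have e10 : 0 < e1 by rewrite divr_gt0//; lra.
      have e11 : e1 * (8 * (nrm (d s) + 1)) = e.
        by rewrite /e1 divfK// gt_eqF//; lra.
      pose C := (2 * e1 + nrm (c s)) ^+ 2.
      have C0 : 0 <= C by exact: sqr_ge0.
      have [d1 d10 h1] := sg_right sV s0 Ag e10; have [d2 d20 h2] := sg_right sW s0 Ag e10.
      pose d3 := e / (2 * (C + 1)).
      have d30 : 0 < d3 by rewrite divr_gt0//; lra.
      have d31 : d3 * (2 * (C + 1)) = e by rewrite /d3 divfK// gt_eqF//; lra.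
      exists (Num.min (Num.min d1 d2) d3) => [|r]; first by rewrite !lt_min d10 d20.
      rewrite -ltrBlDl !lt_min => /andP[sr /andP[/andP[r1 r2] r3]] rt.
      have {h1} := h1 r; rewrite -ltrBlDl sr r1 => /(_ isT) h1.
      have {h2} := h2 r; rewrite -ltrBlDl sr r2 => /(_ isT) h2.
      have tau0 : 0 < r - s by lra.
      pose rho := (V r g - V s g + (r - s) *: V s k) - (W r g - W s g + (r - s) *: W s k).
      have hrho : nrm rho <= 2 * ((r - s) * e1).
        have := ler_nrmB (V r g - V s g + (r - s) *: V s k) 0
           (W r g - W s g + (r - s) *: W s k).
        by rewrite subr0 sub0r nrmN -/rho; lra.
      have E : d r = d s + (rho - (r - s) *: c s) by rewrite /rho /d /c; hring.
      have hz : nrm (rho - (r - s) *: c s) <= (r - s) * (2 * e1 + nrm (c s)).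
        have := ler_nrmB rho 0 ((r - s) *: c s).
        by rewrite subr0 sub0r nrmN nrmZ gtr0_norm//; lra.
      have hz2 : nrm (rho - (r - s) *: c s) ^+ 2 <= (r - s) ^+ 2 * C.
        rewrite /C -exprMn ler_pXn2r// nnegrE ?nrm_ge0// mulr_ge0 ?(ltW tau0)//.
        by rewrite addr_ge0// mulr_ge0// ltW.
      have hip : 2 * ip (d s) rho <= 4 * nrm (d s) * ((r - s) * e1).
        have := le_trans (ler_norm _) (cauchy_schwarz (d s) rho).
        by have : nrm (d s) * nrm rho <= nrm (d s) * (2 * ((r - s) * e1));
           [rewrite ler_wpM2l|lra].
      have hm : 0 <= (r - s) * ip (d s) (c s).
        by rewrite mulr_ge0 ?(ltW tau0)// ipC; apply: A_mono; exact: Ad.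
      have -> : D r = D s + 2 * ip (d s) rho - 2 * ((r - s) * ip (d s) (c s)) +
          nrm (rho - (r - s) *: c s) ^+ 2.
        by rewrite /D E; exact: sqr_nrm_shift.
      have h4 : (r - s) ^+ 2 * C <= (r - s) * (e / 2).
        rewrite expr2 -mulrA (ler_wpM2l (ltW tau0))//.
        have : (r - s) * C <= d3 * C by rewrite ler_wpM2r// ltW.
        by lra.
      have h5 : 4 * nrm (d s) * ((r - s) * e1) <= (r - s) * (e / 2).
        have -> : 4 * nrm (d s) * ((r - s) * e1) = (r - s) * (4 * nrm (d s) * e1) by ring.
        rewrite (ler_wpM2l (ltW tau0))//.
        by have := ltW e10; lra.
      by rewrite [e * _]mulrC; lra.
  rewrite /D /d (sg_0 sV) (sg_0 sW) subrr nrm0 expr0n/= => le0.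
  apply/eqP; rewrite -subr_eq0; apply/eqP/nrm_eq0/eqP; rewrite -sqrf_eq0.
  by rewrite eq_le le0 sqr_ge0.
apply/eqP; rewrite -subr_eq0; apply/eqP/nrm_eq0/le_anti; rewrite nrm_ge0 andbT.
apply/ler_addgt0Pr => e e0; rewrite add0r; have e2 : 0 < e / 2 by lra.
have [g [k [Ag fg]]] := A_dense f e2.
have -> : V t f - W t f = V t (f - g) - W t (f - g).
  by rewrite !sgB// (onD g k Ag); hring.
have := ler_nrmB (V t (f - g)) 0 (W t (f - g)); rewrite subr0 sub0r nrmN.
by have := sg_contr sV (f - g) t0; have := sg_contr sW (f - g) t0; lra.
Qed.

End Resolvent.

(** * The operator of the closed form *)

Section Quadratic.
Variable R : realType.

(** The discriminant is nonpositive; for [e = 0] the polynomial is affine and [b] must vanish. It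
    serves both the Cauchy-Schwarz inequality of the form and the first variation of
    near-minimizers. *)
Lemma quadratic_bound (d b e : R) : 0 <= e ->
  (forall t, 0 <= d + 2 * t * b + t ^+ 2 * e) -> b ^+ 2 <= d * e.
Proof.
move=> e0 h; have [e00|en] := eqVneq e 0.
  rewrite e00 mulr0; have [->|bn] := eqVneq b 0; first by rewrite expr0n.
  have := h (- (d + 1) / (2 * b)).
  rewrite e00 mulr0 addr0 (_ : 2 * _ * b = - (d + 1)); last by field.
  by lra.
have ep : 0 < e by rewrite lt_def en e0.
have := h (- b / e).
have -> : d + 2 * (- b / e) * b + (- b / e) ^+ 2 * e = d - b ^+ 2 / e by field.
by rewrite subr_ge0 ler_pdivrMr.
Qed.

End Quadratic.

Section IpLimit.
Variables (R : realType) (H : hilbert R).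

Lemma ip_cvg (u v : nat -> H) u' v' : nrm (u n - u') @[n --> \oo] --> 0 ->
  nrm (v n - v') @[n --> \oo] --> 0 -> ip (u n) (v n) @[n --> \oo] --> ip u' v'.
Proof.
move=> uu vv; apply: cvg_sub0_norm.
have c : nrm (u n - u') * nrm (v n - v') + (nrm u' * nrm (v n - v') +
    nrm v' * nrm (u n - u')) @[n --> \oo] --> 0.
  apply: cvg0D; last by apply: cvg0D; apply: cvg0Z.
  by rewrite -[X in _ --> X](mulr0 (0 : R)); apply: cvgM.
apply: (cvg0_le _ c); apply: nearW => n; rewrite normr_ge0/=.
have -> : ip (u n) (v n) - ip u' v' = ip (u n - u') (v n - v') +
    (ip u' (v n - v') + ip (u n - u') v') by rewrite !ipE; ring.
have h1 := cauchy_schwarz (u n - u') (v n - v').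
have h2 := cauchy_schwarz u' (v n - v').
have h3 := cauchy_schwarz (u n - u') v'.
apply: le_trans (ler_normD _ _) _; apply: lerD => //.
apply: le_trans (ler_normD _ _) _; apply: lerD => //.
by rewrite mulrC.
Qed.

End IpLimit.

Section FormOperator.
Variables (R : realType) (X : countType) (G : graph R X).
Local Notation w := (weight G).
Local Notation kappa := (killing G).
Local Notation mu := (mass G).
Local Notation form := (Defs.form G).
Local Notation inner := (Defs.inner G).
Local Notation laplacian := (Defs.laplacian G).
Local Notation H := (l2h G).
Implicit Types (f g u v p s : X -> R) (h : R).

Lemma mass_ge0 x : 0 <= mu x. Proof. exact/ltW/mass_gt0. Qed.

Lemma fsuppB f g : fsupp f -> fsupp g -> fsupp (f \- g).
Proof.
move=> sf sg; have := fsupp_linear (-1) sg sf.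
by congr fsupp; apply/funext => x /=; rewrite mulN1r addrC.
Qed.

Lemma form_linear_r (a : R) f g p : fsupp f -> fsupp g -> fsupp p ->
  form p (fun x => a * f x + g x) = a * form p f + form p g.
Proof.
move=> sf sg sp; rewrite form_sym form_linear//; try exact: fsupp_bounded.
by rewrite !(form_sym G p).
Qed.

Lemma form_quad (a : R) f g : fsupp f -> fsupp g ->
  form (fun x => a * f x + g x) (fun x => a * f x + g x) =
  a ^+ 2 * form f f + 2 * a * form f g + form g g.
Proof.
move=> sf sg; have sfg := fsupp_linear a sf sg.
rewrite form_linear//; try exact: fsupp_bounded.
by rewrite !form_linear_r// (form_sym G g f); ring.
Qed.

Lemma inner_quad (a : R) f g : ell2 G f -> ell2 G g ->
  inner (fun x => a * f x + g x) (fun x => a * f x + g x) =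
  a ^+ 2 * inner f f + 2 * a * inner f g + inner g g.
Proof.
move=> sf sg; have sfg := ell2_linear a sf sg.
rewrite inner_linear// !(inner_sym G _ (fun x => a * f x + g x)).
by rewrite !inner_linear// (inner_sym G g f); ring.
Qed.

Lemma form_cauchy_schwarz f g : fsupp f -> fsupp g ->
  form f g ^+ 2 <= form f f * form g g.
Proof.
move=> sf sg; rewrite mulrC; have := quadratic_bound (d := form g g) (b := form f
    g) (form_ge0 G sf).
apply=> t; have := form_ge0 G (fsupp_linear t sf sg); rewrite form_quad//.
by rewrite (_ : _ + _ + form g g = form g g + 2 * t * form f g + t ^+ 2 * form f f)//; ring.
Qed.

Lemma formB f g p : fsupp f -> fsupp g -> fsupp p ->
  form (f \- g) p = form f p - form g p.
Proof.
move=> sf sg sp; have -> : f \- g = fun x => -1 * g x + f x by apply/funext => x /=; ring.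
by rewrite form_linear//; [ring|exact: fsupp_bounded|exact: fsupp_bounded].
Qed.

Lemma form_subE f g : fsupp f -> fsupp g ->
  form (f \- g) (f \- g) = form f f - 2 * form f g + form g g.
Proof.
move=> sf sg; have -> : f \- g = fun x => -1 * g x + f x by apply/funext => x /=; ring.
by rewrite form_quad// (form_sym G g f); ring.
Qed.

Lemma form_le2 f g : fsupp f -> fsupp g ->
  form f f <= 2 * form (f \- g) (f \- g) + 2 * form g g.
Proof.
move=> sf sg; have := form_ge0 G (fsupp_linear (-2) sg sf).
by rewrite form_subE// form_quad// (form_sym G g f); lra.
Qed.

Definition energy h p := h * form p p + inner p p.
(** Its minimizer over the form domain is [(1 + h L)^-1 f]. It is evaluated on finitely supported
    functions only, because the closed form is known only through limits of such functions. *)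
Definition functional h f u := h * form u u + inner (u \- f) (u \- f).

Lemma energy_ge0 h p : 0 < h -> fsupp p -> 0 <= energy h p.
Proof.
move=> h0 sp; rewrite addr_ge0 ?mulr_ge0 ?(ltW h0) ?form_ge0//.
by apply: inner_ge0; exact: fsupp_ell2.
Qed.

Lemma functional_expand h f u p (t : R) : ell2 G f -> fsupp u -> fsupp p ->
  functional h f (fun x => t * p x + u x) =
  functional h f u + 2 * t * (h * form u p + inner (u \- f) p) + t ^+ 2 * energy h p.
Proof.
move=> sf su sp; rewrite /functional /energy form_quad//.
have suf : ell2 G (u \- f).
  have := ell2_linear (-1) sf (fsupp_ell2 G su); congr ell2.
  by apply/funext => x /=; ring.
have -> : (fun x => t * p x + u x) \- f = fun x => t * p x + (u \- f) x.
  by apply/funext => x /=; ring.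
rewrite inner_quad//; last exact: fsupp_ell2.
by rewrite (inner_sym G p) (form_sym G p u); ring.
Qed.

(** The explicit error [d] makes the estimates below quantitative, and it survives any modification
    of the sequence that does not increase the functional, such as clipping. *)
Definition minimizing h f (un : nat -> X -> R) := (forall n, fsupp (un n)) /\
  exists2 d : nat -> R, d n @[n --> \oo] --> 0 &
    forall n v, fsupp v -> functional h f (un n) <= functional h f v + d n.

Lemma minimizing_exists h f : 0 < h -> ell2 G f -> exists un, minimizing h f un.
Proof.
move=> h0 sf; pose A := [set functional h f v | v in @fsupp R X].
have A0 y : A y -> 0 <= y.
  move=> [v sv <-]; rewrite addr_ge0 ?mulr_ge0 ?(ltW h0) ?form_ge0//.
  apply: inner_ge0; have := ell2_linear (-1) sf (fsupp_ell2 G sv); congr ell2.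
  by apply/funext => x /=; ring.
have hA : has_inf A.
  split; first by exists (functional h f (fun=> 0)); exists (fun=> 0) => //; exact: fsupp0.
  by exists 0 => y /A0.
have P n : exists v, fsupp v /\ functional h f v < inf A + n.+1%:R^-1.
  have [_ [v sv <-] lt] : exists2 y, A y & y < inf A + n.+1%:R^-1.
    by apply: inf_adherent => //; rewrite invr_gt0.
  by exists v.
have [u uP] := choice P; exists u; split; first by move=> n; case: (uP n).
exists (fun n => n.+1%:R^-1); first exact: cvg_harmonic.
move=> n v sv; have [_ /ltW le] := uP n; apply: (le_trans le); rewrite lerD2r.
by apply: ge_inf; [case: hA|exists v].
Qed.

(** Along the line through [u] in direction [p] the functional is a quadratic polynomial bounded
    below by its value at [u] minus [d]; the discriminant bounds its linear coefficient. *)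
Lemma minimizing_variation h f u d p : 0 < h -> ell2 G f -> fsupp u -> fsupp p ->
  (forall v, fsupp v -> functional h f u <= functional h f v + d) ->
  (h * form u p + inner (u \- f) p) ^+ 2 <= d * energy h p.
Proof.
move=> h0 sf su sp um; apply: quadratic_bound; first exact: energy_ge0.
by move=> t; have := um _ (fsupp_linear t sp su); rewrite functional_expand//; lra.
Qed.

(** Both near-minimizers are tested against their midpoint [u - (u - v) / 2]. *)
Lemma minimizing_parallelogram h f u v d e : 0 < h -> ell2 G f -> fsupp u -> fsupp v ->
  (forall z, fsupp z -> functional h f u <= functional h f z + d) ->
  (forall z, fsupp z -> functional h f v <= functional h f z + e) ->
  energy h (u \- v) <= 2 * d + 2 * e.
Proof.
move=> h0 sf su sv um vm; have suv := fsuppB su sv.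
have E := functional_expand h (-1) sf su suv.
have E2 := functional_expand h (- 2^-1) sf su suv.
have Ev : (fun x => -1 * (u \- v) x + u x) = v by apply/funext => x /=; ring.
rewrite Ev in E.
have sz := fsupp_linear (- 2^-1) suv su.
have := um _ sz; have := vm _ sz; rewrite E2 E.
by lra.
Qed.

Lemma form_approx_bounded fn f : form_approx G fn f ->
  exists2 M, 0 <= M & forall n, form (fn n) (fn n) <= M.
Proof.
move=> [sf _ _ /(_ 1 ltr01)[N NC]].
have {}sf n : fsupp (fn n) by exact/finitely_supportedP.
pose M := \sum_(i < N.+1) form (fn i) (fn i).
have M0 : 0 <= M by apply: sumr_ge0 => i _; exact: form_ge0.
have hM i : (i <= N)%N -> form (fn i) (fn i) <= M.
  rewrite -ltnS => iN; rewrite /M (bigD1 (Ordinal iN))//= lerDl.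
  by apply: sumr_ge0 => j _; exact: form_ge0.
exists (2 + 2 * M) => [|n]; first by lra.
have [nN|/ltnW Nn] := leqP n N; first by have := hM n nN; lra.
have := form_le2 (sf n) (sf N); have := NC n N Nn (leqnn _); have := hM N (leqnn N).
by lra.
Qed.

Lemma norm2_cvg_point (fn : nat -> X -> R) f x : (forall n, ell2 G (fn n)) -> ell2 G f ->
  norm2 G (fn n \- f) @[n --> \oo] --> 0 -> fn n x @[n --> \oo] --> f x.
Proof.
move=> sfn sf nf; have c : nrm ((to_l2 G (fn n) : H) - to_l2 G f) @[n --> \oo] --> 0.
  apply: cvg_ext nf => n; rewrite -norm2_nrm; congr norm2; apply/funext => y /=.
  by rewrite !to_l2E.
have {c} : l2val (to_l2 G (fn n)) x @[n --> \oo] --> l2val (to_l2 G f) x.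
  exact: nrm_cvg_point c.
by rewrite to_l2E//; apply: cvg_ext => n; rewrite to_l2E.
Qed.

Lemma inner_cvg (fn gn : nat -> X -> R) f g :
  (forall n, ell2 G (fn n)) -> ell2 G f -> (forall n, ell2 G (gn n)) -> ell2 G g ->
  norm2 G (fn n \- f) @[n --> \oo] --> 0 -> norm2 G (gn n \- g) @[n --> \oo] --> 0 ->
  inner (fn n) (gn n) @[n --> \oo] --> inner f g.
Proof.
move=> sfn sf sgn sg nf ng.
have c (kn : nat -> X -> R) k : (forall n, ell2 G (kn n)) -> ell2 G k ->
    norm2 G (kn n \- k) @[n --> \oo] --> 0 ->
    nrm ((to_l2 G (kn n) : H) - to_l2 G k) @[n --> \oo] --> 0.
  move=> skn sk; apply: cvg_ext => n; rewrite -norm2_nrm; congr norm2; apply/funext => y /=.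
  by rewrite !to_l2E.
have := ip_cvg (c _ _ sfn sf nf) (c _ _ sgn sg ng); rewrite /= !to_l2E//.
by apply: cvg_ext => n; rewrite !to_l2E.
Qed.

(** Closability of the form. The difference sequence [d] is form-Cauchy and tends to 0 pointwise;
    letting [m] tend to infinity in the partial sums of [form (d n \- d m) (d n \- d m) <= e] bounds
    [form (d n) (d n)] by [e]. *)
Lemma form_approx_sub_cvg0 fn gn f : form_approx G fn f -> form_approx G gn f ->
  form (fn n \- gn n) (fn n \- gn n) @[n --> \oo] --> 0.
Proof.
move=> [sf lf nf Cf] [sg _ ng Cg].
have {}sf n : fsupp (fn n) by exact/finitely_supportedP.
have {}sg n : fsupp (gn n) by exact/finitely_supportedP.
pose d n := fn n \- gn n.
have sd n : fsupp (d n) by exact: fsuppB.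
have d0 x : d n x @[n --> \oo] --> 0.
  rewrite -[X in _ --> X](subrr (f x)); apply: cvgB;
      apply: norm2_cvg_point => // n; exact: fsupp_ell2.
apply/cvgrPdist_le => e e0; have e4 : 0 < e / 4 by lra.
have [N1 N1C] := Cf _ e4; have [N2 N2C] := Cg _ e4.
exists (maxn N1 N2) => // n /=; rewrite geq_max => /andP[n1 n2].
rewrite sub0r normrN ger0_norm; last exact/form_ge0/sd.
have dC m : (N1 <= m)%N -> (N2 <= m)%N -> form (d n \- d m) (d n \- d m) <= e.
  move=> m1 m2; have := N1C n m n1 m1; have := N2C n m n2 m2.
  have := form_le2 (fsuppB (sd n) (sd m)) (fsuppB (sf n) (sf m)).
  have -> : (d n \- d m) \- (fn n \- fn m) = fun x => -1 * (gn n \- gn m) x + 0.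
    by apply/funext => x; rewrite /d /=; ring.
  rewrite form_quad; [|exact: fsuppB|exact: fsupp0].
  have -> : form (fun=> 0) (fun=> 0) = 0.
    rewrite form_green; [|exact: bounded_cst|exact: fsupp0].
    by rewrite /inner -[RHS](@rsum0 R X); congr rsum; apply/funext => x; rewrite !mulr0.
  have -> : form (gn n \- gn m) (fun=> 0) = 0.
    rewrite form_green; [|exact/fsupp_bounded/fsuppB|exact: fsupp0].
    by rewrite /inner -[RHS](@rsum0 R X); congr rsum; apply/funext => x; rewrite !mulr0.
  by lra.
pose P u k := 2^-1 * psum (fun p : X * X => w p.1 p.2 * (u p.1 - u p.2) * (u p.1 -
    u p.2)) k +
  psum (fun x => kappa x * u x * u x) k.
have Pform u : fsupp u -> P u k @[k --> \oo] --> form u u.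
  move=> su; apply: cvgD; last first.
    by apply: rsum_cvg; apply: fsupp_rsummable; apply: fsupp_le su => x ->; rewrite mulr0.
  by apply: cvgMl_tmp; apply: rsum_cvg; apply: rsummable_energy => //; exact: fsupp_bounded.
have Ple u k : fsupp u -> P u k <= form u u.
  move=> su; apply: lerD.
    rewrite ler_wpM2l//; apply: psum_le_rsum.
      by apply: rsummable_energy => //; exact: fsupp_bounded.
    by move=> p; rewrite -mulrA mulr_ge0 ?weight_ge0// -expr2 sqr_ge0.
  apply: psum_le_rsum.
    by apply: fsupp_rsummable; apply: fsupp_le su => x ->; rewrite mulr0.
  by move=> x; rewrite -mulrA mulr_ge0 ?killing_ge0// -expr2 sqr_ge0.
apply: (cvgr_to_le (Pform _ (sd n))); apply: nearW => k.
have c : P (d n \- d m) k @[m --> \oo] --> P (d n) k.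
  have dd x : d n x - d m x @[m --> \oo] --> d n x.
    by rewrite -[X in _ --> X]subr0; apply: cvgB => //; exact: cvg_cst.
  rewrite /P /psum; apply: cvgD.
    apply: cvgMl_tmp; apply: cvg_sum_nat => i; rewrite /term.
    case: pickle_inv => [[x y]|] /=; last exact: cvg_cst.
    have dxy : d n x - d m x - (d n y - d m y) @[m --> \oo] --> d n x - d n y.
      by apply: cvgB.
    by apply: cvgM => //; apply: cvgMl_tmp.
  apply: cvg_sum_nat => i; rewrite /term.
  case: pickle_inv => [x|] /=; last exact: cvg_cst.
  by apply: cvgM => //; apply: cvgMl_tmp.
apply: (cvgr_to_le c); exists (maxn N1 N2) => // m /=; rewrite geq_max => /andP[m1 m2].
by apply: le_trans (dC m m1 m2); apply: Ple; exact: fsuppB.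
Qed.

Lemma form_cvg0 (fn gn : nat -> X -> R) (M : R) : (forall n, fsupp (fn n)) ->
  (forall n, fsupp (gn n)) -> form (fn n) (fn n) @[n --> \oo] --> 0 ->
  (forall n, form (gn n) (gn n) <= M) -> form (fn n) (gn n) @[n --> \oo] --> 0.
Proof.
move=> sf sg f0 gM; apply/cvgrPdist_le => e e0.
have M0 : 0 <= M by apply: le_trans (gM 0%N); exact: form_ge0.
have /cvgrPdist_le/(_ (e ^+ 2 / (M + 1))) := f0.
have q0 : 0 < e ^+ 2 / (M + 1) by rewrite divr_gt0 ?exprn_gt0//; lra.
move=> /(_ q0); apply: filterS => n; rewrite !sub0r !normrN ger0_norm ?form_ge0// => fe.
rewrite -(@ler_pXn2r _ 2%N)// ?nnegrE ?normr_ge0 ?(ltW e0)// real_normK ?num_real//.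
apply: (le_trans (form_cauchy_schwarz (sf n) (sg n))).
apply: (@le_trans _ _ (e ^+ 2 / (M + 1) * M)).
  by apply: ler_pM => //; exact: form_ge0.
rewrite mulrAC ler_pdivrMr; last by lra.
by rewrite ler_wpM2l ?sqr_ge0//; lra.
Qed.

(** By closability the value of the closed form does not depend on the approximating sequences, so
    sums and positivity can be computed along chosen ones. *)
Lemma closed_form_approx fn gn f g q : closed_form G f g q ->
  form_approx G fn f -> form_approx G gn g -> form (fn n) (gn n) @[n --> \oo] --> q.
Proof.
move=> [fn' [gn' [af' ag' c]]] af ag.
have sf n : fsupp (fn n) by apply/finitely_supportedP; case: af.
have sg n : fsupp (gn n) by apply/finitely_supportedP; case: ag.
have sf' n : fsupp (fn' n) by apply/finitely_supportedP; case: af'.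
have sg' n : fsupp (gn' n) by apply/finitely_supportedP; case: ag'.
have [M _ gM] := form_approx_bounded ag; have [N _ fN] := form_approx_bounded af'.
have c1 : form (fn n \- fn' n) (gn n) @[n --> \oo] --> 0.
  apply: form_cvg0 gM => //; first by move=> n; exact: fsuppB.
  exact: form_approx_sub_cvg0 af af'.
have c2 : form (gn n \- gn' n) (fn' n) @[n --> \oo] --> 0.
  apply: form_cvg0 fN => //; first by move=> n; exact: fsuppB.
  exact: form_approx_sub_cvg0 ag ag'.
rewrite -[q]addr0 -[X in _ --> _ + X]addr0.
apply: (cvg_ext _ (cvgD c (cvgD c1 c2))) => n.
change (form (fn' n) (gn' n) + (form (fn n \- fn' n) (gn n) +
  form (gn n \- gn' n) (fn' n)) = form (fn n) (gn n)).
rewrite formB// formB// (form_sym G (gn n)) (form_sym G (gn' n)); ring.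
Qed.

Lemma energy_form h p : 0 < h -> fsupp p -> form p p <= h^-1 * energy h p.
Proof.
move=> h0 sp; rewrite ler_pdivlMl// /energy lerDl.
by apply: inner_ge0; exact: fsupp_ell2.
Qed.

Lemma energy_inner h p : 0 < h -> fsupp p -> inner p p <= energy h p.
Proof. by move=> h0 sp; rewrite lerDr mulr_ge0 ?(ltW h0) ?form_ge0. Qed.

Lemma minimizing_approx h f un : 0 < h -> ell2 G f -> minimizing h f un ->
  exists u, form_approx G un u.
Proof.
move=> h0 sf [su [d d0 um]].
have EC e : 0 < e -> exists N, forall m n, (N <= m)%N -> (N <= n)%N ->
    energy h (un m \- un n) < e.
  move=> e0; have e8 : 0 < e / 8 by lra.
  have /cvgrPdist_lt/(_ _ e8)[N _ dN] := d0; exists N => m n Nm Nn.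
  have := minimizing_parallelogram h0 sf (su m) (su n) (um m) (um n).
  have := dN m Nm; have := dN n Nn; rewrite /= !sub0r !normrN.
  have := ler_norm (d m); have := ler_norm (d n); lra.
have [v uv] : exists v : l2 G, nrm ((to_l2 G (un n) : H) - v) @[n --> \oo] --> 0.
  apply: (@ip_complete _ H (fun n => to_l2 G (un n))) => e e0.
  have [N NE] := EC _ (exprn_gt0 2 e0); exists N => m n Nm Nn.
  have lt := NE m n Nm Nn; rewrite -[ltRHS](ger0_norm (ltW e0)) -[ltRHS]sqrtr_sqr
      ltr_sqrt ?exprn_gt0//.
  apply: le_lt_trans lt; have sB := fsuppB (su m) (su n).
  suff -> : ip ((to_l2 G (un m) : H) - to_l2 G (un n)) ((to_l2 G (un m) : H) -
      to_l2 G (un n))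
     = inner (un m \- un n) (un m \- un n) by exact: energy_inner.
  have E : l2val ((to_l2 G (un m)) - to_l2 G (un n)) = un m \- un n.
    by apply/funext => x; rewrite !l2E !to_l2E//; exact: fsupp_ell2.
  by rewrite -[LHS]/(inner (l2val (to_l2 G (un m) - to_l2 G (un n)))
    (l2val (to_l2 G (un m) - to_l2 G (un n)))) E.
exists (l2val v); split.
- by move=> n; apply/finitely_supportedP.
- exact: l2_ell2.
- apply: cvg_ext uv => n; rewrite -norm2_nrm; congr norm2; apply/funext => x /=.
  by rewrite to_l2E//; exact: fsupp_ell2.
- move=> e e0; have [N NE] := EC _ (mulr_gt0 h0 e0); exists N => m n Nm Nn.
  apply: (le_lt_trans (energy_form h0 (fsuppB (su m) (su n)))).
  by rewrite ltr_pdivrMl// NE.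
Qed.

(** The first variation along [gn] tends to 0, since its square is at most [d n] times a bounded
    energy; its limit is the weak equation [h L u + u = f]. *)
Lemma minimizing_operator h f un u : 0 < h -> ell2 G f -> minimizing h f un ->
  form_approx G un u -> form_operator G u (fun x => h^-1 * (f x - u x)).
Proof.
move=> h0 sf [su [d d0 um]] au; have lu : ell2 G u by case: au.
have lfu : ell2 G (f \- u).
  have := ell2_linear (-1) lu sf; congr ell2; apply/funext => x /=; ring.
split; first by exists un.
  have := ell2_linear h^-1 lfu (ell20 G); congr ell2; apply/funext => x /=.
  by rewrite addr0.
move=> g [gn ag]; exists un, gn; split=> //.
have sg n : fsupp (gn n) by apply/finitely_supportedP; case: ag.
have lg : ell2 G g by case: ag.
have [M M0 gM] := form_approx_bounded ag.
have ngg : norm2 G (gn n \- g) @[n --> \oo] --> 0 by case: ag.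
have nuu : norm2 G (un n \- u) @[n --> \oo] --> 0 by case: au.
have lun n : ell2 G (un n) by exact: fsupp_ell2.
have lgn n : ell2 G (gn n) by exact: fsupp_ell2.
pose b n := h * form (un n) (gn n) + inner (un n \- f) (gn n).
have ig : inner (gn n) (gn n) @[n --> \oo] --> inner g g by exact: inner_cvg.
have b2 : b n ^+ 2 @[n --> \oo] --> 0.
  have c : d n * (h * M + inner (gn n) (gn n)) @[n --> \oo] --> 0.
    rewrite -[X in _ --> X](mul0r (h * M + inner g g)); apply: cvgM => //.
    by apply: cvgD => //; exact: cvg_cst.
  apply: (cvg0_le _ c); apply: nearW => n; rewrite sqr_ge0/=.
  apply: le_trans (minimizing_variation h0 sf (su n) (sg n) (um n)) _.
  rewrite ler_wpM2l//; first by have := um n _ (su n); lra.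
  by rewrite lerD2r ler_wpM2l// ltW.
have b0 : b n @[n --> \oo] --> 0.
  apply: cvg_sub0_norm; have := cvg_comp _ _ b2 (@sqrt_continuous R 0); rewrite sqrtr0.
  by apply: cvg_ext => n /=; rewrite sqrtr_sqr subr0.
have i1 : inner (un n) (gn n) @[n --> \oo] --> inner u g by exact: inner_cvg.
have i2 : inner f (gn n) @[n --> \oo] --> inner f g.
  apply: inner_cvg => //; apply: cvg_near_cst; apply: nearW => n.
  have -> : f \- f = fun=> 0 by apply/funext => x /=; rewrite subrr.
  by rewrite /norm2 /inner (_ : (fun x => _) = fun=> 0) ?rsum0 ?sqrtr0//;
      apply/funext => x; rewrite !mulr0.
have -> : inner (fun x => h^-1 * (f x - u x)) g = h^-1 * (0 - (inner u g - inner f g)).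
  have -> : (fun x => h^-1 * (f x - u x)) = fun x => h^-1 * (-1 * u x + f x) + 0.
    by apply/funext => x; ring.
  rewrite inner_linear//; [|exact: ell2_linear|exact: ell20].
  rewrite inner_linear//.
  have -> : inner (fun=> 0) g = 0.
    by rewrite /inner (_ : (fun x => _) = fun=> 0) ?rsum0//; apply/funext => x;
        rewrite mul0r mulr0.
  by ring.
have c : h^-1 * (b n - (inner (un n) (gn n) - inner f (gn n))) @[n --> \oo] -->
    h^-1 * (0 - (inner u g - inner f g)).
  by apply: cvgMl_tmp; apply: cvgB => //; exact: cvgB.
apply: cvg_ext c => n; rewrite /b.
have -> : un n \- f = fun x => -1 * f x + un n x by apply/funext => x /=; ring.
by rewrite inner_linear//; field; exact: lt0r_neq0.
Qed.

Definition formA (u v : H) : Prop := form_operator G (l2val u) (l2val v).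

Lemma form_approx_linear (a : R) fn gn f g : form_approx G fn f -> form_approx G gn g ->
  form_approx G (fun n x => a * fn n x + gn n x) (fun x => a * f x + g x).
Proof.
move=> [sf lf nf Cf] [sg lg ng Cg].
have {}sf n : fsupp (fn n) by exact/finitely_supportedP.
have {}sg n : fsupp (gn n) by exact/finitely_supportedP.
split.
- by move=> n; apply/finitely_supportedP; exact: fsupp_linear.
- exact: ell2_linear.
- have c (kn : nat -> X -> R) k : (forall n, fsupp (kn n)) -> ell2 G k ->
      norm2 G (kn n \- k) @[n --> \oo] --> 0 ->
      nrm ((to_l2 G (kn n) : H) - to_l2 G k) @[n --> \oo] --> 0.
    move=> skn sk; apply: cvg_ext => n; rewrite -norm2_nrm; congr norm2;
        apply/funext => y /=.
    by rewrite !to_l2E//; exact: fsupp_ell2.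
  have c1 : `|a| * nrm ((to_l2 G (fn n) : H) - to_l2 G f) +
      nrm ((to_l2 G (gn n) : H) - to_l2 G g) @[n --> \oo] --> 0.
    by apply: cvg0D; [apply: cvg0Z|]; exact: c.
  apply: (cvg0_le _ c1); apply: nearW => n; rewrite sqrtr_ge0/= -nrmZ.
  apply: le_trans (ler_nrmD _ _); rewrite -norm2_nrm le_eqVlt; apply/orP; left; apply/eqP.
  congr norm2; apply/funext => x.
  rewrite -[RHS]/(a * (l2val (to_l2 G (fn n)) x - l2val (to_l2 G f) x) +
    (l2val (to_l2 G (gn n)) x - l2val (to_l2 G g) x)).
  rewrite /= !to_l2E//; try exact: fsupp_ell2.
  by ring.
- move=> e e0; have q0 : 0 < 4 * (a ^+ 2 + 1) by have := sqr_ge0 a; lra.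
  have e4 : 0 < e / (4 * (a ^+ 2 + 1)) by rewrite divr_gt0.
  have [N1 N1C] := Cf _ e4; have [N2 N2C] := Cg _ e4.
  exists (maxn N1 N2) => m n; rewrite !geq_max => /andP[m1 m2] /andP[n1 n2].
  have h1 := N1C m n m1 n1; have h2 := N2C m n m2 n2.
  have s1 := fsuppB (sf m) (sf n); have s2 := fsuppB (sg m) (sg n).
  have := form_ge0 G (fsupp_linear (- a) s1 s2).
  have -> : (fun x => a * fn m x + gn m x) \- (fun x => a * fn n x + gn n x) =
    fun x => a * (fn m \- fn n) x + (gn m \- gn n) x by apply/funext => x /=; ring.
  rewrite !form_quad//.
  move: (form (fn m \- fn n) (fn m \- fn n)) (form (fn m \- fn n) (gn m \- gn n))
    (form (gn m \- gn n) (gn m \- gn n)) h1 h2 => y z t h1 h2 h3.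
  have : a ^+ 2 * y <= a ^+ 2 * (e / (4 * (a ^+ 2 + 1))) by rewrite ler_wpM2l
      ?sqr_ge0// ltW.
  have : e / (4 * (a ^+ 2 + 1)) * (4 * (a ^+ 2 + 1)) = e by rewrite divfK// gt_eqF.
  by lra.
Qed.

Lemma formA_lin (a : R) (u v u' v' : H) : formA u u' -> formA v v' ->
  formA (a *: u + v) (a *: u' + v').
Proof.
move=> [[fn af] lf Af] [[gn ag] lg Ag]; split.
- by exists (fun n x => a * fn n x + gn n x); exact: (form_approx_linear a af ag).
- exact: l2_ell2.
move=> p [pn ap]; exists (fun n x => a * fn n x + gn n x), pn; split; [|exact: ap|].
  exact: (form_approx_linear a af ag).
have sf n : fsupp (fn n) by apply/finitely_supportedP; case: af.
have sg n : fsupp (gn n) by apply/finitely_supportedP; case: ag.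
have sp n : fsupp (pn n) by apply/finitely_supportedP; case: ap.
have lp : ell2 G p by case: ap.
have cp : closed_form_dom G p by exists pn.
have c1 := closed_form_approx (Af p cp) af ap.
have c2 := closed_form_approx (Ag p cp) ag ap.
have -> : inner (l2val (a *: u' + v')) p = a * inner (l2val u') p + inner (l2val v') p.
  by rewrite -inner_linear.
have c : a * form (fn n) (pn n) + form (gn n) (pn n) @[n --> \oo] -->
  a * inner (l2val u') p + inner (l2val v') p by apply: cvgD => //; exact: cvgMl_tmp.
by apply: cvg_ext c => n; rewrite form_linear//; exact: fsupp_bounded.
Qed.

Lemma formA_mono (u u' : H) : formA u u' -> 0 <= ip u' u.
Proof.
move=> [[fn af] lf Af]; have cu : closed_form_dom G (l2val u) by exists fn.
apply: (cvgr_to_ge (closed_form_approx (Af _ cu) af af)); apply: nearW => n.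
by apply: form_ge0; apply/finitely_supportedP; case: af.
Qed.

Lemma resolvent_exists h (f : H) : 0 < h -> exists (un : nat -> X -> R) (u : H),
  [/\ minimizing h (l2val f) un, form_approx G un (l2val u) & formA u (h^-1 *: (f - u))].
Proof.
move=> h0; have [un um] := minimizing_exists h0 (l2_ell2 f).
have [u au] := minimizing_approx h0 (l2_ell2 f) um.
have lu : ell2 G u by case: au.
exists un, (to_l2 G u : H); split=> //; first by rewrite to_l2E.
have := minimizing_operator h0 (l2_ell2 f) um au.
rewrite /formA to_l2E//; congr form_operator; apply/funext => x.
by rewrite -[RHS]/(h^-1 * (l2val f x - l2val (to_l2 G u) x)) to_l2E.
Qed.

Lemma formA_range h (f : H) : 0 < h -> exists u : H, formA u (h^-1 *: (f - u)).
Proof. by move=> /(resolvent_exists f)[un [u [_ _ Au]]]; exists u. Qed.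

(** Truncate [f] to [g] and apply a resolvent: the functional takes the value [h * form g g] at [g]
    itself, whence [|g - u|^2 <= h * form g g] for the minimizer [u]. *)
Lemma formA_dense (f : H) (e : R) : 0 < e -> exists u u' : H, formA u u' /\ nrm (f - u) < e.
Proof.
move=> e0; have e2 : 0 < e / 2 by lra.
have lf := l2_ell2 f.
have /cvgrPdist_lt/(_ _ e2)[n _ /(_ n (leqnn n))] := nrm_truncation lf.
rewrite l2valK; set g := truncation n (l2val f) => /=.
rewrite sub0r normrN ger0_norm ?nrm_ge0// => fg.
have sg : fsupp g by exact: fsupp_truncation.
have lg : ell2 G g by exact: fsupp_ell2.
have q0 := form_ge0 G sg.
pose h := (e / 4) ^+ 2 / (form g g + 1).
have e4 : 0 < (e / 4) ^+ 2 by rewrite exprn_gt0//; lra.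
have h0 : 0 < h by rewrite divr_gt0//; lra.
have hg : h * form g g <= (e / 4) ^+ 2.
  by rewrite /h mulrAC ler_pdivrMr; [rewrite (ler_wpM2l (ltW e4))//; lra|lra].
have [un [u [[su [d d0 um]] au Au]]] := resolvent_exists (to_l2 G g) h0.
exists u, (h^-1 *: ((to_l2 G g : H) - u)); split=> //.
rewrite to_l2E// in um.
have gu : nrm ((to_l2 G g : H) - u) <= e / 4.
  rewrite -(@ler_pXn2r _ 2%N)// ?nnegrE ?nrm_ge0//; last by lra.
  rewrite sqr_nrm.
  have c : inner (un n \- g) (un n \- g) @[n --> \oo] --> inner (l2val u \- g)
      (l2val u \- g).
    have lu : ell2 G (l2val u) by exact: l2_ell2.
    have sB k : ell2 G k -> ell2 G (k \- g).
      move=> lk; have := ell2_linear (-1) lg lk; congr ell2; apply/funext => x /=; ring.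
    have nB : norm2 G ((un n \- g) \- (l2val u \- g)) @[n --> \oo] --> 0.
      case: au => _ _ nu _; apply: cvg_ext nu => k; congr norm2; apply/funext => x /=; ring.
    by apply: inner_cvg => // [k||k|]; apply: sB => //; exact: fsupp_ell2.
  have -> : ip ((to_l2 G g : H) - u) ((to_l2 G g : H) - u) = inner (l2val u \- g)
      (l2val u \- g).
    have E : l2val ((to_l2 G g : H) - u) = fun x => g x - l2val u x.
      by apply/funext => x; rewrite -[LHS]/(l2val (to_l2 G g) x - l2val u x) to_l2E.
    rewrite -[LHS]/(inner (l2val ((to_l2 G g : H) - u)) (l2val ((to_l2 G g : H) - u))) E.
    by congr rsum; apply/funext => x /=; ring.
  apply: (le_trans _ hg); rewrite -[leRHS]addr0 -subr_le0.
  have c2 : inner (un n \- g) (un n \- g) - d n @[n --> \oo] -->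
     inner (l2val u \- g) (l2val u \- g) - 0 by apply: cvgB.
  rewrite subr_le0 addr0 -[leLHS]subr0; apply: (cvgr_to_le c2); apply: nearW => k.
  have := um k g sg; rewrite /functional.
  have -> : inner (g \- g) (g \- g) = 0.
    by rewrite /inner (_ : (fun x => _) = fun=> 0) ?rsum0//; apply/funext => x /=;
        rewrite subrr !mulr0.
  have : 0 <= h * form (un k) (un k) by rewrite mulr_ge0 ?(ltW h0) ?form_ge0.
  by lra.
apply: (le_lt_trans (ler_nrmB f (to_l2 G g) u)); rewrite (nrmBC f).
by apply: (lt_le_trans (ltr_leD fg gu)); lra.
Qed.

End FormOperator.

(** * The heat semigroup *)

Section Resolvent.
Variables (R : realType) (X : countType) (G : graph R X).
Local Notation w := (weight G).
Local Notation kappa := (killing G).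
Local Notation mu := (mass G).
Local Notation form := (Defs.form G).
Local Notation inner := (Defs.inner G).
Local Notation laplacian := (Defs.laplacian G).
Local Notation H := (l2h G).
Implicit Types (f g u v p s : X -> R) (h : R).

Lemma laplacian_cvg (T : Type) (F : set_system T) {FF : ProperFilter F}
    (un : T -> X -> R) u (M : R) x :
  (\forall t \near F, forall y, `|un t y| <= M) ->
  (forall y, un t y @[t --> F] --> u y) ->
  laplacian (un t) x @[t --> F] --> laplacian u x.
Proof.
move=> unM unu.
have uM y : `|u y| <= M.
  apply: (cvgr_to_le (cvg_norm (unu y))); apply: filterS unM => t; exact.
have cS : rsum (fun y => w x y * (un t x - un t y)) @[t --> F] -->
    rsum (fun y => w x y * (u x - u y)).
  apply: (@rsum_dominated _ _ _ _ _ _ _ (fun y => 2 * M * w x y)).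
  - exact/rsummableZ/weight_summable.
  - apply: filterS unM => t tM y; rewrite normrM ger0_norm ?weight_ge0//.
    rewrite mulrC ler_wpM2r ?weight_ge0//; apply: (le_trans (ler_normB _ _)).
    by have := tM x; have := tM y; lra.
  - move=> y; apply: cvgMl_tmp; exact: cvgB.
rewrite /Defs.laplacian; apply: cvgD; exact: cvgMl_tmp.
Qed.

Lemma inner_delta f z : inner f (delta R z) = mu z * f z.
Proof.
rewrite /Defs.inner.
have [_ ->] : rsummable (fun x => mu x * (f x * delta R z x)) /\
   rsum (fun x => mu x * (f x * delta R z x)) =
   psum (fun x => mu x * (f x * delta R z x)) (pickle z).+1.
  apply: rsum_finite => x zx; rewrite /delta.
  by case: eqP zx => [->|_ _]; [rewrite ltnn|rewrite !mulr0].
rewrite /psum big_nat_recr//= term_pickle /delta eqxx mulr1 -[RHS]add0r; congr (_ + _).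
rewrite big1_seq// => k /andP[_]; rewrite mem_index_iota /term => /andP[_ kz].
have := @pickle_invK X k; case: pickle_inv => //= y yk.
by case: eqP kz => [<-|_ _]; [rewrite yk ltnn|rewrite !mulr0].
Qed.

Lemma maxr_lipschitz (a b c : R) : `|Num.max a b - Num.max a c| <= `|b - c|.
Proof.
have := ler_norm (b - c); have := ler_norm (c - b); rewrite distrC => h1 h2.
rewrite ler_norml; apply/andP; split;
  by case: (leP a b); case: (leP a c) => *; lra.
Qed.

Lemma formA_resolvent h (f : H) : 0 < h ->
  formA (resolvent (@formA _ _ G) h f) (h^-1 *: (f - resolvent (@formA _ _ G) h f)).
Proof. by move=> h0; apply: JP => //; exact: formA_range. Qed.

Lemma resolvent_uniq h (f u : H) : 0 < h -> formA u (h^-1 *: (f - u)) ->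
  u = resolvent (@formA _ _ G) h f.
Proof.
move=> h0; apply: J_uniq => //; [exact: formA_lin|exact: formA_mono|exact: formA_range].
Qed.

(** Termwise [(a - b)(a^+ - b^+) >= (a^+ - b^+)^2], where [a] and [b] are two values of [u - s]. *)
Lemma form_supersolution u s p : fsupp u -> bounded_function s -> fsupp p ->
  (forall x, p x = Num.max 0 (u x - s x)) ->
  form s p + form p p <= form u p.
Proof.
move=> su bs sp pE; have bu := fsupp_bounded su; have bp := fsupp_bounded sp.
have sk v : rsummable (fun x => kappa x * v x * p x).
  by apply: fsupp_rsummable; apply: fsupp_le sp => x ->; rewrite mulr0.
have se v : bounded_function v -> rsummable (fun q : X * X => w q.1 q.2 * (v q.1 -
    v q.2) * (p q.1 - p q.2)).
  by move=> bv; exact: rsummable_energy.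
rewrite /Defs.form addrACA -mulrDr -!rsumD//; try exact: se.
apply: lerD.
  rewrite ler_wpM2l//; apply: le_rsum; [|apply: rsummableD; exact: se|exact: se].
  move=> [x y] /=; rewrite -!mulrA -mulrDr ler_wpM2l ?weight_ge0// !pE.
  by case: (leP 0 (u x - s x)); case: (leP 0 (u y - s y)) => *; nra.
apply: le_rsum; [|apply: rsummableD; exact: sk|exact: sk].
move=> x; rewrite -!mulrA -mulrDr ler_wpM2l ?killing_ge0// pE.
by case: (leP 0 (u x - s x)) => *; nra.
Qed.

(** The barrier [s] need not lie in ell^2, so the comparison takes place on a minimizing sequence:
    as [s >= 0], the positive part of [un n - s] is finitely supported, and testing with it bounds
    its energy by [d n]. *)
Lemma resolvent_le h (f : H) s : 0 < h -> bounded_function s -> (forall x, 0 <= s x) ->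
  (forall x, l2val f x <= s x + h * laplacian s x) ->
  forall x, l2val (resolvent (@formA _ _ G) h f) x <= s x.
Proof.
move=> h0 bs s0 fs x; have [un [u [[su [d d0 um]] au Au]]] := resolvent_exists f h0.
rewrite -(resolvent_uniq h0 Au).
pose p n y := Num.max 0 (un n y - s y).
have sp n : fsupp (p n).
  apply: fsupp_le (su n) => y uy; rewrite /p uy sub0r; apply/max_idPl.
  by rewrite oppr_le0.
have p0 n y : 0 <= p n y by rewrite le_max lexx.
have lf := l2_ell2 f; have sn n : ell2 G (un n) by exact: fsupp_ell2.
have lp n : ell2 G (p n) by exact: fsupp_ell2.
have le n : energy G h (p n) <= h * form (un n) (p n) + inner (un n \- l2val f) (p n).
  have sr (g : X -> R) : rsummable (fun y => mu y * (g y * p n y)).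
    by apply: fsupp_rsummable; apply: fsupp_le (sp n) => y ->; rewrite !mulr0.
  have h1 : h * (form s (p n) + form (p n) (p n)) <= h * form (un n) (p n).
    by rewrite (ler_wpM2l (ltW h0))//; exact: form_supersolution.
  rewrite form_green// in h1.
  have h2 : inner (un n \- l2val f) (p n) =
      inner (fun y => s y - l2val f y) (p n) + inner (p n) (p n).
    rewrite /Defs.inner -rsumD//; congr rsum; apply/funext => y; rewrite -mulrDr /=.
    by rewrite /p; case: (leP 0 (un n y - s y)) => *; ring.
  have h3 : 0 <= h * inner (laplacian s) (p n) + inner (fun y => s y - l2val f y) (p n).
    rewrite /Defs.inner -rsumZ// -rsumD//; last by apply: rsummableZ.
    apply: rsum_ge0; last by apply: rsummableD => //; exact: rsummableZ.
    move=> y; rewrite (_ : _ + _ = mu y * ((s y + h * laplacian s y - l2val f y) *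
        p n y)); last by ring.
    by rewrite mulr_ge0 ?mass_ge0// mulr_ge0// subr_ge0.
  by rewrite /energy h2; lra.
have ed n : energy G h (p n) <= d n.
  have e0 := energy_ge0 G h0 (sp n).
  have dn0 : 0 <= d n by have := um n _ (su n); lra.
  have := minimizing_variation h0 lf (su n) (sp n) (um n).
  have := le n; move: (h * _ + _) (energy _ _ _) e0 => b e e0 be b2.
  have [->//|en] := eqVneq e 0.
  have e1 : 0 < e by rewrite lt_def en.
  rewrite -(ler_pM2r e1) -expr2; apply: le_trans b2.
  by rewrite ler_pXn2r// nnegrE// (le_trans e0).
have c : un n x - p n x @[n --> \oo] --> l2val u x - 0.
  apply: cvgB.
    by apply: norm2_cvg_point => //; [exact: l2_ell2|case: au].
  have cd : (mu x)^-1 * d n @[n --> \oo] --> 0 by exact: cvg0Z.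
  have c2 : p n x ^+ 2 @[n --> \oo] --> 0.
    apply: (cvg0_le _ cd); apply: nearW => n; rewrite sqr_ge0/= ler_pdivlMl ?mass_gt0//.
    apply: le_trans (ed n); apply: le_trans (energy_inner G h0 (sp n)).
    rewrite /Defs.inner expr2; apply: (@le_rsum1 _ _ (fun y => mu y * (p n y * p n y)) x).
      exact: rsummable_inner.
    by move=> y; rewrite !mulr_ge0 ?mass_ge0.
  apply: cvg_sub0_norm; have := cvg_comp _ _ c2 (@sqrt_continuous R 0); rewrite sqrtr0.
  by apply: cvg_ext => n /=; rewrite sqrtr_sqr subr0.
rewrite -[leLHS]subr0; apply: (cvgr_to_le c); apply: nearW => n /=.
by rewrite lerBlDl /p addrC -lerBlDl le_max lexx orbT.
Qed.

Definition clip (M a : R) : R := Num.max 0 (Num.min M a).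

Lemma clip_itv (M a : R) : 0 <= M -> 0 <= clip M a <= M.
Proof. by move=> M0; rewrite /clip le_max lexx ge_max M0 ge_min lexx. Qed.

Lemma clip_lipschitz (M a b : R) : `|clip M a - clip M b| <= `|a - b|.
Proof.
apply: le_trans (maxr_lipschitz _ _ _) _.
have := ler_norm (a - b); have := ler_norm (b - a); rewrite distrC => h1 h2.
rewrite ler_norml; apply/andP; split;
  by case: (leP M a); case: (leP M b) => *; lra.
Qed.

Lemma clip_id (M a : R) : 0 <= a <= M -> clip M a = a.
Proof. by move=> /andP[a0 aM]; rewrite /clip (min_idPr aM) (max_idPr a0). Qed.

Lemma clip0 (M : R) : 0 <= M -> clip M 0 = 0.
Proof. by move=> M0; apply: clip_id; rewrite lexx. Qed.

Lemma sqr_clip (M a b : R) : (clip M a - clip M b) * (clip M a - clip M b) <= (a -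
    b) * (a - b).
Proof.
rewrite -!expr2 -(real_normK (num_real (a - b))) -(real_normK (num_real (clip M a -
    clip M b))).
by rewrite ler_pXn2r ?nnegrE ?normr_ge0// clip_lipschitz.
Qed.

(** Markov property of the form: [clip M] is 1-Lipschitz and fixes 0 and all values of [f], so no
    term increases. *)
Lemma functional_clip h f u (M : R) : 0 < h -> 0 <= M -> ell2 G f ->
  (forall x, 0 <= f x <= M) -> fsupp u ->
  functional G h f (clip M \o u) <= functional G h f u.
Proof.
move=> h0 M0 lf fM su.
have sc : fsupp (clip M \o u) by apply: fsupp_le su => x /= ->; exact: clip0.
have lB v : fsupp v -> ell2 G (v \- f).
  move=> sv; have := ell2_linear (-1) lf (fsupp_ell2 G sv); congr ell2.
  by apply/funext => x /=; ring.
have sk v : fsupp v -> rsummable (fun x => kappa x * v x * v x).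
  by move=> sv; apply: fsupp_rsummable; apply: fsupp_le sv => x ->; rewrite mulr0.
have se v : fsupp v -> rsummable (fun q : X * X => w q.1 q.2 * (v q.1 - v q.2) * (v
    q.1 - v q.2)).
  by move=> sv; apply: rsummable_energy => //; exact: fsupp_bounded.
apply: lerD.
  rewrite (ler_wpM2l (ltW h0))//; apply: lerD.
    rewrite ler_wpM2l//; apply: le_rsum; [|exact: se|exact: se].
    by move=> [x y] /=; rewrite -!mulrA ler_wpM2l ?weight_ge0// sqr_clip.
  apply: le_rsum; [|exact: sk|exact: sk].
  move=> x /=; rewrite -!mulrA ler_wpM2l ?killing_ge0//.
  by have := sqr_clip M (u x) 0; rewrite clip0// !subr0.
apply: le_rsum; [|apply: rsummable_inner; exact: lB|apply: rsummable_inner; exact: lB].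
move=> x /=; rewrite ler_wpM2l ?mass_ge0//.
by have := sqr_clip M (u x) (f x); rewrite (clip_id (fM x)).
Qed.

(** After clipping, the minimizing sequence is uniformly bounded, so its Laplacians converge
    pointwise; the first variation tested with delta functions then becomes the pointwise resolvent
    equation. *)
Lemma resolvent_eq h (f : H) (M : R) : 0 < h -> (forall x, 0 <= l2val f x <= M) ->
  forall x, 0 <= l2val (resolvent (@formA _ _ G) h f) x <= M /\
    l2val (resolvent (@formA _ _ G) h f) x + h * laplacian (l2val (resolvent
        (@formA _ _ G) h f)) x = l2val f x.
Proof.
move=> h0 fM x; have M0 : 0 <= M by have /andP[] := fM x; exact: le_trans.
have lf := l2_ell2 f; have [un [su [d d0 um]]] := minimizing_exists h0 lf.
pose vn n := clip M \o un n.
have sv n : fsupp (vn n) by apply: fsupp_le (su n) => y /= uy; rewrite /vn/= uy clip0.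
have vm : minimizing G h (l2val f) vn.
  split=> //; exists d => // n z sz; apply: le_trans (um n z sz).
  exact: functional_clip.
have [v av] := minimizing_approx h0 lf vm.
have lv : ell2 G v by case: av.
have -> : resolvent (@formA _ _ G) h f = to_l2 G v.
  apply/esym/resolvent_uniq => //; have := minimizing_operator h0 lf vm av.
  rewrite /formA to_l2E//; congr form_operator; apply/funext => y.
  by rewrite -[RHS]/(h^-1 * (l2val f y - l2val (to_l2 G v) y)) to_l2E.
rewrite to_l2E//.
have vpt y : vn n y @[n --> \oo] --> v y.
  apply: (norm2_cvg_point (G := G)); [by move=> n; exact: fsupp_ell2|exact: lv|by case: av].
split.
  apply/andP; split; [apply: (cvgr_to_ge (vpt x))|apply: (cvgr_to_le (vpt x))];
    by apply: nearW => n; have /andP[] := clip_itv (un n x) M0.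
have lap : laplacian (vn n) x @[n --> \oo] --> laplacian v x.
  apply: (@laplacian_cvg _ _ _ _ _ M) => //; apply: nearW => n y.
  by have /andP[c0 c1] := clip_itv (un n y) M0; rewrite ger0_norm.
pose b n := mu x * (h * laplacian (vn n) x + (vn n x - l2val f x)).
have sd := fsupp_delta R x.
have bE n : b n = h * form (vn n) (delta R x) + inner (vn n \- l2val f) (delta R x).
  rewrite form_green//; last exact: fsupp_bounded.
  by rewrite !inner_delta /b /=; ring.
have cb : b n @[n --> \oo] --> mu x * (h * laplacian v x + (v x - l2val f x)).
  apply: cvgMl_tmp; apply: cvgD; first exact: cvgMl_tmp.
  by apply: cvgB; [exact: vpt|exact: cvg_cst].
have b2 : b n ^+ 2 @[n --> \oo] --> 0.
  apply: (cvg0_le _ (cvg0Z (energy G h (delta R x)) d0)); apply: nearW => n;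
      rewrite sqr_ge0/=.
  rewrite bE [leRHS]mulrC; apply: minimizing_variation => // z sz.
  by apply: le_trans (functional_clip h0 M0 lf fM (su n)) _; exact: um.
have b0 : mu x * (h * laplacian v x + (v x - l2val f x)) = 0.
  apply/eqP; rewrite -sqrf_eq0; apply/eqP.
  have c2 : b n ^+ 2 @[n --> \oo] --> (mu x * (h * laplacian v x + (v x - l2val f x))) ^+ 2.
    by rewrite expr2; under eq_fun do rewrite expr2; exact: cvgM.
  exact: cvg_unique c2 b2.
move/eqP: b0; rewrite mulf_eq0 (negbTE (mass_neq0 G x)) /= => /eqP; lra.
Qed.

End Resolvent.
Section Derivative.
Variable R : realType.
Implicit Types (f : R -> R) (t l : R).

Lemma derive_near f t l : (forall e, 0 < e -> exists2 d, 0 < d &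
    forall s, `|s - t| < d -> `|f s - f t - (s - t) * l| <= `|s - t| * e) ->
  derivable f t 1 /\ derive1 f t = l.
Proof.
move=> fl; have c : h^-1 *: (f (h + t) - f t) @[h --> 0^'] --> l.
  apply/cvgrPdist_le => e e0; have [d d0 dP] := fl e e0.
  rewrite near_withinE; exists d => // h /=; rewrite sub0r normrN => hd h0.
  have := dP (h + t); rewrite addrK => /(_ hd).
  have hn : 0 < `|h| by rewrite normr_gt0.
  rewrite [leRHS]mulrC -ler_pdivrMr// => le0; apply: le_trans le0.
  rewrite -normfV -normrM distrC le_eqVlt; apply/orP; left; apply/eqP; congr `|_|.
  by rewrite /GRing.scale/=; field; exact: h0.
have E : (fun h => h^-1 *: ((f \o shift t) (h *: 1) - f t)) = (fun h => h^-1 *: (f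
    (h + t) - f t)).
  by apply/funext => h; rewrite /= /GRing.scale/= mulr1.
split; last exact: (cvg_lim (@Rhausdorff R) c).
by rewrite /derivable E; apply/cvg_ex; exists l.
Qed.

Lemma near_derive f t e : derivable f t 1 -> 0 < e -> exists2 d, 0 < d &
    forall s, `|s - t| < d -> `|f s - f t - (s - t) * derive1 f t| <= `|s - t| * e.
Proof.
move=> df e0; have c : h^-1 *: (f (h + t) - f t) @[h --> 0^'] --> derive1 f t.
  have E : (fun h => h^-1 *: ((f \o shift t) (h *: 1) - f t)) = (fun h => h^-1 *:
      (f (h + t) - f t)).
    by apply/funext => h; rewrite /= /GRing.scale/= mulr1.
  by move: df; rewrite /derivable E.
move/cvgrPdist_le: c => /(_ _ e0); rewrite near_withinE => -[d /= d0 dP].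
exists d => // s sd; have [->|st] := eqVneq s t.
  by rewrite !subrr mul0r subr0 normr0 mul0r.
have st0 : s - t != 0 by rewrite subr_eq0.
have := dP (s - t); rewrite /= sub0r normrN subrK => /(_ sd st0).
have hn : 0 < `|s - t| by rewrite normr_gt0.
rewrite -(ler_pM2l hn) -normrM; apply: le_trans; rewrite distrC le_eqVlt; apply/orP; left.
by apply/eqP; congr `|_|; rewrite /GRing.scale/=; field; exact: st0.
Qed.

End Derivative.

Section HeatSemigroup.
Variables (R : realType) (X : countType) (G : graph R X).
Local Notation laplacian := (Defs.laplacian G).
Local Notation H := (l2h G).
Local Notation A := (@formA R X G).
Local Notation toH f := (to_l2 G f : H).
Implicit Types (f g u v : X -> R).

Definition heat (t : R) f : X -> R := l2val (semigroup A t (toH f)).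

Lemma heat_sg : semigroup_of A (semigroup A).
Proof.
apply: S_semigroup_of; [exact: formA_lin|exact: formA_mono|exact:
    formA_range|exact: formA_dense].
Qed.

Lemma to_l2_linear (a : R) f g : ell2 G f -> ell2 G g ->
  toH (fun x => a * f x + g x) = a *: toH f + toH g.
Proof.
move=> sf sg; apply: l2_ext => x; rewrite to_l2E; last exact: ell2_linear.
by rewrite -[RHS]/(a * l2val (toH f) x + l2val (toH g) x) !to_l2E.
Qed.

Lemma heat_ell2 t f : ell2 G (heat t f). Proof. exact: l2_ell2. Qed.

Lemma toH_heat t f : toH (heat t f) = semigroup A t (toH f). Proof. exact: l2valK. Qed.

Lemma heat_linear t (a : R) f g : 0 <= t -> ell2 G f -> ell2 G g ->
  heat t (fun x => a * f x + g x) = fun x => a * heat t f x + heat t g x.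
Proof. by move=> t0 sf sg; rewrite /heat to_l2_linear// (sg_lin heat_sg). Qed.

Lemma heatD s t f : 0 <= s -> 0 <= t -> heat (s + t) f = heat s (heat t f).
Proof. by move=> s0 t0; rewrite /heat toH_heat (sg_D heat_sg). Qed.

Lemma norm2_sub (f g : X -> R) : ell2 G f -> ell2 G g ->
  norm2 G (f \- g) = nrm (toH f - toH g).
Proof.
move=> sf sg; rewrite -norm2_nrm; congr norm2; apply/funext => x.
by rewrite -[RHS]/(l2val (toH f) x - l2val (toH g) x) !to_l2E.
Qed.

Lemma norm2_toH f : ell2 G f -> norm2 G f = nrm (toH f).
Proof. by move=> sf; rewrite -norm2_nrm to_l2E. Qed.

Lemma generator_norm (u v z : H) (t : R) :
  norm2 G (fun x => t^-1 * (l2val u x - l2val v x) + l2val z x) =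
  nrm (t^-1 *: (u - v) + z).
Proof. by []. Qed.

Lemma heat_semigroup_heat : heat_semigroup G heat.
Proof.
split.
- move=> t f t0 sf; split; first exact: heat_ell2.
  by rewrite norm2_nrm norm2_toH//; exact: (sg_contr heat_sg).
- by move=> t a f g t0 sf sg; exact: heat_linear.
- move=> f sf; split; first by rewrite /heat (sg_0 heat_sg) to_l2E.
  by move=> s t s0 t0; exact: heatD.
- move=> f sf; apply: cvg_ext (sg_cont0 heat_sg (toH f)) => t.
  by have := norm2_sub (heat_ell2 t f) sf; rewrite toH_heat => ->.
- move=> f h sf sh.
  have E t : nrm (t^-1 *: (semigroup A t (toH f) - toH f) + toH h) =
      norm2 G (fun x => t^-1 * (heat t f x - f x) + h x).
    by rewrite -generator_norm !to_l2E.
  have EA : A (toH f) (toH h) <-> form_operator G f h by rewrite /formA !to_l2E.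
  split=> [/EA/(sg_gen heat_sg)|c]; first exact: cvg_ext.
  by apply/EA/(sg_gen heat_sg); apply: cvg_ext c => t; rewrite E.
Qed.

(** Stochastic completeness asserts the existence of some semigroup; this identifies any witness
    with [heat]. *)
Lemma heat_semigroup_unique W : heat_semigroup G W ->
  forall t f, 0 <= t -> ell2 G f -> W t f = heat t f.
Proof.
move=> [Wc Wl W0 Ws Wg] t f t0 sf.
pose V (t : R) (u : H) := toH (W t (l2val u)).
have lV s (u : H) : 0 <= s -> ell2 G (W s (l2val u)).
  by move=> s0; have [] := Wc s _ s0 (l2_ell2 u).
have sgV : semigroup_of A V.
  split.
  - move=> s u s0; rewrite -norm2_toH; last exact: lV.
    by have [_] := Wc s _ s0 (l2_ell2 u).
  - move=> s a u v s0; rewrite /V -to_l2_linear; try exact: lV.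
    by rewrite -Wl//; exact: l2_ell2.
  - by move=> u; rewrite /V; have [-> _] := W0 _ (l2_ell2 u); exact: l2valK.
  - move=> r s u r0 s0; rewrite /V to_l2E; last exact: lV.
    by have [_ ->] := W0 _ (l2_ell2 u).
  - move=> u; apply: cvg0_le (Ws _ (l2_ell2 u)); near=> s.
    have s0 : 0 < s by [].
    rewrite nrm_ge0/= norm2_sub; [|exact/lV/ltW|exact: l2_ell2].
    by rewrite l2valK.
  - move=> u k; have := Wg _ _ (l2_ell2 u) (l2_ell2 k).
    rewrite /formA => E; split.
      move=> /E; apply: cvg0_le; near=> s.
      have s0 : 0 < s by [].
      by rewrite nrm_ge0/= -generator_norm to_l2E//; apply/lV/ltW.
    move=> c; apply/E; apply: cvg0_le c; near=> s.
    have s0 : 0 < s by [].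
    by rewrite sqrtr_ge0/= -generator_norm to_l2E//; apply/lV/ltW.
have := semigroup_unique (formA_lin (G := G)) (@formA_mono _ _ G) (@formA_dense _ _
    G) sgV heat_sg (toH f) t0.
rewrite /V /heat => <-; rewrite !to_l2E//.
by have [] := Wc t _ t0 sf.
Unshelve. all: by end_near. Qed.

Lemma heat_limit t f x : 0 <= t -> ell2 G f ->
  l2val (backward_euler A m t (toH f)) x @[m --> \oo] --> heat t f x.
Proof.
move=> t0 sf; apply: nrm_cvg_point.
apply: S_cvg => //; [exact: formA_lin|exact: formA_mono|exact: formA_range|exact:
    formA_dense].
Qed.

(** If [h b <= 1/2], then [(1 + 2 h b)(1 - h b) >= 1], so with the barrier [v] each backward Euler
    step costs at most a factor [1 + 2 h b]. Over steps of total length at most [t] the product is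
    at most [expR (2 * b * t)]. *)
Lemma heat_le_super (t b : R) f v : 0 <= t -> 0 <= b -> ell2 G f ->
  bounded_function v -> (forall x, 0 <= v x) -> (forall x, f x <= v x) ->
  (forall x, - b * v x <= laplacian v x) ->
  forall x, heat t f x <= expR (2 * b * t) * v x.
Proof.
move=> t0 b0 sf bv v0 fv lv x.
have hc : l2val (backward_euler A m t (toH f)) x @[m --> \oo] --> heat t f x by
    exact: heat_limit.
apply: (cvgr_to_le hc).
have Jle h (c : R) (u : H) : 0 < h -> h * b <= 1 / 2 -> 0 <= c ->
    (forall y, l2val u y <= c * v y) ->
    forall y, l2val (resolvent A h u) y <= c * (1 + 2 * (h * b)) * v y.
  move=> h0 hb c0 uv; set c' := c * _.
  have hb0 : 0 <= h * b by rewrite mulr_ge0// ltW.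
  have c'0 : 0 <= c' by rewrite mulr_ge0//; lra.
  apply: resolvent_le => //.
  - have := bounded_linear c' bv (@bounded_cst _ _ 0).
    by congr bounded_function; apply/funext => y; rewrite addr0.
  - by move=> y; rewrite mulr_ge0.
  move=> y; have -> : laplacian (fun y => c' * v y) y = c' * laplacian v y.
    have := laplacian_linear G c' y bv (@bounded_cst _ _ 0).
    rewrite laplacian_cst mulr0 addr0 => <-; congr Defs.laplacian.
    by apply/funext => z; rewrite addr0.
  apply: (le_trans (uv y)).
  have l1 : h * c' * (- b * v y) <= h * c' * laplacian v y.
    by rewrite ler_wpM2l// mulr_ge0// ltW.
  have l2 : 0 <= (c' * (1 - h * b) - c) * v y.
    rewrite mulr_ge0// /c'.
    have -> : c * (1 + 2 * (h * b)) * (1 - h * b) - c = c * (h * b * (1 - 2 * (h *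
        b))) by ring.
    by rewrite !mulr_ge0//; lra.
  by lra.
have /cvgrPdist_le/(_ (1 / 2 / (b + 1))) := @step_cvg0 R.
case; first by rewrite divr_gt0//; lra.
move=> N _ NP; exists N => // m /= Nm.
have s0 := step_gt0 R m.
have hb : step R m * b <= 1 / 2.
  have := NP m Nm; rewrite /= sub0r normrN gtr0_norm// ler_pdivlMr; last by lra.
  by move: (step R m) s0 => a a0; nra.
rewrite TE.
have it n y : l2val (itJ A (step R m) n (toH f)) y <= (1 + 2 * (step R m * b)) ^+ n * v y.
  elim: n y => [|n IHn] y; first by rewrite expr0 mul1r /= to_l2E.
  rewrite exprSr; apply: Jle => //; rewrite exprn_ge0//.
  by rewrite addr_ge0// !mulr_ge0// ltW.
apply: (le_trans (it _ x)); rewrite ler_wpM2r//.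
have /andP[tn _] := truncn_step m t0; set n := Num.truncn _ in tn *.
apply: (@le_trans _ _ (expR (2 * (step R m * b)) ^+ n)).
  rewrite lerXn2r ?nnegrE ?expR_ge0// ?expR_ge1Dx//.
  by rewrite addr_ge0// !mulr_ge0// ltW.
rewrite -expRM_natl ler_expR.
have -> : n%:R * (2 * (step R m * b)) = 2 * b * (n%:R * step R m) by ring.
by rewrite ler_wpM2l// mulr_ge0.
Qed.

Lemma heat_ge0 t f x : 0 <= t -> ell2 G f -> (forall x, 0 <= f x) -> 0 <= heat t f x.
Proof.
move=> t0 sf f0; have sn : ell2 G (fun y => -1 * f y + 0) by apply: ell2_linear =>
    //; exact: ell20.
have h : heat t (fun y => -1 * f y + 0) x <= expR (2 * 0 * t) * 0.
  apply: (@heat_le_super t 0 _ (fun=> 0) t0 (lexx 0) sn (@bounded_cst _ _ 0)).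
  - by move=> y; exact: lexx.
  - by move=> y; rewrite addr0 mulN1r oppr_le0.
  - by move=> y; rewrite laplacian_cst !mulr0.
rewrite heat_linear// in h; last exact: ell20.
have E : heat t (fun=> 0) = fun=> 0.
  have := heat_linear (-1) t0 (ell20 G) (ell20 G).
  have -> : (fun _ : X => -1 * 0 + 0 : R) = fun=> 0 by apply/funext => y; ring.
  generalize (heat t (fun=> 0)) => F EF; apply/funext => y.
  by have := congr1 (fun F => F y) EF; rewrite /= mulN1r addNr.
by move: h; rewrite E; generalize (heat t f x) (expR (2 * 0 * t)) => z a; lra.
Qed.

Lemma heat_le t f g x : 0 <= t -> ell2 G f -> ell2 G g -> (forall x, f x <= g x) ->
  heat t f x <= heat t g x.
Proof.
move=> t0 sf sg fg; have h : 0 <= heat t (fun y => -1 * f y + g y) x.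
  apply: (heat_ge0 x t0 (ell2_linear (-1) sf sg)) => y.
  by rewrite mulN1r addrC subr_ge0.
rewrite heat_linear// in h.
by move: h; generalize (heat t f x) (heat t g x) => a b; lra.
Qed.

End HeatSemigroup.

(** * Stochastic completeness at infinity and bounded subsolutions *)

Section WithinContinuity.
Variable R : realType.
Implicit Types (F : R -> R) (A : set R).

Lemma within_continuousP A F : {within A, continuous F} <->
  (forall t, A t -> forall e, 0 < e -> exists2 d, 0 < d &
     forall s, A s -> `|s - t| < d -> `|F s - F t| <= e).
Proof.
split=> [/subspace_continuousP cF t At e e0|cF].
  have /cvgrPdist_le/(_ _ e0) := cF t At.
  rewrite near_withinE => -[d /= d0 dP]; exists d => // s As st.
  by rewrite distrC; apply: dP => //; rewrite /ball/= distrC.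
apply/subspace_continuousP => t At; apply/cvgrPdist_le => e e0.
have [d d0 dP] := cF t At e e0; rewrite near_withinE; exists d => // s /=.
by rewrite distrC => st As; rewrite distrC; apply: dP.
Qed.

End WithinContinuity.

Section IntegralOnItv.
Variables (R : realType) (t : R).
Hypothesis t0 : 0 < t.
Local Notation D := (`[0, t]%classic : set R).
Local Notation co F := {within D, continuous (F : R -> R)}.
Implicit Types F g : R -> R.

Definition rint F : R := (\int[lebesgue_measure]_(s in D) F s)%R.

Let mD : measurable D. Proof. exact: measurable_itv. Qed.

Lemma continuous_integrable F : co F ->
  (@lebesgue_measure R).-integrable D (EFin \o F).
Proof. by move=> cF; apply: continuous_compact_integrable => //;
    exact: segment_compact. Qed.

Lemma rintE F : co F ->
  (\int[lebesgue_measure]_(s in D) (F s)%:E = (rint F)%:E)%E.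
Proof.
by move=> cF; rewrite fineK//; apply: integrable_fin_num => //;
    exact: continuous_integrable.
Qed.

Lemma within_continuous_linear (a : R) F g : co F -> co g ->
  co (fun s => a * F s + g s).
Proof.
move=> /subspace_continuousP cF /subspace_continuousP cg.
apply/subspace_continuousP => s Ds; apply: cvgD; last exact: cg.
by apply: cvgMl_tmp; exact: cF.
Qed.

Lemma within_continuous_cst (a : R) : co (fun=> a).
Proof. by apply/subspace_continuousP => s Ds; exact: cvg_cst. Qed.

Lemma rint_linear (a : R) F g : co F -> co g ->
  rint (fun s => a * F s + g s) = a * rint F + rint g.
Proof.
move=> cF cg; have caF : co (fun s => a * F s).
  move/subspace_continuousP: cF => cF; apply/subspace_continuousP => s Ds.
  by apply: cvgMl_tmp; exact: cF.
rewrite /rint RintegralD//; [|exact: continuous_integrable|exact: continuous_integrable].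
by rewrite RintegralZl//; exact: continuous_integrable.
Qed.

Lemma rint_le F g : co F -> co g -> (forall s, 0 <= s <= t -> F s <= g s) ->
  rint F <= rint g.
Proof.
by move=> cF cg Fg; apply: le_Rintegral => //; exact: continuous_integrable.
Qed.

Lemma rint_ftc F f : co F -> co f ->
  (forall s, 0 < s < t -> derivable F s 1 /\ derive1 F s = f s) ->
  rint f = F t - F 0.
Proof.
move=> cF cf dF.
have [_ F0 Ft] := (continuous_within_itvP F t0).1 cF.
have := @continuous_FTC2 R f F 0 t t0 cf; rewrite rintE// => E.
suff /E : derivable_oo_LRcontinuous F 0 t.
  move=> {}E; have /E : {in `]0, t[, derive1 F =1 f}.
    by move=> s; rewrite in_itv/= => /dF[].
  by rewrite -EFinB => -[].
split=> // s; rewrite in_itv/= => /dF[//].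
Qed.

(** The pointwise limit is a constant, so no regularity in time of a limit function has to be
    established; both applications are arranged to have this form. *)
Lemma rint_dominated (Fn : nat -> R -> R) (M c : R) : (forall n, co (Fn n)) ->
  (forall n s, 0 <= s <= t -> `|Fn n s| <= M) ->
  (forall s, 0 <= s <= t -> Fn n s @[n --> \oo] --> c) ->
  rint (Fn n) @[n --> \oo] --> c * t.
Proof.
move=> cF FM Fc.
have mu : fine (lebesgue_measure D) = t.
  by rewrite lebesgue_measure_itv/= lte_fin t0 oppr0 adde0.
have -> : c * t = rint (fun=> c) by rewrite /rint Rintegral_cst// mu.
have H := @dominated_cvg _ _ R (@lebesgue_measure R) D mD
  (fun n s => (Fn n s)%:E) (fun=> c%:E) (fun=> M%:E).
have {H} : (\int[lebesgue_measure]_(s in D) (Fn n s)%:E)%E @[n --> \oo] -->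
    (\int[lebesgue_measure]_(s in D) c%:E)%E.
  apply: H => //.
  - by move=> n; apply: (measurable_int (@lebesgue_measure R));
        exact: continuous_integrable.
  - by move=> s /=; rewrite in_itv/= => /Fc Fs; apply: cvg_EFin => //; exact: nearW.
  - exact: (continuous_integrable (within_continuous_cst (a := M))).
rewrite (rintE (within_continuous_cst (a := c))); under eq_fun do rewrite rintE//.
by move=> /fine_cvgP[_].
Qed.

Lemma rint_monotone (Fn : nat -> R -> R) : (forall n, co (Fn n)) ->
  (forall n s, 0 <= s <= t -> 0 <= Fn n s) ->
  (forall m n s, 0 <= s <= t -> (m <= n)%N -> Fn m s <= Fn n s) ->
  ((rint (Fn n))%:E @[n --> \oo] -->
    \int[lebesgue_measure]_(s in D) limn (fun n => (Fn n s)%:E))%E.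
Proof.
move=> cF F0 Fm.
under eq_fun do rewrite -rintE//.
apply: (@cvg_monotone_convergence _ _ R (@lebesgue_measure R) D mD (fun n s => (Fn
    n s)%:E)).
- by move=> n; apply: (measurable_int (@lebesgue_measure R)); exact: continuous_integrable.
- by move=> n s Ds; rewrite lee_fin; apply: F0; move: Ds; rewrite /= in_itv.
- by move=> s Ds m n mn; rewrite lee_fin; apply: Fm => //; move: Ds; rewrite /= in_itv.
Qed.

End IntegralOnItv.
Section StochasticCompleteness.
Variables (R : realType) (X : countType) (G : graph R X).
Local Notation kappa := (killing G).
Local Notation mu := (mass G).
Local Notation laplacian := (Defs.laplacian G).
Local Notation H := (l2h G).
Local Notation A := (@formA R X G).
Local Notation toH f := (to_l2 G f : H).
Local Notation heat := (heat G).
Local Notation trunc := (@truncation R X).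
Implicit Types (f g u v : X -> R) (x : X).

Definition positive_subsolution := exists f (a : R),
  [/\ 0 < a, forall x, 0 <= f x <= 1, exists x, 0 < f x &
      forall x, laplacian f x <= - a * f x].

Lemma trunc_ell2 n f : ell2 G (trunc n f).
Proof. exact/fsupp_ell2/fsupp_truncation. Qed.

Lemma heat_point (u v : H) x (e : R) : nrm (u - v) <= Num.sqrt (mu x) * e ->
  `|l2val u x - l2val v x| <= e.
Proof.
move=> uv; apply: (le_trans (ler_point_nrm (u - v) x)).
by rewrite ler_pdivrMl// sqrtr_gt0 mass_gt0.
Qed.

Lemma heat_continuous t f x : 0 < t -> {within `[0, t], continuous (fun s => heat s f x)}.
Proof.
move=> t0; apply/within_continuousP => s; rewrite /= in_itv/= => /andP[s0 st] e e0.
have m0 : 0 < Num.sqrt (mu x) by rewrite sqrtr_gt0 mass_gt0.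
have [d1 d10 h1] := sg_left (heat_sg G) s (toH f) (mulr_gt0 m0 e0).
have [d2 d20 h2] := sg_right_cont (heat_sg G) (toH f) s0 (mulr_gt0 m0 e0).
exists (Num.min d1 d2) => [|r]; first by rewrite lt_min d10.
rewrite /= in_itv/= lt_min => /andP[r0 rt] /andP[rs1 rs2].
apply: heat_point => //; case: (ltgtP r s) => [rs|sr|->].
- rewrite nrmBC; apply: h1 => //; move: rs1; rewrite distrC gtr0_norm ?subr_gt0//.
  by move=> ?; apply/andP; split; lra.
- apply: h2; move: rs2; rewrite gtr0_norm ?subr_gt0//.
  by move=> ?; apply/andP; split; lra.
- by rewrite subrr nrm0 mulr_ge0 ?ltW.
Qed.

Lemma heat_ftc t (u u' : H) x : 0 < t -> A u u' ->
  rint t (fun s => heat s (l2val u') x) = l2val u x - heat t (l2val u) x.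
Proof.
move=> t0 Au; have m0 : 0 < Num.sqrt (mu x) by rewrite sqrtr_gt0 mass_gt0.
pose F s := -1 * heat s (l2val u) x + 0.
have cF : {within `[0, t], continuous F}.
  by apply: within_continuous_linear; [exact: heat_continuous|exact: within_continuous_cst].
rewrite (rint_ftc t0 cF) /F; first last.
- move=> s /andP[s0 st]; apply: derive_near => e e0.
  have [d d0 dP] := sg_deriv (heat_sg G) s0 Au (mulr_gt0 m0 e0).
  exists d => // r rs; have := dP r rs => le.
  have E : -1 * heat r (l2val u) x + 0 - (-1 * heat s (l2val u) x + 0) -
      (r - s) * heat s (l2val u') x = - (l2val (semigroup A r u - semigroup A s u +
          (r - s) *: semigroup A s u') x).
    rewrite -[X in _ = - X]/(l2val (semigroup A r u) x - l2val (semigroup A s u) x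
        + (r - s) * l2val (semigroup A s u') x).
    rewrite /heat !l2valK.
    generalize (l2val (semigroup A r u) x) (l2val (semigroup A s u) x) (l2val
        (semigroup A s u') x) => a b c.
    by ring.
  rewrite E normrN; apply: (le_trans (ler_point_nrm _ x)).
  rewrite ler_pdivrMl//; apply: (le_trans le).
  by rewrite mulrCA.
- exact: heat_continuous.
have -> : heat 0 (l2val u) = l2val u.
  by rewrite /heat l2valK (sg_0 (heat_sg G)).
by generalize (heat t (l2val u) x) (l2val u x) => a b; lra.
Qed.

Lemma heat_trunc_cvg s f x : 0 <= s -> ell2 G f ->
  heat s (trunc m f) x @[m --> \oo] --> heat s f x.
Proof.
move=> s0 sf; apply: nrm_cvg_point; apply: (cvg0_le _ (nrm_truncation sf)).
apply: nearW => n; rewrite nrm_ge0 -(sgB (heat_sg G) _ _ s0).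
exact: (sg_contr (heat_sg G)).
Qed.

Lemma heat_trunc_cvg2 s m (gn : nat -> X -> R) g (M : R) x : 0 <= s ->
  (forall n y, `|gn n y| <= M) -> (forall y, gn n y @[n --> \oo] --> g y) ->
  heat s (trunc m (gn n)) x @[n --> \oo] --> heat s (trunc m g) x.
Proof.
move=> s0 gM gg; apply: nrm_cvg_point.
have gM' y : `|g y| <= M.
  by apply: (cvgr_to_le (cvg_norm (gg y))); exact: nearW.
have c : Num.sqrt (inner G (trunc m (gn n) \- trunc m g) (trunc m (gn n) \- trunc m g))
    @[n --> \oo] --> 0.
  have c0 : inner G (trunc m (gn n) \- trunc m g) (trunc m (gn n) \- trunc m g) @[n
      --> \oo] --> 0.
    rewrite -[X in _ --> X](@rsum0 R X).
    apply: (@rsum_dominated _ _ _ _ _ _ _ (trunc m (fun y => mu y * ((2 * M) * (2 * M))))).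
    - exact/fsupp_rsummable/fsupp_truncation.
    - apply: nearW => n y; rewrite /= /truncation; case: ifP => _; last first.
        by rewrite subr0 !mulr0 normr0.
      have : `|gn n y - g y| <= 2 * M.
        by apply: (le_trans (ler_normB _ _)); have := gM n y; have := gM' y; lra.
      by move=> le; rewrite !normrM ger0_norm ?mass_ge0// ler_wpM2l ?mass_ge0// ler_pM.
    - move=> y /=; rewrite -(mulr0 (mu y)); apply: cvgMl_tmp.
      have : trunc m (gn n) y - trunc m g y @[n --> \oo] --> 0.
        rewrite -[X in _ --> X](subrr (trunc m g y)); apply: cvgB; last exact: cvg_cst.
        by rewrite /truncation; case: ifP => _; [exact: gg|exact: cvg_cst].
      by move=> c; rewrite -(mulr0 (0 : R)); apply: cvgM.
  by have := cvg_comp _ _ c0 (@sqrt_continuous R 0); rewrite sqrtr0.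
apply: (cvg0_le _ c); apply: nearW => n; rewrite nrm_ge0 -(sgB (heat_sg G) _ _ s0).
apply: le_trans (sg_contr (heat_sg G) _ s0) _.
by rewrite -norm2_sub; [exact: lexx|exact: trunc_ell2|exact: trunc_ell2].
Qed.

Lemma heat_trunc_homo s f x : 0 <= s -> (forall y, 0 <= f y) ->
  nondecreasing_seq (fun n => heat s (trunc n f) x).
Proof.
move=> s0 f0 m n mn; apply: heat_le => //; try exact: trunc_ell2.
move=> y; rewrite /truncation; case: ltnP => [ym|_]; last by case: ifP.
by rewrite (leq_trans ym mn).
Qed.

Lemma heat_trunc_itv s f x n (c : R) : 0 <= s -> (forall y, 0 <= f y <= c) ->
  0 <= heat s (trunc n f) x <= c.
Proof.
move=> s0 f0; have c0 : 0 <= c by have /andP[] := f0 x; exact: le_trans.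
apply/andP; split.
  apply: heat_ge0 => //; first exact: trunc_ell2.
  by move=> y; rewrite /truncation; case: ifP => // _; have /andP[] := f0 y.
have := @heat_le_super _ _ G s 0 (trunc n f) (fun=> c) s0 (lexx 0) (trunc_ell2 n f)
    (@bounded_cst _ _ c).
rewrite mulr0 mul0r expR0 mul1r; apply => // y.
  by rewrite /truncation; case: ifP => // _; have /andP[] := f0 y.
by rewrite laplacian_cst oppr0 mul0r mulr_ge0// divr_ge0 ?killing_ge0 ?mass_ge0.
Qed.

(** Real-valued counterpart of [extended heat]; a genuine limit when [f] is nonnegative and
    bounded. *)
Definition lheat s f x : R := limn (fun n => heat s (trunc n f) x).

Lemma lheat_cvg s f x (c : R) : 0 <= s -> (forall y, 0 <= f y <= c) ->
  heat s (trunc n f) x @[n --> \oo] --> lheat s f x.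
Proof.
move=> s0 f0; apply: nondecreasing_is_cvgn.
  by apply: heat_trunc_homo => // y; have /andP[] := f0 y.
by exists c => _ [n _ <-]; have /andP[] := heat_trunc_itv x n s0 f0.
Qed.

(** [kappa / mu] may be unbounded, so the integral could be infinite a priori. Both terms are
    monotone limits over truncations, hence the identity amounts to the convergence of one real
    sequence. *)
Lemma stochastic_completeness_real (t : R) x : 0 < t ->
  (Defs.extended heat t (cst 1%R) x +
     \int[lebesgue_measure]_(s in `[0%R, t])
        Defs.extended heat s (fun y => kappa y / mu y)%R x = 1)%E <->
  (heat t (trunc n (fun=> 1)) x + rint t (fun s => heat s (trunc n (fun y => kappa
      y / mu y)) x))
    @[n --> \oo] --> (1 : R).
Proof.
move=> t0; set I := (\int[lebesgue_measure]_(s in _) _)%E.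
have k0 y : 0 <= kappa y / mu y by rewrite divr_ge0 ?killing_ge0 ?mass_ge0.
pose e n := heat t (trunc n (fun=> 1)) x.
pose B n := rint t (fun s => heat s (trunc n (fun y => kappa y / mu y)) x).
have e0 n : 0 <= e n.
  by have /andP[] := @heat_trunc_itv t (fun=> 1) x n 1 (ltW t0) (fun y => introT
      andP (conj ler01 (lexx 1))).
have ec : ((e n)%:E @[n --> \oo] --> Defs.extended heat t (cst 1%R) x)%E.
  apply: ereal_nondecreasing_is_cvgn => m n mn; rewrite lee_fin.
  by apply: heat_trunc_homo => //; exact: ltW.
have Bc : ((B n)%:E @[n --> \oo] --> I)%E.
  apply: rint_monotone.
  - by move=> n; exact: heat_continuous.
  - move=> n s /andP[s0 _]; apply: heat_ge0 => //; first exact: trunc_ell2.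
    by move=> y; rewrite /truncation; case: ifP.
  - by move=> m n s /andP[s0 _] mn; apply: heat_trunc_homo.
have B0 n : 0 <= B n.
  have c0 : {within `[0, t], continuous (fun _ : R => 0 : R)} by exact:
      within_continuous_cst.
  have -> : 0 = rint t (fun=> 0).
    have := rint_linear (-1) c0 c0; rewrite (_ : (fun s : R => -1 * 0 + 0 : R) =
        fun=> 0); last first.
      by apply/funext => s; ring.
    by generalize (rint t (fun=> 0)) => z; lra.
  apply: rint_le => //; first exact: heat_continuous.
  move=> s /andP[s0 _]; apply: heat_ge0 => //; first exact: trunc_ell2.
  by move=> y; rewrite /truncation; case: ifP.
have E0 : (0 <= Defs.extended heat t (cst 1%R) x)%E.
  by apply: (cvge_ge _ ec); apply: nearW => n; rewrite lee_fin.
have I0 : (0 <= I)%E.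
  by apply: (cvge_ge _ Bc); apply: nearW => n; rewrite lee_fin.
have c : ((e n + B n)%:E @[n --> \oo] --> Defs.extended heat t (cst 1%R) x + I)%E.
  under eq_fun do rewrite EFinD.
  by apply: cvgeD => //; apply: ge0_adde_def; rewrite inE.
split=> [E|eB].
  by move: c; rewrite E => /fine_cvgP[_].
have : ((e n + B n)%:E @[n --> \oo] --> (1 : \bar R))%E.
  by apply: cvg_EFin eB => //; exact: nearW.
by move=> c1; apply: cvg_unique c c1.
Qed.

End StochasticCompleteness.
(* Unification must not unfold the semigroup down to its defining limits. *)
#[local] Opaque heat.

Lemma minr_lipschitz (R : realType) (a b c : R) :
  `|Num.min a c - Num.min b c| <= `|a - b|.
Proof.
have := maxr_lipschitz (- c) (- a) (- b).
rewrite -!oppr_min ![Num.min c _]minC -opprD normrN -opprD normrN; exact: id.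
Qed.

(** * The defect of the resolvents and its relation to completeness *)

Section Equivalence.
Variables (R : realType) (X : countType) (G : graph R X).
Local Notation kappa := (killing G).
Local Notation mu := (mass G).
Local Notation laplacian := (Defs.laplacian G).
Local Notation H := (l2h G).
Local Notation A := (@formA R X G).
Local Notation toH f := (to_l2 G f : H).
Local Notation heat := (heat G).
Local Notation trunc := (@truncation R X).
Implicit Types (f g u v : X -> R) (x : X).

Let alg (a b c d E : R) : E = b + (d - c) - 1^-1 * a -> b + (-1 * c + d) - a = E.
Proof. by move=> ->; rewrite invr1; ring. Qed.

Let alg2 (h a b c d E : R) : h != 0 -> E = b + (d - c) - h^-1 * a ->
  h * (b + (-1 * c + d) - E) = a.
Proof. by move=> h0 ->; field. Qed.

Section Exhaustion.
Variable h : R.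
Hypothesis h0 : 0 < h.

(** This is [(1 + h Delta) 1], so the constant 1 is a supersolution for each truncated source. *)
Definition source : X -> R := fun y => 1 + h * (kappa y / mu y).
Definition rhoH n : H := resolvent A h (toH (trunc n source)).
Definition rho n : X -> R := l2val (rhoH n).

Lemma source_ge0 y : 0 <= source y.
Proof.
by rewrite addr_ge0// mulr_ge0 ?(ltW h0)// divr_ge0 ?killing_ge0 ?mass_ge0.
Qed.

Lemma trunc_source_itv n y : 0 <= trunc n source y <= source y.
Proof. by rewrite /truncation; case: ifP; rewrite source_ge0 lexx. Qed.

Lemma rho_eq n x : 0 <= rho n x /\ rho n x + h * laplacian (rho n) x = trunc n source x.
Proof.
have sf := @fsupp_truncation R X n source; have [M fM] := fsupp_bounded sf.
have := @resolvent_eq _ _ G h (toH (trunc n source)) M h0.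
rewrite to_l2E; last exact: trunc_ell2.
move=> H1; have {H1}[] := H1 _ x.
  move=> y; have /andP[-> _] := trunc_source_itv n y.
  by rewrite (le_trans _ (fM y))// ler_norm.
by move=> /andP[r0 _].
Qed.

Lemma rho_le1 n x : rho n x <= 1.
Proof.
apply: (resolvent_le h0 (@bounded_cst _ X 1)) => y; first exact: ler01.
rewrite to_l2E; last exact: trunc_ell2.
rewrite laplacian_cst mulr1; have /andP[_] := trunc_source_itv n y; exact: id.
Qed.

Lemma rho_itv n x : 0 <= rho n x <= 1.
Proof. by have [-> _] := rho_eq n x; rewrite rho_le1. Qed.

Lemma rho_formA n : A (rhoH n) (h^-1 *: (toH (trunc n source) - rhoH n)).
Proof. exact: formA_resolvent. Qed.

Lemma rho_homo x : nondecreasing_seq (rho^~ x).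
Proof.
move=> m n mn; pose d : H := toH (trunc m source) - toH (trunc n source).
have : l2val (resolvent A h d) x <= 0.
  apply: (resolvent_le h0 (@bounded_cst _ X 0)) => y; first exact: lexx.
  rewrite laplacian_cst !mulr0 addr0.
  rewrite -[leLHS]/(l2val (toH (trunc m source)) y - l2val (toH (trunc n source)) y).
  rewrite !to_l2E; try exact: trunc_ell2.
  rewrite subr_le0 /truncation; case: ltnP => [ym|_].
    by rewrite (leq_trans ym mn).
  by case: ifP => _ //; exact: source_ge0.
have -> : resolvent A h d = rhoH m - rhoH n.
  exact: (JB (formA_lin (G := G)) (@formA_mono _ _ G) (@formA_range _ _ G) _ _ h0).
by rewrite -[leLHS]/(rho m x - rho n x) subr_le0.
Qed.

Lemma rho_ell2 n : ell2 G (rho n). Proof. exact: l2_ell2. Qed.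

Lemma rhoE n : l2val (rhoH n) = rho n. Proof. by []. Qed.

#[local] Opaque rho.

Definition rholim x : R := limn (rho^~ x).

Lemma rho_cvg x : rho n x @[n --> \oo] --> rholim x.
Proof.
apply: nondecreasing_is_cvgn; first exact: rho_homo.
by exists 1 => _ [n _ <-]; exact: rho_le1.
Qed.

Lemma rholim_itv x : 0 <= rholim x <= 1.
Proof.
have c : rho n x @[n --> \oo] --> rholim x by exact: rho_cvg.
apply/andP; split; [apply: (cvgr_to_ge c)|apply: (cvgr_to_le c)];
  by apply: nearW => n; have /andP[] := rho_itv n x.
Qed.

Lemma rho_le_rholim n x : rho n x <= rholim x.
Proof.
apply: nondecreasing_cvgn_le; first exact: rho_homo.
by apply/cvg_ex; exists (rholim x); exact: rho_cvg.
Qed.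

Lemma rholim_eq x : rholim x + h * laplacian rholim x = source x.
Proof.
have c1 : rho n x + h * laplacian (rho n) x @[n --> \oo] --> rholim x + h *
    laplacian rholim x.
  apply: cvgD; first exact: rho_cvg.
  apply: cvgMl_tmp; apply: (@laplacian_cvg _ _ _ _ _ _ _ _ 1); last exact: rho_cvg.
  by apply: nearW => n y; have /andP[? ?] := rho_itv n y; rewrite ger0_norm.
have c2 : rho n x + h * laplacian (rho n) x @[n --> \oo] --> source x.
  apply: cvg_near_cst; exists (pickle x).+1 => // n /= xn.
  by have [_ ->] := rho_eq n x; rewrite /truncation xn.
exact: cvg_unique c1 c2.
Qed.

Definition defect x : R := 1 - rholim x.

Lemma defect_itv x : 0 <= defect x <= 1.
Proof. by have := rholim_itv x; rewrite /defect; lra. Qed.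

Lemma defect_laplacian x : laplacian defect x = - h^-1 * defect x.
Proof.
have br : bounded_function rholim by exact: bounded_between rholim_itv.
have -> : defect = fun y => -1 * rholim y + 1 by apply/funext => y; rewrite /defect; ring.
rewrite laplacian_linear//; last exact: bounded_cst.
rewrite laplacian_cst mulr1; have := rholim_eq x; rewrite /source => E.
have hn := lt0r_neq0 h0.
have -> : laplacian rholim x = h^-1 * (1 + h * (kappa x / mu x) - rholim x).
  by rewrite -E; field.
by generalize (kappa x / mu x) (rholim x) => a b; field.
Qed.

Lemma defect_subsolution x : 0 < defect x -> positive_subsolution G.
Proof.
move=> d0; exists defect, h^-1; split; [by rewrite invr_gt0|exact: defect_itv|by exists x|].
by move=> y; rewrite defect_laplacian.
Qed.

(** The function [1 - f] is a nonnegative bounded supersolution for every truncated source; it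
    therefore lies above each [rho n], and above their limit. *)
Lemma subsolution_le_defect f : (forall y, 0 <= f y <= 1) ->
  (forall y, laplacian f y <= - h^-1 * f y) -> forall x, f x <= defect x.
Proof.
move=> f01 lf x; have bf : bounded_function f by exact: bounded_between f01.
have b1 : bounded_function (fun y => -1 * f y + 1) by apply: bounded_linear => //;
    exact: bounded_cst.
have le n : rho n x <= -1 * f x + 1.
  apply: (resolvent_le h0 b1) => y; first by have := f01 y; lra.
  rewrite to_l2E; last exact: trunc_ell2.
  rewrite laplacian_linear//; last exact: bounded_cst.
  rewrite laplacian_cst mulr1; have /andP[_ le] := trunc_source_itv n y.
  apply: (le_trans le); rewrite /source.
  have : h * laplacian f y <= - f y.
    by rewrite mulrC -ler_pdivlMr// mulrC (le_trans (lf y))// mulNr mulrN.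
  by generalize (kappa y / mu y) (laplacian f y) (f y) => a b c; lra.
have : rholim x <= -1 * f x + 1.
  have c : rho n x @[n --> \oo] --> rholim x by exact: rho_cvg.
  by apply: (cvgr_to_le c); exact: nearW.
by rewrite /defect; lra.
Qed.

Variables (t : R) (x : X).
Hypothesis t0 : 0 < t.

Let e n s := heat s (trunc n (fun=> 1)) x.
Let r n s := heat s (rho n) x.
Let B n := rint t (fun s => heat s (trunc n (fun y => kappa y / mu y)) x).

Lemma heat_rho_itv n s : 0 <= s -> 0 <= r n s <= 1.
Proof.
move=> s0; have lr := rho_ell2 n.
apply/andP; split; first by apply: heat_ge0 => // y; have /andP[] := rho_itv n y.
have := @heat_le_super _ _ G s 0 (rho n) (fun=> 1) s0 (lexx 0) lr (@bounded_cst _ _ 1).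
rewrite mulr0 mul0r expR0 mul1r; apply => // y; first exact: rho_le1.
by rewrite laplacian_cst oppr0 mul0r mulr1 divr_ge0 ?killing_ge0 ?mass_ge0.
Qed.

(** Interchange of two monotone limits, one in the truncation and one in [rho n]: the semigroup
    applied to [rho n] tends to the extended semigroup applied to [rholim]. *)
Lemma heat_rho_cvg s : 0 <= s -> r n s @[n --> \oo] --> lheat G s rholim x.
Proof.
move=> s0; have lr n := rho_ell2 n.
have rh : nondecreasing_seq (r^~ s).
  by move=> m n mn; exact: (heat_le x s0 (lr m) (lr n) (fun y => rho_homo y mn)).
have rc : cvgn (r^~ s).
  apply: nondecreasing_is_cvgn => //.
  by exists 1 => _ [n _ <-]; have /andP[] := heat_rho_itv n s0.
have lc : heat s (trunc n rholim) x @[n --> \oo] --> lheat G s rholim x.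
  exact: lheat_cvg s0 rholim_itv.
have lh := @heat_trunc_homo _ _ G s rholim x s0 (fun y => proj1 (andP (rholim_itv y))).
have E : limn (r^~ s) = lheat G s rholim x; last by move: rc; rewrite /cvg_to E; exact.
have c n : heat s (trunc m (rho n)) x @[m --> \oo] --> heat s (rho n) x.
  by apply: heat_trunc_cvg; [exact: s0|exact: lr].
have d m : heat s (trunc m (rho n)) x @[n --> \oo] --> heat s (trunc m rholim) x.
  apply: (@heat_trunc_cvg2 _ _ _ _ _ _ _ 1); [exact: s0| |exact: rho_cvg].
  by move=> n y; have /andP[? ?] := rho_itv n y; rewrite ger0_norm.
apply/le_anti/andP; split.
  apply: limr_le; first exact: rc.
  apply: nearW => n; apply: (cvgr_to_le (c n)); apply: nearW => m.
  apply: (@le_trans _ _ (heat s (trunc m rholim) x)); last first.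
    by apply: (cvgr_to_ge lc); exists m; [exact: I | move=> k mk; exact: (lh m k mk)].
  apply: (heat_le x s0 (trunc_ell2 G m _) (trunc_ell2 G m _)).
  by move=> y; rewrite /truncation; case: ifP => _; [exact: rho_le_rholim|exact: lexx].
apply: (cvgr_to_le lc); apply: nearW => m.
apply: (cvgr_to_le (d m)); apply: nearW => n.
apply: (@le_trans _ _ (r n s)); last by apply: nondecreasing_cvgn_le; [exact: rh|exact: rc].
apply: (heat_le x s0 (trunc_ell2 G m _) (lr n)).
by move=> y; rewrite /truncation; case: ifP => _; [exact: lexx|have /andP[] := rho_itv n y].
Qed.

(* Integrated form of [(d/ds) e^{-sL} rho = - e^{-sL} L rho]. *)
Lemma main_identity n : e n t + B n =
  rho n x + (e n t - r n t) - h^-1 * rint t (fun s => -1 * r n s + e n s).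
Proof.
have tk : 0 < t := t0; have hn := lt0r_neq0 h0.
have lr := rho_ell2 n.
pose kp s := heat s (trunc n (fun y => kappa y / mu y)) x.
have E s : 0 <= s <= t -> heat s (l2val (h^-1 *: (toH (trunc n source) - rhoH n))) x =
    kp s + h^-1 * (-1 * r n s + e n s).
  move=> /andP[s0 _].
  have -> : l2val (h^-1 *: (toH (trunc n source) - rhoH n)) =
    fun y => (- h^-1) * rho n y + (h^-1 * trunc n (fun=> 1) y + trunc n (fun y =>
        kappa y / mu y) y).
    apply/funext => y.
    rewrite -[LHS]/(h^-1 * (l2val (toH (trunc n source)) y - l2val (rhoH n) y))
        rhoE to_l2E; last exact: trunc_ell2.
    rewrite /truncation /source; generalize (kappa y / mu y) (rho n y) => a b.
    by case: ifP => _; field.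
  rewrite heat_linear//; last by apply: ell2_linear; exact: trunc_ell2.
  rewrite heat_linear//; try exact: trunc_ell2.
  rewrite -/(kp s) -/(e n s) -/(r n s).
  by generalize (kp s) (e n s) (r n s) => a b c; ring.
have ce : {within `[0, t], continuous (e n)} by exact: heat_continuous.
have cr : {within `[0, t], continuous (r n)} by exact: heat_continuous.
have ck : {within `[0, t], continuous kp} by exact: heat_continuous.
have cd : {within `[0, t], continuous (fun s => -1 * r n s + e n s)} by exact:
    (@within_continuous_linear _ t (-1) _ _ cr ce).
have F := heat_ftc x t0 (rho_formA n); rewrite rhoE in F.
have cL : {within `[0, t], continuous
    (fun s => heat s (l2val (h^-1 *: (toH (trunc n source) - rhoH n))) x)}.
  exact: heat_continuous.
have cR : {within `[0, t], continuous (fun s => h^-1 * (-1 * r n s + e n s) + kp s)}.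
  exact: (@within_continuous_linear _ t h^-1 _ _ cd ck).
have {}F : rint t (fun s => h^-1 * (-1 * r n s + e n s) + kp s) = rho n x - r n t.
  rewrite -F; apply/le_anti/andP; split; apply: rint_le => // s st;
      rewrite E// addrC; exact: lexx.
have L : rint t (fun s => h^-1 * (-1 * r n s + e n s) + kp s) =
    h^-1 * rint t (fun s => -1 * r n s + e n s) + B n := rint_linear h^-1 cd ck.
have : h^-1 * rint t (fun s => -1 * r n s + e n s) + B n = rho n x - r n t.
  exact: etrans (esym L) F.
move=> /(canRL (addKr _)) ->.
generalize (h^-1 * rint t (fun s => -1 * r n s + e n s)) (rho n x) (r n t) (e n t).
by move=> a c d f; ring.
Qed.

End Exhaustion.

#[local] Opaque rho.
Local Notation e x n s := (heat s (trunc n (fun=> 1)) x).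

Lemma heat_one_itv x n s : 0 <= s -> 0 <= e x n s <= 1.
Proof. by move=> s0; apply: heat_trunc_itv => // y; rewrite ler01 lexx. Qed.

Lemma heat_diff_cvg h x s : 0 < h -> 0 <= s ->
  -1 * heat s (rho h n) x + e x n s @[n --> \oo] --> lheat G s (defect h) x.
Proof.
move=> h0 s0.
have rc : heat s (rho h n) x @[n --> \oo] --> lheat G s (rholim h) x by exact: heat_rho_cvg.
have oi (y : X) : 0 <= (1 : R) <= 1 by rewrite ler01 lexx.
have ec : e x n s @[n --> \oo] --> lheat G s (fun=> 1) x by exact: (lheat_cvg s0 oi).
have lc : heat s (trunc n (rholim h)) x @[n --> \oo] --> lheat G s (rholim h) x.
  exact: (lheat_cvg s0 (rholim_itv h0)).
have dc : heat s (trunc n (defect h)) x @[n --> \oo] --> lheat G s (defect h) x.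
  exact: (lheat_cvg s0 (defect_itv h0)).
have E n : heat s (trunc n (defect h)) x = -1 * heat s (trunc n (rholim h)) x + e x n s.
  have -> : trunc n (defect h) = fun y => -1 * trunc n (rholim h) y + trunc n (fun=> 1) y.
    by apply/funext => y; rewrite /truncation /defect; case: ifP => _; ring.
  by rewrite heat_linear//; exact: trunc_ell2.
have lc' : -1 * heat s (trunc n (rholim h)) x + e x n s @[n --> \oo] -->
    -1 * lheat G s (rholim h) x + lheat G s (fun=> 1) x.
  by apply: cvgD; [apply: cvgMl_tmp; exact: lc|exact: ec].
have -> : lheat G s (defect h) x = -1 * lheat G s (rholim h) x + lheat G s (fun=> 1) x.
  have EF : (fun n => heat s (trunc n (defect h)) x) =
    (fun n => -1 * heat s (trunc n (rholim h)) x + e x n s) by apply/funext.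
  by rewrite EF in dc; exact: cvg_unique dc lc'.
by apply: cvgD; [apply: cvgMl_tmp; exact: rc|exact: ec].
Qed.

Lemma heat_diff_continuous h x t n : 0 < t ->
  {within `[0, t], continuous (fun s => -1 * heat s (rho h n) x + e x n s)}.
Proof.
move=> t0.
have cr : {within `[0, t], continuous (fun s => heat s (rho h n) x)} by exact:
    heat_continuous.
have ce : {within `[0, t], continuous (fun s => e x n s)} by exact: heat_continuous.
exact: (@within_continuous_linear _ t (-1) _ _ cr ce).
Qed.

Lemma heat_diff_bounded h x n s : 0 < h -> 0 <= s ->
  `|-1 * heat s (rho h n) x + e x n s| <= 1.
Proof.
move=> h0 s0; have := heat_rho_itv h0 x n s0; have := heat_one_itv x n s0.
by generalize (heat s (rho h n) x) (e x n s) => a b; rewrite ler_norml; lra.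
Qed.

(** A nonzero defect for [h = 1] would be a subsolution. With zero defect the right-hand side of
    [main_identity] at time 1 tends to [1 + 0 - 0]. *)
Lemma complete_of_no_subsolution :
  ~ positive_subsolution G -> stochastically_complete_at_infinity G.
Proof.
move=> nP; exists heat; first exact: heat_semigroup_heat.
exists 1; first exact: ltr01.
move=> x; apply/(stochastic_completeness_real G x ltr01).
have h0 : (0 : R) < 1 := ltr01.
have d0 y : defect 1 y = 0.
  have /andP[d0 _] := defect_itv h0 y; apply/le_anti/andP; split; last exact: d0.
  by case: (leP (defect 1 y) 0) => // dp; case: nP; exact: (defect_subsolution h0 dp).
have dE : defect 1 = fun=> 0 by apply/funext.
have l0 s : 0 <= s -> lheat G s (defect 1) x = 0.
  move=> s0; rewrite dE; have oi (y : X) : 0 <= (0 : R) <= 0 by rewrite lexx.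
  have lc : heat s (trunc n (fun=> 0)) x @[n --> \oo] --> lheat G s (fun=> 0) x.
    exact: (lheat_cvg s0 oi).
  apply/le_anti/andP; split; [apply: (cvgr_to_le lc)|apply: (cvgr_to_ge lc)];
    by apply: nearW => n; have /andP[] := heat_trunc_itv G x n s0 oi.
have dc s : 0 <= s -> -1 * heat s (rho 1 n) x + e x n s @[n --> \oo] --> (0 : R).
  by move=> s0; rewrite -(l0 s s0); exact: heat_diff_cvg.
have I : rint 1 (fun s => -1 * heat s (rho 1 n) x + e x n s) @[n --> \oo] --> 0 * (1 : R).
  apply: (rint_dominated ltr01 (M := 1)).
  - by move=> n; exact: heat_diff_continuous.
  - by move=> n s /andP[s0 _]; exact: heat_diff_bounded.
  - by move=> s /andP[s0 _]; exact: dc.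
have rc : rho 1 n x @[n --> \oo] --> rholim 1 x by exact: rho_cvg.
have r1 : rholim 1 x = 1 by apply/esym/eqP; rewrite -subr_eq0; apply/eqP; exact: (d0 x).
rewrite r1 in rc.
have F : rho 1 n x + (-1 * heat 1 (rho 1 n) x + e x n 1) -
    rint 1 (fun s => -1 * heat s (rho 1 n) x + e x n s) @[n --> \oo] --> 1 + 0 - 0
        * (1 : R).
  by apply: cvgB; [apply: cvgD; [exact: rc|exact: (dc 1 (ltW h0))]|exact: I].
rewrite mul0r subr0 addr0 in F; move: F; apply: cvg_ext => n.
exact: (alg (main_identity h0 x h0 n)).
Qed.

(** Since the defect [v] satisfies [laplacian v = - h^-1 * v], the barrier estimate bounds
    [e^{-(t-s)L} v] by a multiple of [v]. Applying [e^{-sL}] bounds the value at time [s] from below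
    by the one at time [t], as needed under an integral over [[0, t]]. *)
Lemma lheat_defect_le h x s t : 0 < h -> 0 <= s <= t ->
  lheat G t (defect h) x <= expR (2 * h^-1 * t) * lheat G s (defect h) x.
Proof.
move=> h0 /andP[s0 st]; have t0 := le_trans s0 st.
have ts0 : 0 <= t - s by rewrite subr_ge0.
have lt : heat t (trunc n (defect h)) x @[n --> \oo] --> lheat G t (defect h) x.
  exact: (lheat_cvg t0 (defect_itv h0)).
have ls : heat s (trunc n (defect h)) x @[n --> \oo] --> lheat G s (defect h) x.
  exact: (lheat_cvg s0 (defect_itv h0)).
have d0 y : 0 <= defect h y by have /andP[] := defect_itv h0 y.
have hm n : heat s (trunc n (defect h)) x <= lheat G s (defect h) x.
  apply: (cvgr_to_ge ls); exists n; [exact: I | move=> k nk].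
  exact: (heat_trunc_homo G x s0 d0 nk).
have i0 : 0 <= h^-1 by rewrite invr_ge0 (ltW h0).
apply: (cvgr_to_le lt); apply: nearW => n.
pose g := heat (t - s) (trunc n (defect h)).
have g_ell2 : ell2 G g by exact: heat_ell2.
have gd y : g y <= expR (2 * h^-1 * t) * defect h y.
  have bd : bounded_function (defect h) by exact: bounded_between (defect_itv h0).
  have := @heat_le_super _ _ G (t - s) h^-1 (trunc n (defect h)) (defect h) ts0 i0
      (trunc_ell2 G n _) bd d0.
  have tl z : trunc n (defect h) z <= defect h z.
    by rewrite /truncation; case: ifP => _; [exact: lexx|exact: d0].
  have dl z : - h^-1 * defect h z <= laplacian (defect h) z by rewrite
      (defect_laplacian h0) lexx.
  move=> /(_ tl dl y) H1; apply: (le_trans H1).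
  rewrite ler_wpM2r// ler_expR ler_wpM2l ?mulr_ge0// gerBl; exact: s0.
have : heat (s + (t - s)) (trunc n (defect h)) = heat s g := heatD G _ s0 ts0.
rewrite [s + _]addrC subrK => ->.
have gc : heat s (trunc m g) x @[m --> \oo] --> heat s g x by exact: heat_trunc_cvg.
apply: (cvgr_to_le gc); apply: nearW => m.
have -> : expR (2 * h^-1 * t) * lheat G s (defect h) x =
    expR (2 * h^-1 * t) * lheat G s (defect h) x + 0 by rewrite addr0.
apply: (@le_trans _ _ (expR (2 * h^-1 * t) * heat s (trunc m (defect h)) x)); last first.
  by rewrite addr0 ler_wpM2l ?expR_ge0//; exact: hm.
have z0 := ell20 G.
have E : heat s (fun y => expR (2 * h^-1 * t) * trunc m (defect h) y + trunc m
    (fun=> 0) y) x =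
    expR (2 * h^-1 * t) * heat s (trunc m (defect h)) x + heat s (trunc m (fun=> 0)) x.
  by rewrite heat_linear//; exact: trunc_ell2.
have oi (y : X) : 0 <= (0 : R) <= 0 by rewrite lexx.
have Z : heat s (trunc m (fun=> 0)) x = 0.
  by apply/le_anti; rewrite andbC; exact: (heat_trunc_itv G x m s0 oi).
rewrite Z addr0 in E; rewrite -E; apply: heat_le; [exact: s0|exact: trunc_ell2| |].
  by apply: ell2_linear; exact: trunc_ell2.
move=> y; rewrite /truncation; case: ifP => _; rewrite addr0; first exact: gd.
by rewrite mulr0.
Qed.

(** Write [v] for the defect and [q s] for [e^{-sL} v]. Under completeness, [main_identity] becomes
    [v = q t - h^-1 \int_0^t q] in the limit, and [q s >= q t / C] on [[0, t]]. *)
Lemma defect_contraction h t x : 0 < h -> 0 < t ->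
  heat t (trunc n (fun=> 1)) x + rint t (fun s => heat s (trunc n (fun y => kappa y
      / mu y)) x)
    @[n --> \oo] --> (1 : R) ->
  defect h x <= (1 - t / (h * expR (2 * h^-1 * t))) * lheat G t (defect h) x.
Proof.
move=> h0 t0 E1; pose C := expR (2 * h^-1 * t); have C0 : 0 < C by exact: expR_gt0.
pose q s := lheat G s (defect h) x; pose c := q t / C.
pose D n s := -1 * heat s (rho h n) x + e x n s.
have dc s : 0 <= s -> D n s @[n --> \oo] --> q s by move=> s0; exact: heat_diff_cvg.
have cD n : {within `[0, t], continuous (D n)} by exact: heat_diff_continuous.
have t0' := ltW t0.
have I1 : rint t (D n) @[n --> \oo] --> h * (rholim h x + q t - 1).
  have c1 : h * (rho h n x + D n t - (e x n t +
      rint t (fun s => heat s (trunc n (fun y => kappa y / mu y)) x))) @[n --> \oo] -->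
      h * (rholim h x + q t - 1).
    apply: cvgMl_tmp; apply: cvgB; last exact: E1.
    by apply: cvgD; [exact: rho_cvg|exact: dc].
  move: c1; apply: cvg_ext => n.
  exact: (alg2 (lt0r_neq0 h0) (main_identity h0 x t0 n)).
(* The minimum with [c] has the constant limit [c], because [c <= q s], and it lies below [D n]:
   this bounds the limit of the integrals of [D n] from below. *)
pose m n s := Num.min (D n s) c.
have cm n : {within `[0, t], continuous (m n)}.
  apply/within_continuousP => s Ds eps eps0.
  have [d d0 dP] := (within_continuousP _ _).1 (cD n) s Ds eps eps0.
  exists d => // s' Ds' ss'; apply: le_trans (dP s' Ds' ss').
  rewrite /m; generalize (D n s') (D n s) => a b.
  exact: minr_lipschitz.
have I2 : rint t (m n) @[n --> \oo] --> c * t.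
  apply: (rint_dominated t0 (M := 1 + `|c|)) => // [n s /andP[s0 _]|s /andP[s0 st]].
    have := heat_diff_bounded x n h0 s0; rewrite -/(D n s) /m.
    generalize (D n s) => a; rewrite !ler_norml => /andP[a1 a2].
    by case: (lerP a c) => ac; case: (lerP 0 c) => c0;
        rewrite ?(ger0_norm c0) ?(ltr0_norm c0); lra.
  have cs : c <= q s.
    rewrite /c ler_pdivrMr// mulrC; apply: lheat_defect_le => //.
    by rewrite s0.
  apply: (@squeeze_cvgr _ _ _ _ (fun n => c - `|D n s - q s|) (fun=> c)).
  - apply: nearW => n; rewrite /m; generalize (D n s) => a.
    case: (lerP a c) => ac; case: (lerP 0 (a - q s)) => aq;
      by rewrite ?(ger0_norm aq) ?(ltr0_norm aq); apply/andP; split; lra.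
  - rewrite -[X in _ --> X]subr0; apply: cvgB; first exact: cvg_cst.
    by rewrite -(@normr0 _ R); apply: cvg_norm; rewrite -(subrr (q s));
        apply: cvgB; [exact: dc|exact: cvg_cst].
  - exact: cvg_cst.
have le : c * t <= h * (rholim h x + q t - 1).
  apply: (ler_cvg_to I2 I1); apply: nearW => n; apply: rint_le => // s _.
  by rewrite /m; generalize (D n s) => a; case: (lerP a c) => ac; [exact: lexx|exact: ltW].
rewrite -/C -/(q t) /defect.
have -> : (1 - t / (h * C)) * q t = q t - h^-1 * (c * t).
  rewrite /c; have hn := lt0r_neq0 h0; have cn := lt0r_neq0 C0.
  by generalize (q t) C hn cn => a b hn' bn; field; rewrite hn' bn.
have : h^-1 * (c * t) <= rholim h x + q t - 1 by rewrite (ler_pdivrMl _ _ h0); exact: le.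
by move=> H; rewrite lerBrDr -lerBrDl opprB addrA [q t + _]addrC.
Qed.

(** With [h = a^-1] the subsolution lies below the defect. The contraction improves a uniform bound
    [th ^+ n] on the defect to [th ^+ n.+1], with [th < 1] depending only on [h] and the one given
    time [t]. *)
Lemma no_subsolution_of_complete :
  stochastically_complete_at_infinity G -> ~ positive_subsolution G.
Proof.
move=> [W hW [t t0 sc]] [f [a [a0 f01 [x0 fx0] lf]]].
have h0 : 0 < a^-1 by rewrite invr_gt0.
have t0' := ltW t0.
have lf' y : laplacian f y <= - (a^-1)^-1 * f y by rewrite invrK.
have fd := subsolution_le_defect h0 f01 lf'.
have WE s n g : 0 <= s -> W s (trunc n g) = heat s (trunc n g).
  by move=> s0; apply: (heat_semigroup_unique hW s0); exact: trunc_ell2.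
have WX s g x : 0 <= s -> Defs.extended W s g x = Defs.extended heat s g x.
  by move=> s0; rewrite /Defs.extended; congr (limn _); apply/funext => n; rewrite WE.
have E1 x : heat t (trunc n (fun=> 1)) x +
    rint t (fun s => heat s (trunc n (fun y => kappa y / mu y)) x) @[n --> \oo] --> (1 : R).
  apply/(stochastic_completeness_real G x t0); rewrite -(sc x) WX//; congr (_ + _)%E.
  apply: eq_integral => s; rewrite inE/= in_itv/= => /andP[s0 _].
  by rewrite WX.
pose h := a^-1; pose C := expR (2 * h^-1 * t); have C0 : 0 < C by exact: expR_gt0.
pose th := Num.max 0 (1 - t / (h * C)).
have th0 : 0 <= th by rewrite le_max lexx.
have th1 : th < 1 by rewrite gt_max ltr01 ltrBlDr ltrDl divr_gt0// mulr_gt0.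
have dn n y : defect h y <= th ^+ n.
  elim: n y => [|n IHn] y; first by rewrite expr0; have /andP[] := defect_itv h0 y.
  apply: (le_trans (defect_contraction h0 t0 (E1 y))).
  have di z : 0 <= defect h z <= th ^+ n by rewrite IHn andbT;
      have /andP[] := defect_itv h0 z.
  have lc : heat t (trunc n (defect h)) y @[n --> \oo] --> lheat G t (defect h) y.
    exact: (lheat_cvg t0' di).
  have l0 : 0 <= lheat G t (defect h) y.
    by apply: (cvgr_to_ge lc); apply: nearW => k; have /andP[] := heat_trunc_itv G
        y k t0' di.
  have l1 : lheat G t (defect h) y <= th ^+ n.
    by apply: (cvgr_to_le lc); apply: nearW => k; have /andP[] := heat_trunc_itv G
        y k t0' di.
  rewrite exprS; apply: (@le_trans _ _ (th * lheat G t (defect h) y)).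
    by rewrite ler_wpM2r// le_max lexx orbT.
  by rewrite ler_wpM2l.
have z : th ^+ n @[n --> \oo] --> (0 : R) by apply: cvg_expr; rewrite ger0_norm.
have : defect h x0 <= 0 by apply: (cvgr_to_ge z); apply: nearW => n; exact: dn.
by rewrite leNgt (lt_le_trans fx0 (fd x0)).
Qed.

End Equivalence.

(** * Monotone Euler schemes *)

Section LipschitzApproximation.
Variables (R : realType) (phi : R -> R) (C : R).
Hypotheses (C0 : 0 <= C) (cphi : continuous phi) (mphi : {homo phi : s t / s <= t}).
Hypothesis phi0 : phi 0 = 0.

Let values n s := [set phi r + n%:R * `|s - r| | r in [set r | `|r| <= C]].
(** Inf-convolution of [phi] on [[-C, C]] with [n] times the distance: it is [n]-Lipschitz and stays
    increasing there. The Lipschitz bound is what makes an explicit Euler step monotone. *)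
Definition infconv (n : nat) s : R := inf (values n s).

Let phi_lb r : `|r| <= C -> phi (- C) <= phi r.
Proof. by rewrite ler_norml => /andP[? _]; exact: mphi. Qed.

Let phi_ub r : `|r| <= C -> phi r <= phi C.
Proof. by rewrite ler_norml => /andP[_ ?]; exact: mphi. Qed.

Let n_ge0 (n : nat) (s r : R) : 0 <= n%:R * `|s - r|.
Proof. by rewrite mulr_ge0. Qed.

Lemma infconv_le n s r : `|r| <= C -> infconv n s <= phi r + n%:R * `|s - r|.
Proof.
move=> rC; apply: ge_inf; last by exists r.
exists (phi (- C)) => _ [r' /= r'C <-].
by have := phi_lb r'C; have := n_ge0 n s r'; lra.
Qed.

Lemma infconv_ge n s c : (forall r, `|r| <= C -> c <= phi r + n%:R * `|s - r|) ->
  c <= infconv n s.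
Proof.
move=> H; apply: lb_le_inf; last by move=> _ [r /= rC <-]; exact: H.
by exists (phi 0 + n%:R * `|s - 0|), 0; rewrite //= normr0.
Qed.

Lemma infconv_le_phi n s : `|s| <= C -> infconv n s <= phi s.
Proof. by move=> /(infconv_le n s); rewrite subrr normr0 mulr0 addr0. Qed.

Lemma infconv_lbound n s : phi (- C) <= infconv n s.
Proof.
by apply: infconv_ge => r rC; have := phi_lb rC; have := n_ge0 n s r; lra.
Qed.

Lemma infconv_homo n s t : `|s| <= C -> s <= t -> infconv n s <= infconv n t.
Proof.
move=> sC st; apply: infconv_ge => r rC; case: (lerP s r) => sr.
  apply: (le_trans (infconv_le_phi n sC)); have := mphi sr; have := n_ge0 n t r; lra.
apply: (le_trans (infconv_le n s rC)); rewrite lerD2l ler_wpM2l//.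
by rewrite !ger0_norm; lra.
Qed.

Lemma infconv_lipschitz n s t : infconv n t - n%:R * `|t - s| <= infconv n s.
Proof.
apply: infconv_ge => r rC; have := infconv_le n t rC.
have : n%:R * `|t - r| <= n%:R * `|t - s| + n%:R * `|s - r|.
  by rewrite -mulrDr ler_wpM2l// (le_trans _ (ler_normD _ _))// addrA subrK.
lra.
Qed.

(** Convergence with moving arguments, as the arguments will depend on [n]. A competitor [r] far
    from [s] is too expensive once [n * (d / 2)] exceeds the oscillation of [phi] on [[-C, C]]. *)
Lemma infconv_cvg s e : `|s| <= C -> 0 < e -> exists2 d, 0 < d &
  exists N : nat, forall n t, (N <= n)%N -> `|t| <= C -> `|t - s| < d ->
    `|infconv n t - phi s| <= e.
Proof.
move=> sC e0; have c : phi t @[t --> s] --> phi s by exact: cphi.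
move/cvgrPdist_le: c => /(_ e e0)/nbhs_ballP[d /= d0 dP].
have [N NP] : exists N : nat, phi C - phi (- C) <= N%:R * (d / 2).
  exists (Num.truncn ((phi C - phi (- C)) / (d / 2))).+1.
  by rewrite -ler_pdivrMr ?divr_gt0// ltW// truncnS_gt.
exists (d / 2); first by rewrite divr_gt0.
exists N => n t Nn tC ts; rewrite ler_norml; apply/andP; split; last first.
  have := infconv_le_phi n tC; have := dP t; rewrite /ball/= distrC => H1;
      have {H1}: `|phi s - phi t| <= e by apply: H1; lra.
  by rewrite ler_norml => /andP[]; lra.
suff : phi s - e <= infconv n t by lra.
apply: infconv_ge => r rC; case: (ltP `|s - r| d) => sr.
  by have := dP r sr; rewrite ler_norml => /andP[]; have := n_ge0 n t r; lra.
have tr : d / 2 <= `|t - r|.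
  have : `|s - r| <= `|t - s| + `|t - r|.
    by rewrite [`|t - s|]distrC (le_trans _ (ler_normD _ _))// addrA subrK.
  lra.
have : N%:R * (d / 2) <= n%:R * `|t - r|.
  by apply: ler_pM => //; [lra|rewrite ler_nat].
by have := phi_ub sC; have := phi_lb rC; lra.
Qed.

Lemma lipschitz_approximation : exists (psi : nat -> R -> R) (B : R),
  [/\ forall n, psi n 0 = 0,
      forall n s t, - C <= s -> s <= t -> t <= C ->
        0 <= psi n t - psi n s <= n%:R * (t - s),
      forall n s, `|s| <= C -> `|psi n s| <= B
    & forall s e, `|s| <= C -> 0 < e -> exists2 d, 0 < d &
        exists N : nat, forall n t, (N <= n)%N -> `|t| <= C -> `|t - s| < d ->
          `|psi n t - phi s| <= e].
Proof.
have z : `|0 : R| <= C by rewrite normr0.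
(* An inf-convolution may be negative at 0; subtracting its value there restores [psi n 0 = 0] and
   keeps all increments. *)
exists (fun n s => infconv n s - infconv n 0), (phi C - phi (- C)); split.
- by move=> n; rewrite subrr.
- move=> n s t Cs st tC; have sC : `|s| <= C by rewrite ler_norml Cs (le_trans st).
  have := infconv_homo n sC st; have := infconv_lipschitz n s t.
  by rewrite (ger0_norm (_ : 0 <= t - s)) ?subr_ge0//; lra.
- move=> n s sC; have := infconv_lbound n s; have := infconv_lbound n 0.
  have := infconv_le_phi n sC; have := infconv_le_phi n z; have := phi_ub sC;
      have := phi_ub z.
  by rewrite ler_norml; lra.
- move=> s e sC e0; have e20 : 0 < e / 2 by rewrite divr_gt0.
  have [d d0 [N NP]] := infconv_cvg sC e20.
  have [d' d'0 [N' N'P]] := infconv_cvg z e20.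
  exists d => //; exists (maxn N N') => n t; rewrite geq_max => /andP[Nn N'n] tC ts.
  have := NP n t Nn tC ts; have := N'P n 0 N'n z; rewrite subrr normr0 phi0 => /(_ d'0).
  by rewrite !ler_norml; lra.
Qed.

End LipschitzApproximation.

Section DiscreteScheme.
Variables (R : realType) (X : countType) (G : graph R X).
Local Notation kappa := (killing G).
Local Notation mu := (mass G).
Local Notation laplacian := (Defs.laplacian G).
Implicit Types (f g u v : X -> R) (x : X).

(** The diagonal coefficient of the Laplacian. It is finite at each vertex but may be unbounded over
    [X], so step lengths are chosen per finite set. *)
Definition rate x : R := (degree G x + kappa x) / mu x.

Lemma rate_ge0 x : 0 <= rate x.
Proof. by rewrite divr_ge0 ?(ltW (mass_gt0 G x))// addr_ge0 ?degree_ge0 ?killing_ge0. Qed.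

(** For [c = f x] this is the maximum principle at a nonnegative maximum; the general form controls
    one Euler step. The condition [0 <= c] takes care of the killing term. *)
Lemma laplacian_ge f c x : bounded_function f -> (forall y, f y <= c) -> 0 <= c ->
  - rate x * (c - f x) <= laplacian f x.
Proof.
move=> bf fc c0; rewrite laplacian_eq// /rate.
have -> : - ((degree G x + kappa x) / mu x) * (c - f x) =
    (- (degree G x + kappa x) * (c - f x)) / mu x by rewrite !mulNr mulrAC.
rewrite ler_pM2r ?invr_gt0 ?mass_gt0//.
have : rsum (fun y => weight G x y * f y) <= degree G x * c.
  rewrite mulrC /degree -rsumZ; last exact: weight_summable.
  apply: le_rsum.
  - by move=> y; rewrite mulrC ler_wpM2r ?weight_ge0.
  - exact: rsummable_weight_bounded.
  - exact/rsummableZ/weight_summable.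
have := mulr_ge0 (killing_ge0 G x) c0.
generalize (degree G x) (kappa x) (f x) (rsum (fun y => weight G x y * f y)).
by move=> a b d e; rewrite mulrBr mulrDl; lra.
Qed.

Lemma laplacianN f x : bounded_function f -> laplacian (fun y => - f y) x = - laplacian f x.
Proof.
move=> bf; have -> : (fun y => - f y) = fun y => -1 * f y + 0.
  by apply/funext => y; rewrite mulN1r addr0.
by rewrite laplacian_linear ?laplacian_cst//; [rewrite mulr0 addr0 mulN1r|exact:
    bounded_cst].
Qed.

Lemma laplacian_le f c x : bounded_function f -> (forall y, c <= f y) -> c <= 0 ->
  laplacian f x <= rate x * (f x - c).
Proof.
move=> bf fc c0; rewrite -[leLHS]opprK -laplacianN// lerNl.
have [B fB] := bf; have bn : bounded_function (fun y => - f y).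
  by exists B => y; rewrite normrN.
have := @laplacian_ge (fun y => - f y) (- c) x bn; rewrite oppr_ge0 opprK => /(_ _ c0).
by rewrite mulNr [- c + _]addrC; apply => y; rewrite lerN2.
Qed.

Lemma laplacian_norm f B x : (forall y, `|f y| <= B) -> `|laplacian f x| <= rate x
    * (2 * B).
Proof.
move=> fB; have bf : bounded_function f by exists B.
have B0 : 0 <= B := le_trans (normr_ge0 _) (fB x).
have fi y : - B <= f y <= B by rewrite -ler_norml.
have rx := rate_ge0 x.
rewrite ler_norml; apply/andP; split.
  apply: le_trans (laplacian_ge x bf (fun y => proj2 (andP (fi y))) B0).
  by rewrite mulNr lerN2 ler_wpM2l//; have := fi x; lra.
have nB : - B <= 0 by rewrite oppr_le0.
apply: (le_trans (laplacian_le x bf (fun y => proj1 (andP (fi y))) nB)).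
by rewrite ler_wpM2l//; have := fi x; lra.
Qed.

(** A positive supremum would be attained in the finite set, where [laplacian_ge] makes the
    Laplacian nonnegative. *)
Lemma maximum_principle n D : bounded_function D ->
  (forall x, (n <= pickle x)%N -> D x <= 0) ->
  (forall x, (pickle x < n)%N -> 0 < D x -> laplacian D x < 0) -> forall x, D x <= 0.
Proof.
move=> bD out inn x0; rewrite leNgt; apply/negP => Dx0.
have x0n : (pickle x0 < n)%N by rewrite ltnNge; apply/negP => /out; rewrite leNgt Dx0.
pose i0 := Ordinal x0n.
have [i _ imax] := @Order.TotalTheory.arg_maxP _ _ _ i0 xpredT (fun i : 'I_n =>
    term D i) isT.
have ti : 0 < term D i.
  by apply: lt_le_trans (imax i0 isT); rewrite /= term_pickle.
move: ti imax; rewrite {1 2}/term; case E : (pickle_inv i) => [x|] /=; last by rewrite ltxx.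
move=> Dx imax; have xi : pickle x = i :> nat.
  by have := @pickle_invK X i; rewrite /obind/oapp/= E.
have xn : (pickle x < n)%N by rewrite xi.
have Dmax y : D y <= D x.
  case: (ltnP (pickle y) n) => yn; last exact: (le_trans (out y yn) (ltW Dx)).
  by have := imax (Ordinal yn) isT; rewrite /= /term pickleK_inv.
have := laplacian_ge x bD Dmax (ltW Dx).
by rewrite subrr mulr0 leNgt inn.
Qed.

Section Scheme.
Variables (psi : R -> R) (n : nat) (h C L B : R).
Hypotheses (h0 : 0 < h) (psi0 : psi 0 = 0).
Hypothesis psiL : forall s t, - C <= s -> s <= t -> t <= C ->
  0 <= psi t - psi s <= L * (t - s).
Hypothesis psiB : forall s, `|s| <= C -> `|psi s| <= B.
Hypothesis hL : forall x, (pickle x < n)%N -> h * (L * rate x) <= 1.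

(* Explicit Euler steps on the finite set [pickle x < n], with the constant
   value [M] maintained on its complement. *)
Definition euler_step (M : R) u : X -> R :=
  fun x => if (pickle x < n)%N then u x - h * laplacian (fun y => psi (u y)) x else M.

Definition euler (u0 : X -> R) M (k : nat) : X -> R :=
  iter k (euler_step M) (fun x => if (pickle x < n)%N then u0 x else M).

Lemma psi_homo s t : - C <= s -> s <= t -> t <= C -> psi s <= psi t.
Proof. by move=> Cs st tC; have := psiL Cs st tC; lra. Qed.

Lemma psi_bounded u : (forall x, `|u x| <= C) -> bounded_function (fun y => psi (u y)).
Proof. by move=> uC; exists B => x; exact: psiB. Qed.

(** The step condition [hL] prevents overshooting: the Laplacian at [x] is at most [rate x * L]
    times the distance from [u x] to the end of the interval. The interval contains 0 because
    killing pulls values towards 0. *)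
Lemma euler_step_itv M u (lo hi : R) : - C <= lo -> lo <= 0 -> 0 <= hi -> hi <= C ->
  lo <= M <= hi -> (forall x, lo <= u x <= hi) -> forall x, lo <= euler_step M u x <= hi.
Proof.
move=> Clo lo0 hi0 hiC Mi ui x; rewrite /euler_step; case: ifP => // xn.
have uC y : `|u y| <= C by rewrite ler_norml; have := ui y; lra.
have bu := psi_bounded uC; have /andP[u1 u2] := ui x.
have r0 := rate_ge0 x.
apply/andP; split.
  have a1 y : psi lo <= psi (u y).
    by have := ui y; have := uC y; rewrite ler_norml => *; apply: psi_homo; lra.
  have a2 : psi lo <= 0 by rewrite -psi0; apply: psi_homo; lra.
  have := laplacian_le x bu a1 a2; have := @psiL lo (u x) Clo u1 (le_trans u2 hiC).
  move=> /andP[_ H1] H2.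
  have {}H2 : h * laplacian (fun y => psi (u y)) x <= h * (rate x * (L * (u x - lo))).
    by rewrite ler_wpM2l ?(ltW h0)// (le_trans H2)// ler_wpM2l.
  have : h * (L * rate x) * (u x - lo) <= 1 * (u x - lo) by rewrite ler_wpM2r ?hL//
      subr_ge0.
  have -> : h * (L * rate x) * (u x - lo) = h * (rate x * (L * (u x - lo))) by ring.
  by rewrite mul1r; lra.
have a1 y : psi (u y) <= psi hi.
  by have := ui y; have := uC y; rewrite ler_norml => *; apply: psi_homo; lra.
have a2 : 0 <= psi hi by rewrite -psi0; apply: psi_homo; lra.
have := laplacian_ge x bu a1 a2; have := @psiL (u x) hi (le_trans Clo u1) u2 hiC.
move=> /andP[_ H1] H2.
have {}H2 : h * (- rate x * (L * (hi - u x))) <= h * laplacian (fun y => psi (u y)) x.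
  rewrite ler_wpM2l ?(ltW h0)// (le_trans _ H2)// !mulNr lerN2 ler_wpM2l//.
have : h * (L * rate x) * (hi - u x) <= 1 * (hi - u x) by rewrite ler_wpM2r ?hL// subr_ge0.
have -> : h * (L * rate x) * (hi - u x) = - (h * (- rate x * (L * (hi - u x)))) by ring.
by rewrite mul1r; lra.
Qed.

Lemma euler_itv u0 M (lo hi : R) : - C <= lo -> lo <= 0 -> 0 <= hi -> hi <= C ->
  lo <= M <= hi -> (forall x, lo <= u0 x <= hi) ->
  forall k x, lo <= euler u0 M k x <= hi.
Proof.
move=> Clo lo0 hi0 hiC Mi ui; elim => [|k IHk] x /=; first by case: ifP.
exact: euler_step_itv.
Qed.

Section Bounded.
Variables (u0 : X -> R) (M : R).
Hypotheses (MC : `|M| <= C) (u0C : forall x, `|u0 x| <= C).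
Local Notation u := (euler u0 M).

Lemma euler_le k x : `|u k x| <= C.
Proof.
have C0 : 0 <= C := le_trans (normr_ge0 _) MC.
rewrite ler_norml; apply: euler_itv; rewrite ?lexx ?oppr_le0 -?ler_norml//.
by move=> y; rewrite -ler_norml.
Qed.

Let bpsi k : bounded_function (fun y => psi (u k y)).
Proof. by apply: psi_bounded; exact: euler_le. Qed.

Lemma eulerS k x : u k.+1 x =
  if (pickle x < n)%N then u k x - h * laplacian (fun y => psi (u k y)) x else M.
Proof. by []. Qed.

Lemma euler_out k x : (n <= pickle x)%N -> u k x = M.
Proof.
by rewrite leqNgt => /negbTE nx; case: k => [|k]; rewrite ?eulerS /= ?nx.
Qed.

Lemma euler_diff (D e : R) x k m : (pickle x < n)%N ->
  (forall i, (k <= i < k + m)%N -> `|laplacian (fun y => psi (u i y)) x - D| <= e) ->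
  `|u (k + m)%N x - u k x + m%:R * h * D| <= m%:R * h * e.
Proof.
move=> xn; elim: m => [|m IHm] H; first by rewrite addn0 subrr !mul0r addr0 normr0.
rewrite addnS eulerS xn.
have -> : u (k + m)%N x - h * laplacian (fun y => psi (u (k + m)%N y)) x - u k x +
    m.+1%:R * h * D =
    (u (k + m)%N x - u k x + m%:R * h * D) -
    h * (laplacian (fun y => psi (u (k + m)%N y)) x - D).
  by rewrite -[m.+1%:R]natr1; ring.
have -> : m.+1%:R * h * e = m%:R * h * e + h * e by rewrite -[m.+1%:R]natr1; ring.
apply: (le_trans (ler_normB _ _)); apply: lerD.
  by apply: IHm => i /andP[ki im]; apply: H; rewrite ki addnS ltnS ltnW.
by rewrite normrM gtr0_norm// ler_pM2l// H// leq_addr addnS ltnS leqnn.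
Qed.

Lemma euler_lipschitz x k m :
  `|u (k + m)%N x - u k x| <= m%:R * h * (rate x * (2 * B)).
Proof.
have B0 : 0 <= B := le_trans (normr_ge0 _) (psiB MC).
case: (ltnP (pickle x) n) => xn; last first.
  have r0 := rate_ge0 x; have h0' := ltW h0.
  by rewrite !euler_out// subrr normr0; do 2![apply: mulr_ge0 => //]; apply: mulr_ge0.
have := @euler_diff 0 (rate x * (2 * B)) x k m xn; rewrite mulr0 addr0; apply => i _.
by rewrite subr0; apply: laplacian_norm => y; apply: psiB; exact: euler_le.
Qed.

Definition euler_sum N : X -> R := fun x => \sum_(k < N) psi (u k x).

Lemma euler_sumS N : euler_sum N.+1 = fun x => 1 * euler_sum N x + psi (u N x).
Proof. by apply/funext => x; rewrite /euler_sum big_ord_recr mul1r. Qed.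

Lemma euler_sum_bounded N : bounded_function (euler_sum N).
Proof.
elim: N => [|N IHN]; last by rewrite euler_sumS; exact: bounded_linear.
by exists 0 => x; rewrite /euler_sum big_ord0 normr0.
Qed.

(** The scheme telescopes, so [h] times the Laplacian of the sum stays bounded by [2 C] however
    large [N] is. *)
Lemma euler_sum_laplacian N x : (pickle x < n)%N ->
  h * laplacian (euler_sum N) x = u 0 x - u N x.
Proof.
move=> xn; elim: N => [|N IHN].
  have -> : euler_sum 0 = fun=> 0 by apply/funext => y; rewrite /euler_sum big_ord0.
  by rewrite laplacian_cst !mulr0 subrr.
rewrite euler_sumS laplacian_linear//; last exact: euler_sum_bounded.
by rewrite eulerS xn mul1r mulrDr IHN; ring.
Qed.

Lemma euler_sum_out N x : (n <= pickle x)%N -> euler_sum N x = N%:R * psi M.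
Proof.
move=> nx; rewrite /euler_sum; under eq_bigr do rewrite euler_out//.
by rewrite sumr_const card_ord mulr_natl.
Qed.

Variables (g : X -> R) (A : R).
Hypotheses (g01 : forall x, 0 <= g x <= 1) (gA : forall x, 0 < g x -> laplacian g x <= - A).
Let bg : bounded_function g. Proof. exact: bounded_between g01. Qed.
Let C0 : 0 <= C := le_trans (normr_ge0 _) MC.

(** The barrier on the left lies below the sum off the finite set, where the sum is [N * psi M], and
    wherever [g = 0], since every term is at least [psi (- C)]. Elsewhere, by [big], its Laplacian
    is more negative than that of the sum can be, and the maximum principle applies. *)
Lemma euler_sum_ge N x (c := psi M - psi (- C)) : 2 * C < h * N%:R * (c * A) ->
  N%:R * (psi (- C) + c * g x) <= euler_sum N x.
Proof.
move=> big.
have /andP[CM MC'] : - C <= M <= C by rewrite -ler_norml.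
have c0 : 0 <= c by rewrite subr_ge0 psi_homo.
have N0 : 0 <= N%:R :> R by [].
pose D y := -1 * euler_sum N y + ((N%:R * c) * g y + N%:R * psi (- C)).
have bD : bounded_function D.
  apply: bounded_linear; first exact: euler_sum_bounded.
  by apply: bounded_linear => //; exact: bounded_cst.
suff : D x <= 0 by rewrite /D; lra.
have sumC y : N%:R * psi (- C) <= euler_sum N y.
  rewrite -[N in N%:R]card_ord mulr_natl -sumr_const; apply: ler_sum => k _.
  by have := euler_le k y; rewrite ler_norml => /andP[a b]; exact: psi_homo.
apply: (maximum_principle (n := n) bD) => {x} x xn.
  rewrite /D euler_sum_out//; have /andP[_ g1] := g01 x.
  have : N%:R * c * g x <= N%:R * c * 1 by rewrite ler_wpM2l// mulr_ge0.
  by rewrite /c; lra.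
move=> Dx; have gx : 0 < g x.
  case/andP: (g01 x); rewrite le_eqVlt => /orP[/eqP g0 _|//].
  by move: Dx; rewrite /D -g0; have := sumC x; lra.
rewrite -(pmulr_rlt0 _ h0) /D laplacian_linear; [|exact: euler_sum_bounded|]; last first.
  by apply: bounded_linear => //; exact: bounded_cst.
rewrite laplacian_linear//; last exact: bounded_cst.
rewrite laplacian_cst mulrDr mulN1r mulrN euler_sum_laplacian//.
have := euler_le 0 x; have := euler_le N x; rewrite !ler_norml.
have l1 : h * (N%:R * c * laplacian g x) <= h * (N%:R * c * - A).
  by rewrite ler_pM2l// ler_wpM2l ?gA// mulr_ge0.
have l2 : h * (kappa x / mu x * (N%:R * psi (- C))) <= 0.
  rewrite mulr_ge0_le0 ?(ltW h0)// mulr_ge0_le0 ?divr_ge0 ?killing_ge0 ?(ltW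
      (mass_gt0 G x))//.
  by rewrite mulr_ge0_le0// -psi0 psi_homo// oppr_le0.
move: l1 l2 big; rewrite [h * (_ + _)]mulrDr.
have -> : h * (N%:R * c * - A) = - (h * N%:R * (c * A)) by ring.
generalize (h * (N%:R * c * laplacian g x)) (h * (kappa x / mu x * (N%:R * psi (- C)))).
generalize (h * N%:R * (c * A)) (u 0 x) (u N x).
by move=> a b d e f; lra.
Qed.

(** Mirror image of the lower bound: the barrier now lies above the sum where [g = 0], since every
    term is at most [psi C]. *)
Lemma euler_sum_le N x (c := psi C - psi M) : 2 * C < h * N%:R * (c * A) ->
  euler_sum N x <= N%:R * (psi C - c * g x).
Proof.
move=> big.
have /andP[CM MC'] : - C <= M <= C by rewrite -ler_norml.
have c0 : 0 <= c by rewrite subr_ge0 psi_homo.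
have N0 : 0 <= N%:R :> R by [].
pose D y := 1 * euler_sum N y + ((N%:R * c) * g y + - (N%:R * psi C)).
have bD : bounded_function D.
  apply: bounded_linear; first exact: euler_sum_bounded.
  by apply: bounded_linear => //; exact: bounded_cst.
suff : D x <= 0 by rewrite /D; lra.
have sumC y : euler_sum N y <= N%:R * psi C.
  rewrite -[N in N%:R]card_ord mulr_natl -sumr_const; apply: ler_sum => k _.
  by have := euler_le k y; rewrite ler_norml => /andP[a b]; exact: psi_homo.
apply: (maximum_principle (n := n) bD) => {x} x xn.
  rewrite /D euler_sum_out//; have /andP[_ g1] := g01 x.
  have : N%:R * c * g x <= N%:R * c * 1 by rewrite ler_wpM2l// mulr_ge0.
  by rewrite /c; lra.
move=> Dx; have gx : 0 < g x.
  case/andP: (g01 x); rewrite le_eqVlt => /orP[/eqP g0 _|//].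
  by move: Dx; rewrite /D -g0; have := sumC x; lra.
rewrite -(pmulr_rlt0 _ h0) /D laplacian_linear; [|exact: euler_sum_bounded|]; last first.
  by apply: bounded_linear => //; exact: bounded_cst.
rewrite laplacian_linear//; last exact: bounded_cst.
rewrite laplacian_cst mulrDr mul1r euler_sum_laplacian//.
have := euler_le 0 x; have := euler_le N x; rewrite !ler_norml.
have l1 : h * (N%:R * c * laplacian g x) <= h * (N%:R * c * - A).
  by rewrite ler_pM2l// ler_wpM2l ?gA// mulr_ge0.
have l2 : h * (kappa x / mu x * - (N%:R * psi C)) <= 0.
  rewrite mulrN mulrN oppr_le0 mulr_ge0 ?(ltW h0)// mulr_ge0 ?divr_ge0 ?killing_ge0
      ?(ltW (mass_gt0 G x))//.
  by rewrite mulr_ge0// -psi0 psi_homo// ?oppr_le0.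
move: l1 l2 big; rewrite [h * (_ + _)]mulrDr.
have -> : h * (N%:R * c * - A) = - (h * N%:R * (c * A)) by ring.
generalize (h * (N%:R * c * laplacian g x)) (h * (kappa x / mu x * - (N%:R * psi C))).
generalize (h * N%:R * (c * A)) (u 0 x) (u N x).
by move=> a b d e f; lra.
Qed.

End Bounded.

(** Subtracting the two barriers bounds the average over [N] steps of the gap from below; some step
    attains at least the average. Near [g x = 1] the bound is close to [psi M' - psi M]. *)
Lemma euler_gap u0 M M' g A N x :
  (forall x, `|u0 x| <= C) -> `|M| <= C -> `|M'| <= C ->
  (forall x, 0 <= g x <= 1) -> (forall x, 0 < g x -> laplacian g x <= - A) -> 0 <= A ->
  2 * C < h * N%:R * ((psi M' - psi M) * A) ->
  exists2 k, (k < N)%N & (psi M' - psi M) * g x - (1 - g x) * (psi C - psi (- C)) <=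
    psi (euler u0 M' k x) - psi (euler u0 M k x).
Proof.
move=> u0C MC M'C g01 gA A0 big.
set d := (psi M' - psi M) * g x - (1 - g x) * (psi C - psi (- C)).
have MC1 : - C <= M <= C by rewrite -ler_norml.
have MC2 : - C <= M' <= C by rewrite -ler_norml.
have C0 : 0 <= C := le_trans (normr_ge0 _) MC.
have p1 : psi (- C) <= psi M by apply: psi_homo; lra.
have p2 : psi M' <= psi C by apply: psi_homo; lra.
have hN : 0 <= h * N%:R by rewrite mulr_ge0// ltW.
have b1 : 2 * C < h * N%:R * ((psi M' - psi (- C)) * A).
  by apply: (lt_le_trans big); rewrite ler_wpM2l// ler_wpM2r//; lra.
have b2 : 2 * C < h * N%:R * ((psi C - psi M) * A).
  by apply: (lt_le_trans big); rewrite ler_wpM2l// ler_wpM2r//; lra.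
have s1 := euler_sum_ge M'C u0C g01 gA x b1.
have s2 := euler_sum_le MC u0C g01 gA x b2.
have N0 : (0 < N)%N.
  by rewrite lt0n; apply/eqP => N0; move: big; rewrite N0 mulr0 mul0r; lra.
have : N%:R * d <= \sum_(k < N) (psi (euler u0 M' k x) - psi (euler u0 M k x)).
  rewrite big_split/= sumrN; apply: le_trans (lerB s1 s2).
  by rewrite -mulrBr ler_wpM2l// /d; lra.
case: (pselect (exists2 k, (k < N)%N & d <= psi (euler u0 M' k x) - psi (euler u0 M
    k x))) => // no.
move=> /le_gtF/negP[]; rewrite -[N in N%:R]card_ord mulr_natl -sumr_const.
apply: ltr_sum => [|k _]; first by apply/hasP; exists (Ordinal N0); rewrite ?mem_index_enum.
by rewrite ltNge; apply/negP => dk; apply: no; exists k.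
Qed.

End Scheme.

End DiscreteScheme.

Section UltraLimit.
Variable R : realType.

Lemma free_ultrafilter : exists U : set_system nat, UltraFilter U /\ \oo `<=` U.
Proof. exact: (ultraFilterLemma eventually_filter). Qed.

(** Compactness of [[-C, C]]. A single ultrafilter provides the limits for all vertices and all
    times at once, without extracting subsequences. *)
Lemma ultra_cvg (U : set_system nat) {UU : UltraFilter U} (a : nat -> R) (C : R) :
  (forall n, `|a n| <= C) -> a n @[n --> U] --> lim (a n @[n --> U]).
Proof.
move=> aC; have UF : UltraFilter (a n @[n --> U]).
  split; first exact: fmap_proper_filter.
  move=> V VF UV; apply/seteqP; split => // A VA.
  have [//|UcA] := @in_ultra_setVsetC nat U (a @^-1` A) UU.
  have VcA : V (~` A) by apply: UV; exact: UcA.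
  have : V (A `&` ~` A) by exact: filterI.
  by rewrite setICr => /filter_not_empty.
have := @segment_compact R (- C) C; rewrite compact_ultra => /(_ _ UF)[].
  by apply: nearW => n /=; rewrite in_itv/= -ler_norml.
by move=> l [_ /= al]; exact: (cvgP l al).
Qed.

End UltraLimit.

Section Peak.
Variables (R : realType) (X : countType) (G : graph R X).
Local Notation laplacian := (Defs.laplacian G).

(* The witness is the normalized part of the subsolution above a level close
   to its supremum. *)
Lemma subsolution_peak (A eta : R) : positive_subsolution G -> 0 < A -> 0 < eta ->
  exists (g : X -> R) x, [/\ forall y, 0 <= g y <= 1,
    forall y, 0 < g y -> laplacian g y <= - A & 1 - eta < g x].
Proof.
move=> [f [a [a0 f01 [x0 fx0] lf]]] A0 eta0.
have bf : bounded_function f by exact: bounded_between f01.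
pose E : set R := range f; pose sg := sup E.
have fE y : E (f y) by exists y.
have hE : has_sup E.
  split; first by exists (f x0).
  by exists 1 => _ [y _ <-]; have /andP[] := f01 y.
have f_le y : f y <= sg by apply: ub_le_sup => //; exact: hE.2.
have sg0 : 0 < sg := lt_le_trans fx0 (f_le x0).
(* The first bound keeps the level [c] above [sg / 2], so that [laplacian f <= - a * sg / 2] above
   it; the second turns this into [- A] after division by [eps]. Choosing [f x] within [eta * eps]
   of the supremum gives [g x > 1 - eta]. *)
pose eps := Num.min (sg / 2) (a * sg / 2 / A).
have e0 : 0 < eps by rewrite lt_min !divr_gt0// mulr_gt0.
have e1 : eps <= sg / 2 by rewrite ge_min lexx.
have e2 : A * eps <= a * sg / 2 by rewrite mulrC -ler_pdivlMr// ge_min lexx orbT.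
pose c := sg - eps.
have c0 : 0 <= c by rewrite /c; lra.
pose g y := Num.max 0 (f y - c) / eps.
have [_ [x _ <-] fx] := sup_adherent (mulr_gt0 eta0 e0) hE.
exists g, x; have ei : 0 < eps^-1 by rewrite invr_gt0.
have g01 y : 0 <= g y <= 1.
  rewrite /g divr_ge0 ?ler_pdivrMr ?mul1r ?(ltW e0) ?le_max ?lexx//=.
  by rewrite ge_max (ltW e0)/= /c; have := f_le y; lra.
split => //; last first.
  rewrite /g ltr_pdivlMr//; apply: (@lt_le_trans _ _ (f x - c)).
    by rewrite -/sg in fx; rewrite /c; lra.
  by rewrite le_max lexx orbT.
move=> y gy; have fy : c < f y.
  rewrite -subr_gt0 ltNge; apply/negP => H; move: gy; rewrite /g.
  by rewrite (elimT max_idPl H) mul0r ltxx.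
have bg : bounded_function g by exact: bounded_between g01.
(* [D <= 0] with equality at [y]: the maximum principle transfers the Laplacian of the uncut affine
   function of [f] to [g], and the killing term of the subtracted constant has the right sign. *)
pose D z := -1 * g z + (eps^-1 * f z + - (eps^-1 * c)).
have b1 : bounded_function (fun z => eps^-1 * f z + - (eps^-1 * c)).
  by apply: bounded_linear => //; exact: bounded_cst.
have bD : bounded_function D by exact: bounded_linear.
have D0 z : D z <= 0.
  rewrite /D /g mulN1r addrC subr_le0 -mulrBr mulrC ler_pM2r//.
  by rewrite le_max lexx orbT.
have Dy : D y = 0.
  rewrite /D /g (elimT max_idPr _); last by rewrite subr_ge0 ltW.
  by ring.
have := laplacian_ge G y bD D0 (lexx 0); rewrite Dy subrr mulr0 /D.
rewrite laplacian_linear// laplacian_linear//; last exact: bounded_cst.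
rewrite laplacian_cst => H.
have k0 : 0 <= killing G y / mass G y * (eps^-1 * c).
  by rewrite mulr_ge0 ?divr_ge0 ?killing_ge0 ?(ltW (mass_gt0 G y))// mulr_ge0// ltW.
have l1 : eps^-1 * laplacian f y <= - A.
  rewrite mulrC ler_pdivrMr//; apply: (le_trans (lf y)).
  rewrite !mulNr lerN2; apply: (le_trans e2).
  by rewrite -mulrA ler_pM2l//; move: fy; rewrite /c; lra.
have alg (p q r : R) : 0 <= -1 * p + (q - r) -> 0 <= r -> q <= - A -> p <= - A by lra.
by rewrite mulrN in H; exact: alg H k0 l1.
Qed.

End Peak.

(** * Limits of the Euler schemes along an ultrafilter *)

Section EulerLimit.
Variables (R : realType) (X : countType) (G : graph R X).
Local Notation laplacian := (Defs.laplacian G).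
Local Notation rate := (rate G).
Variables (phi : R -> R) (C B : R) (psi : nat -> R -> R) (u0 : X -> R).
Hypotheses (cphi : continuous phi) (psi0 : forall n, psi n 0 = 0).
Hypothesis psiL : forall n s t, - C <= s -> s <= t -> t <= C ->
  0 <= psi n t - psi n s <= n%:R * (t - s).
Hypothesis psiB : forall n s, `|s| <= C -> `|psi n s| <= B.
Hypothesis psi_cvg : forall s e, `|s| <= C -> 0 < e -> exists2 d, 0 < d &
  exists N : nat, forall n t, (N <= n)%N -> `|t| <= C -> `|t - s| < d ->
    `|psi n t - phi s| <= e.
Hypothesis u0C : forall x, `|u0 x| <= C.
Variable U : set_system nat.
Hypotheses (UU : UltraFilter U) (UN : \oo `<=` U).

(** The factor [n.+1] forces the step to 0. The other one dominates [n * rate x] for every vertex of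
    the finite set, because the sum bounds each rate; the summand 1 keeps it positive. *)
Definition stepsize (n : nat) : R :=
  (n.+1%:R * (1 + n%:R * rsum (truncation n rate)))^-1.

Let trunc_rate_ge0 n x : 0 <= truncation n rate x.
Proof. by rewrite /truncation; case: ifP => // _; exact: rate_ge0. Qed.

Let srate n : rsummable (truncation n rate).
Proof. exact/fsupp_rsummable/fsupp_truncation. Qed.

Let denominator_ge1 n : 1 <= 1 + n%:R * rsum (truncation n rate).
Proof. by rewrite lerDl mulr_ge0// rsum_ge0. Qed.

Lemma stepsize_gt0 n : 0 < stepsize n.
Proof. by rewrite invr_gt0 mulr_gt0// (lt_le_trans ltr01). Qed.

Lemma stepsize_le n : stepsize n <= n.+1%:R^-1.
Proof.
rewrite /stepsize lef_pV2 ?posrE//; last by rewrite mulr_gt0// (lt_le_trans ltr01).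
by rewrite ler_peMr.
Qed.

Lemma stepsize_rate n x : (pickle x < n)%N -> stepsize n * (n%:R * rate x) <= 1.
Proof.
move=> xn; have D0 : 0 < n.+1%:R * (1 + n%:R * rsum (truncation n rate)).
  by rewrite mulr_gt0// (lt_le_trans ltr01).
rewrite ler_pdivrMl// mulr1.
have : rate x <= rsum (truncation n rate).
  by have := @le_rsum1 _ _ (truncation n rate) x (srate n) (trunc_rate_ge0 n);
      rewrite /truncation xn.
move=> /(ler_wpM2l (ler0n R n)) H.
apply: (@le_trans _ _ (1 * (1 + n%:R * rsum (truncation n rate)))).
  by rewrite mul1r; lra.
by rewrite ler_wpM2r ?ler1n// (le_trans ler01).
Qed.

Lemma stepsize_small e : 0 < e -> \forall n \near U, stepsize n <= e.
Proof.
move=> e0; apply: UN; exists (Num.truncn e^-1) => // n /= en.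
apply: (le_trans (stepsize_le n)); rewrite invf_ple ?posrE//.
by rewrite (le_trans (ltW (truncnS_gt _)))// ler_nat ltnS.
Qed.

Lemma near_pickle (x : X) : \forall n \near U, (pickle x < n)%N.
Proof. by apply: UN; exists (pickle x).+1. Qed.

Definition ticks (n : nat) (t : R) : nat := Num.truncn (t / stepsize n).
Definition clock n t : R := (ticks n t)%:R * stepsize n.

Lemma clock_le n t : 0 <= t -> clock n t <= t.
Proof.
move=> t0; rewrite /clock -ler_pdivlMr ?stepsize_gt0// truncn_le.
by rewrite divr_ge0// ltW// stepsize_gt0.
Qed.

Lemma clock_gt n t : t - stepsize n < clock n t.
Proof.
rewrite ltrBlDr -[X in _ + X]mul1r -mulrDl natr1 -ltr_pdivrMr ?stepsize_gt0//.
exact: truncnS_gt.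
Qed.

Lemma clock_near n t : `|clock n t - Num.max t 0| <= stepsize n.
Proof.
have h0 := stepsize_gt0 n; case: (lerP t 0) => t0.
  have -> : clock n t = 0.
    rewrite /clock /ticks; have -> : Num.truncn (t / stepsize n) = 0%N.
      by apply/truncn0Pn; rewrite -ltNge (le_lt_trans _ ltr01)// mulr_le0_ge0//
          invr_ge0 ltW.
    by rewrite mul0r.
  by rewrite subrr normr0 ltW.
have := clock_le n (ltW t0); have := clock_gt n t; rewrite ler_norml.
by generalize (clock n t) => a; lra.
Qed.

Lemma clock_lipschitz n s t : `|clock n t - clock n s| <= `|t - s| + 2 * stepsize n.
Proof.
have M : `|Num.max t 0 - Num.max s 0| <= `|t - s|.
  by rewrite ![Num.max _ 0]maxC; exact: maxr_lipschitz.
move: (clock_near n s) (clock_near n t) M.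
generalize (clock n t) (clock n s) (Num.max t 0) (Num.max s 0) (`|t - s|) (stepsize n).
by move=> a b c d e f; rewrite !ler_norml; lra.
Qed.

Lemma ticks_mul n (k : nat) : ticks n (k%:R * stepsize n) = k.
Proof. by rewrite /ticks mulfK ?natrK// gt_eqF// stepsize_gt0. Qed.

Lemma le_ticks n s t : s <= t -> (ticks n s <= ticks n t)%N.
Proof. by move=> st; apply: le_truncn; rewrite ler_pM2r// invr_gt0 stepsize_gt0. Qed.

Definition approx M n t x : R := euler G (psi n) n (stepsize n) u0 M (ticks n t) x.

Definition limit_solution M t x : R := lim (approx M n t x @[n --> U]).

Lemma approx_itv M (lo hi : R) n t x : - C <= lo -> lo <= 0 -> 0 <= hi -> hi <= C ->
  lo <= M <= hi -> (forall x, lo <= u0 x <= hi) -> lo <= approx M n t x <= hi.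
Proof.
move=> *; apply: (@euler_itv _ _ _ _ _ _ C n%:R B) => //; first exact: stepsize_gt0.
- exact: psiL.
- exact: psiB.
- exact: stepsize_rate.
Qed.

Section BoundaryValue.
Variable M : R.
Hypothesis MC : `|M| <= C.
Local Notation u := (limit_solution M).

Let C0 : 0 <= C := le_trans (normr_ge0 _) MC.
Let B0 : 0 <= B := le_trans (normr_ge0 _) (psiB 0 MC).

Lemma approx_le n t x : `|approx M n t x| <= C.
Proof.
rewrite ler_norml; apply: approx_itv; rewrite ?lexx ?oppr_le0 -?ler_norml// => y.
by rewrite -ler_norml.
Qed.

Definition speed x := rate x * (2 * B).

Lemma speed_ge0 x : 0 <= speed x.
Proof. by rewrite mulr_ge0 ?rate_ge0// mulr_ge0. Qed.

Lemma approx_lipschitz n s t x :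
  `|approx M n t x - approx M n s x| <= speed x * (`|t - s| + 2 * stepsize n).
Proof.
have H (k m : nat) : (k <= m)%N -> `|euler G (psi n) n (stepsize n) u0 M m x -
    euler G (psi n) n (stepsize n) u0 M k x| <= speed x * `|m%:R * stepsize n -
        k%:R * stepsize n|.
  move=> km; have h0 := stepsize_gt0 n.
  have := @euler_lipschitz _ _ G (psi n) n (stepsize n) C n%:R B h0 (psi0 n)
    (@psiL n) (@psiB n) (@stepsize_rate n) u0 M MC u0C x k (m - k).
  rewrite subnKC// => /le_trans; apply.
  by rewrite -mulrBl -natrB// normrM normr_nat gtr0_norm// mulrC.
apply: le_trans (ler_wpM2l (speed_ge0 x) (clock_lipschitz n s t)).
case/orP: (leq_total (ticks n s) (ticks n t)) => [/H//|/H].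
by rewrite distrC [X in _ <= _ * X -> _]distrC.
Qed.

Lemma limit_solution_cvg t x : approx M n t x @[n --> U] --> u t x.
Proof. by apply: (@ultra_cvg _ _ _ _ C) => n; exact: approx_le. Qed.

Lemma limit_solution_itv (lo hi : R) t x : - C <= lo -> lo <= 0 -> 0 <= hi -> hi <= C ->
  lo <= M <= hi -> (forall x, lo <= u0 x <= hi) -> lo <= u t x <= hi.
Proof.
move=> h1 h2 h3 h4 h5 h6; have c : approx M n t x @[n --> U] --> u t x :=
    limit_solution_cvg (t := t) (x := x).
have H n := approx_itv n t x h1 h2 h3 h4 h5 h6.
apply/andP; split; [apply: (cvgr_to_ge c)|apply: (cvgr_to_le c)];
  by apply: nearW => n; have /andP[] := H n.
Qed.

Lemma limit_solution_le t x : `|u t x| <= C.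
Proof.
rewrite ler_norml; apply: limit_solution_itv; rewrite ?lexx ?oppr_le0 -?ler_norml// => y.
by rewrite -ler_norml.
Qed.

Lemma limit_solution_lipschitz s t x : `|u t x - u s x| <= speed x * `|t - s|.
Proof.
have c : `|approx M n t x - approx M n s x| @[n --> U] --> `|u t x - u s x|.
  by apply: cvg_norm; apply: cvgB; exact: limit_solution_cvg.
apply/ler_addgt0Pr => e e0; apply: (cvgr_to_le c).
have d0 : 0 < e / (2 * (speed x + 1)).
  by rewrite divr_gt0// mulr_gt0//; have := speed_ge0 x; lra.
apply: filterS (stepsize_small d0) => n hn.
apply: (le_trans (approx_lipschitz n s t x)); rewrite mulrDr lerD2l.
move: hn; rewrite ler_pdivlMr; last by have := speed_ge0 x; lra.
by have := stepsize_gt0 n; generalize (stepsize n) (speed x) => a b; nra.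
Qed.

Lemma limit_solution_0 x : u 0 x = u0 x.
Proof.
have c1 : approx M n 0 x @[n --> U] --> u 0 x := limit_solution_cvg (t := 0) (x := x).
have c2 : approx M n 0 x @[n --> U] --> u0 x.
  apply: cvg_near_cst; apply: filterS (near_pickle x) => n xn.
  by rewrite /approx /ticks mul0r truncn0 /euler /= xn.
exact: cvg_unique c1 c2.
Qed.

(** The schemes are Lipschitz in time up to an error of the order of the step, and [psi n] converges
    with moving arguments. Joint convergence is needed for the time derivative and, below, for times
    that depend on [n]. *)
Lemma approx_joint_cvg t y :
  psi p.1 (approx M p.1 p.2 y) @[p --> filter_prod U (nbhs t)] --> phi (u t y).
Proof.
apply/cvgrPdist_le => e e0.
have [d d0 [N NP]] := psi_cvg (limit_solution_le t y) e0.
have s1 : 0 < speed y + 1 by have := speed_ge0 y; lra.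
have d1 : 0 < d / 8 / (speed y + 1) by rewrite !divr_gt0.
have c : approx M n t y @[n --> U] --> u t y := limit_solution_cvg (t := t) (x := y).
have d4 : 0 < d / 4 by rewrite divr_gt0.
move/cvgrPdist_le: c => /(_ _ d4) c.
have NU : U [set n | (N <= n)%N] by apply: UN; exists N.
have hU := stepsize_small d1.
exists ([set n | `|u t y - approx M n t y| <= d / 4] `&` [set n | (N <= n)%N] `&`
    [set n | stepsize n <= d / 8 / (speed y + 1)], ball t (d / 8 / (speed y + 1))).
  by split; [apply: filterI => //; exact: filterI|exact: nbhsx_ballx].
move=> [n s] /= [[[c1 Nn] hn] bs]; have {}bs : `|s - t| < d / 8 / (speed y + 1) by
    rewrite distrC.
 rewrite distrC; apply: NP => //; first exact: approx_le.
have a0 : 0 <= `|s - t| by exact: normr_ge0.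
have lip : `|approx M n s y - approx M n t y| <= speed y * (`|s - t| + 2 * stepsize n).
  exact: approx_lipschitz.
rewrite (ltr_pdivlMr _ _ s1) in bs; rewrite /= (ler_pdivlMr _ _ s1) in hn.
have v0 := speed_ge0 y; have b0 := stepsize_gt0 n.
move: a0 lip bs hn v0 b0 c1.
generalize (`|s - t|) (stepsize n) (speed y) => a b v a0 lip av bv v0 b0.
move: lip; rewrite ler_norml => /andP[q1 q2]; rewrite ler_norml => /andP[q3 q4].
have : v * (a + 2 * b) < 3 / 8 * d.
  have -> : v * (a + 2 * b) = a * (v + 1) + 2 * (b * (v + 1)) - (a + 2 * b) by ring.
  by lra.
by rewrite ltr_norml; lra.
Qed.

Lemma laplacian_joint_cvg t x e : 0 < e -> exists2 d, 0 < d &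
  \forall n \near U, forall s, `|s - t| < d ->
  `|laplacian (fun y => psi n (approx M n s y)) x - laplacian (fun y => phi (u t
      y)) x| <= e.
Proof.
move=> e0.
have c : laplacian (fun y => psi p.1 (approx M p.1 p.2 y)) x @[p --> filter_prod U
    (nbhs t)] -->
    laplacian (fun y => phi (u t y)) x.
  apply: (@laplacian_cvg _ _ G _ _ _ _ _ B) => [|y]; last exact: approx_joint_cvg.
  by apply: nearW => p y; apply: psiB; exact: approx_le.
move/cvgrPdist_le: c => /(_ e e0)[[A V] [/= UA /nbhs_ballP[d /= d0 dV] AV]].
exists d => //; apply: filterS UA => n An s st; rewrite distrC.
by apply: (AV (n, s)); split => //=; apply: dV; rewrite /ball/= distrC.
Qed.

(** Near [t] the discrete Laplacians are within [e] of the limiting one, so [euler_diff] makes the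
    schemes almost affine there; this estimate passes to the limit and gives the derivative on both
    sides. *)
Lemma limit_solution_increment t x e : 0 <= t -> 0 < e -> exists2 d, 0 < d &
  forall s s', 0 <= s -> s <= s' -> `|s - t| < d -> `|s' - t| < d ->
  `|u s' x - u s x + (s' - s) * laplacian (fun y => phi (u t y)) x| <= (s' - s) * e.
Proof.
move=> t0 e0; have [d d0 dP] := laplacian_joint_cvg t x e0.
set D := laplacian _ x in dP *.
(* The ticks involved may precede [s] by up to one step, at most [d / 4], hence the margin. *)
exists (d / 2); first by rewrite divr_gt0.
move=> s s' s0 ss' st s't; have s'0 := le_trans s0 ss'.
have cl r : 0 <= r -> clock n r @[n --> U] --> r.
  move=> r0; apply/cvgrPdist_le => e' e'0; apply: filterS (stepsize_small e'0) => n hn.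
  have := clock_near n r; rewrite (elimT max_idPl r0) distrC => /le_trans; exact.
have c1 : `|approx M n s' x - approx M n s x + (clock n s' - clock n s) * D| @[n --> U] -->
    `|u s' x - u s x + (s' - s) * D|.
  apply: cvg_norm; apply: cvgD; first by apply: cvgB; exact: limit_solution_cvg.
  by apply: cvgMr_tmp; apply: cvgB; exact: cl.
have c2 : (clock n s' - clock n s) * e @[n --> U] --> (s' - s) * e.
  by apply: cvgMr_tmp; apply: cvgB; exact: cl.
apply: (ler_cvg_to c1 c2).
have d40 : 0 < d / 4 by rewrite divr_gt0.
apply: filterS3 dP (near_pickle x) (stepsize_small d40) => n nP xn hn.
have km := le_ticks n ss'; have h0 := stepsize_gt0 n.
have := @euler_diff _ _ G (psi n) n (stepsize n) h0 u0 M D e x (ticks n s) (ticks n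
    s' - ticks n s) xn.
rewrite subnKC// natrB// mulrBl; apply => i /andP[i1 i2].
have := nP (i%:R * stepsize n); rewrite /approx ticks_mul; apply.
have l1 : clock n s <= i%:R * stepsize n by rewrite ler_pM2r// ler_nat.
have l2 : i%:R * stepsize n <= clock n s' by rewrite ler_pM2r// ler_nat ltnW.
have l3 := clock_le n s'0; have l4 := clock_gt n s.
move: st s't l1 l2 l3 l4; rewrite !ltr_norml.
by generalize (i%:R * stepsize n) (clock n s) (clock n s') => a b c; lra.
Qed.

Lemma limit_solution_derive t x : 0 < t -> derivable (fun s => u s x) t 1 /\
  derive1 (fun s => u s x) t = - laplacian (fun y => phi (u t y)) x.
Proof.
move=> t0; apply: derive_near => e e0.
have [d d0 dP] := limit_solution_increment x (ltW t0) e0.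
exists (Num.min d t); first by rewrite lt_min d0.
move=> s; rewrite lt_min => /andP[sd st].
have s0 : 0 <= s by move: st; rewrite ltr_norml; lra.
have z : `|t - t| < d by rewrite subrr normr0.
move: dP; set D := laplacian _ x => dP; rewrite mulrN opprK.
case: (lerP s t) => [s_t|/ltW t_s]; last first.
  apply: (le_trans (dP t s (ltW t0) t_s z sd)).
  by rewrite ler_wpM2r ?(ltW e0).
have H : `|u s x - u t x + (s - t) * D| <= (t - s) * e.
  apply: le_trans (dP s t s0 s_t sd z); rewrite -normrN.
  by rewrite le_eqVlt; apply/orP; left; apply/eqP; congr (`|_|); ring.
apply: (le_trans H); apply: ler_wpM2r; first exact: (ltW e0).
exact: lexx.
Qed.

Lemma limit_solution_laplacian_continuous t x :
  laplacian (fun y => phi (u s y)) x @[s --> t] --> laplacian (fun y => phi (u t y)) x.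
Proof.
have [B' B'P] : exists B', forall s y, `|phi (u s y)| <= B'.
  exists (B + 1) => s y; have := limit_solution_le s y => uC.
  have [d d0 [N NP]] := psi_cvg uC ltr01.
  have := NP N (u s y) (leqnn N) uC; rewrite subrr normr0 => /(_ d0).
  by have := psiB N uC; rewrite !ler_norml; lra.
apply: (@laplacian_cvg _ _ G R (nbhs t) (nbhs_pfilter t) (fun s y => phi (u s y)) _
    B'); first by apply: nearW => s y; exact: B'P.
move=> y; have uc : u s y @[s --> t] --> u t y.
  apply/cvgrPdist_le => e e0; apply/nbhs_ballP.
  have s1 : 0 < speed y + 1 by have := speed_ge0 y; lra.
  exists (e / (speed y + 1)) => [|s] /=; first by rewrite divr_gt0.
  rewrite /ball/= ltr_pdivlMr// => ts; apply: (le_trans (limit_solution_lipschitz s t y)).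
  by have := normr_ge0 (t - s); lra.
by apply: continuous_cvg uc; exact: cphi.
Qed.

Lemma limit_solution_global : global_bounded_solution G phi u0 u.
Proof.
split; last by exists C => t x _; exact: limit_solution_le.
move=> T T0; split.
- move=> t _ x; have [B' B'P] : exists B', forall y, `|phi (u t y)| <= B'.
    exists (B + 1) => y; have := limit_solution_le t y => uC.
    have [d d0 [N NP]] := psi_cvg uC ltr01.
    have := NP N (u t y) (leqnn N) uC; rewrite subrr normr0 => /(_ d0).
    by have := psiB N uC; rewrite !ler_norml; lra.
  apply: (@rsummable_weight_bounded _ _ G (fun y => `|phi (u t y)|)).
  by exists B' => y; rewrite normr_id.
- move=> x; split.
  + apply/within_continuousP => t _ e e0.
    have s1 : 0 < speed x + 1 by have := speed_ge0 x; lra.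
    exists (e / (speed x + 1)) => [|s _]; first by rewrite divr_gt0.
    rewrite ltr_pdivlMr// => ts; apply: (le_trans (limit_solution_lipschitz t s x)).
    by have := normr_ge0 (s - t); lra.
  + by move=> t /andP[t0 _]; have [] := limit_solution_derive x t0.
  + move=> t /andP[t0 _]; rewrite /prop_for/=.
    have [_ E] := limit_solution_derive x t0.
    have c : - laplacian (fun y => phi (u s y)) x @[s --> t] --> - laplacian (fun y
        => phi (u t y)) x.
      by apply: cvgN; exact: limit_solution_laplacian_continuous.
    rewrite -E in c; apply: cvg_trans c; apply: near_eq_cvg.
    near=> s; have s0 : 0 < s by near: s; exact: lt_nbhsr.
    by have [_ ->] := limit_solution_derive x s0.
- move=> t x /andP[t0 _]; rewrite /gpme_operator.
  by have [_ ->] := limit_solution_derive x t0; rewrite addNr.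
- exact: limit_solution_0.
Unshelve. all: by end_near.
Qed.

End BoundaryValue.

(** For each large [n] two schemes differ by at least [D / 2] at some tick before [T]. These ticks
    converge along [U], and joint convergence preserves the gap at the limit time. *)
Lemma limit_solution_distinct M M' T : positive_subsolution G ->
  `|M| <= C -> `|M'| <= C -> phi M < phi M' -> 0 < T ->
  exists t x, 0 <= t <= T /\ phi (limit_solution M t x) < phi (limit_solution M' t x).
Proof.
move=> P MC M'C MM' T0; pose D := phi M' - phi M.
have D0 : 0 < D by rewrite subr_gt0.
have C0 : 0 <= C := le_trans (normr_ge0 _) MC.
have CC : `|C| <= C by rewrite ger0_norm.
have NC : `|- C| <= C by rewrite normrN.
have B0 : 0 <= B := le_trans (normr_ge0 _) (psiB 0 MC).
(* [eta] solves [3/4 D (1 - eta) - 2 B eta = D / 2], and [A] makes [T / 2 * (3 / 4 * D * A)] exceed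
   [2 C]. *)
pose eta := D / (3 * D + 8 * B); pose A := 8 * C / (T * D) + 1.
have den0 : 0 < 3 * D + 8 * B by lra.
have eta0 : 0 < eta by rewrite divr_gt0.
have A0 : 0 < A by rewrite ltr_wpDl// divr_ge0 ?mulr_ge0// ltW.
have [g [x [g01 gA gx]]] := subsolution_peak P A0 eta0.
have psi_near s : `|s| <= C -> \forall n \near U, `|psi n s - phi s| <= D / 8.
  move=> sC; have d8 : 0 < D / 8 by rewrite divr_gt0.
  have [d d0 [N NP]] := psi_cvg sC d8; apply: UN; exists N => // n /= Nn.
  by apply: NP => //; rewrite subrr normr0.
have T2 : 0 < T / 2 by rewrite divr_gt0.
pose good n (k : nat) := (k <= ticks n T)%N /\
  D / 2 <= psi n (euler G (psi n) n (stepsize n) u0 M' k x) -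
           psi n (euler G (psi n) n (stepsize n) u0 M k x).
have goodP : \forall n \near U, exists k, good n k.
  apply: filterS3 (psi_near M MC) (psi_near M' M'C) (stepsize_small T2) => n p1 p2 hn.
  have d34 : 3 / 4 * D <= psi n M' - psi n M.
    by move: p1 p2; rewrite !ler_norml /D; lra.
  have cl : T / 2 <= stepsize n * (ticks n T)%:R.
    by rewrite mulrC; have := clock_gt n T; rewrite /clock; lra.
  have big : 2 * C < stepsize n * (ticks n T)%:R * ((psi n M' - psi n M) * A).
    apply: (@lt_le_trans _ _ (T / 2 * (3 / 4 * D * A))); last first.
      apply: ler_pM => //; [exact: ltW|by rewrite !mulr_ge0// ltW|].
      by rewrite ler_pM2r.
    have -> : T / 2 * (3 / 4 * D * A) = 3 * C + 3 / 8 * (T * D).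
      by rewrite /A; field; rewrite !gt_eqF.
    by have := mulr_gt0 T0 D0; lra.
  have [k kN gap] := @euler_gap _ _ G (psi n) n (stepsize n) C n%:R B (stepsize_gt0 n)
    (psi0 n) (@psiL n) (@psiB n) (@stepsize_rate n) u0 M M' g A (ticks n T) x
    u0C MC M'C g01 gA (ltW A0) big.
  exists k; split; first exact: ltnW.
  apply: le_trans gap.
  have : psi n C - psi n (- C) <= 2 * B.
    by have := psiB n CC; have := psiB n NC; rewrite !ler_norml; lra.
  move=> pB; have /andP[g0 g1] := g01 x.
  have h1 : (1 - g x) * (psi n C - psi n (- C)) <= eta * (2 * B).
    apply: (@le_trans _ _ ((1 - g x) * (2 * B))); first by rewrite ler_wpM2l//; lra.
    by rewrite ler_wpM2r ?mulr_ge0//; lra.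
  have h2 : 3 / 4 * D * (1 - eta) <= (psi n M' - psi n M) * g x.
    apply: (@le_trans _ _ (3 / 4 * D * g x)); last by rewrite ler_wpM2r.
    by rewrite ler_pM2l ?ltW//; lra.
  have h3 : eta * (3 * D + 8 * B) = D by rewrite divfK// gt_eqF.
  move: h1 h2 h3.
  generalize (psi n M' - psi n M) (psi n C - psi n (- C)) (g x) eta D B => p q r s v z.
  have -> : 3 / 4 * v * (1 - s) = 3 / 4 * v - 1 / 4 * (s * (3 * v + 8 * z)) + s *
      (2 * z) by field.
  by lra.
(* The minimum keeps the tick before [T] also for those [n] that have no good tick, so that the
   times are bounded for every [n]. *)
pose k n := minn (xget 0%N [set k | good n k]) (ticks n T).
pose tn n := (k n)%:R * stepsize n.
have tn0 n : 0 <= tn n by rewrite mulr_ge0// ltW// stepsize_gt0.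
have tnT n : tn n <= T.
  apply: le_trans (clock_le n (ltW T0)); rewrite ler_pM2r ?stepsize_gt0//.
  by rewrite ler_nat geq_minr.
have tnP : \forall n \near U, D / 2 <= psi n (approx M' n (tn n) x) - psi n (approx
    M n (tn n) x).
  apply: filterS goodP => n [k' gk']; have [g1 g2] : good n (xget 0%N [set k | good n k]).
    by apply: (@xgetPex _ 0%N [set k | good n k]); exists k'.
  by rewrite /approx /tn ticks_mul /k (minn_idPl g1).
have tc : tn n @[n --> U] --> lim (tn n @[n --> U]).
  by apply: (@ultra_cvg _ _ _ _ T) => n; rewrite ger0_norm.
set t := lim (tn n @[n --> U]) in tc.
exists t, x; split.
  by apply/andP; split; [apply: (cvgr_to_ge tc)|apply: (cvgr_to_le tc)]; exact: nearW.
have pc : (n, tn n) @[n --> U] --> filter_prod U (nbhs t) by apply: cvg_pair tc;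
    exact: cvg_id.
have cv m : `|m| <= C -> psi n (approx m n (tn n) x) @[n --> U] --> phi
    (limit_solution m t x).
  by move=> mC; exact: (cvg_comp _ _ pc (approx_joint_cvg mC (t := t) (y := x))).
have c : psi n (approx M' n (tn n) x) - psi n (approx M n (tn n) x) @[n --> U] -->
    phi (limit_solution M' t x) - phi (limit_solution M t x).
  by apply: cvgB; exact: cv.
have : D / 2 <= phi (limit_solution M' t x) - phi (limit_solution M t x).
  exact: (cvgr_to_ge c).
by rewrite -subr_gt0 => /(lt_le_trans _); apply; rewrite divr_gt0.
Qed.

End EulerLimit.

(** * Existence and non-uniqueness of global solutions *)

Section InfinitelyManySolutions.
Variables (R : realType) (X : countType) (G : graph R X).
Variables (phi : R -> R) (u0 : X -> R).
Hypothesis phiI : nonlinearity phi.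

(* [Sol M] is the limit of the schemes with boundary value [M] at infinity. *)
Lemma euler_family (C : R) : 0 <= C -> (forall x, `|u0 x| <= C) ->
  exists Sol : R -> R -> X -> R,
  [/\ forall M, `|M| <= C -> global_bounded_solution G phi u0 (Sol M),
      forall M lo hi t x, `|M| <= C -> - C <= lo -> lo <= 0 -> 0 <= hi -> hi <= C ->
        lo <= M <= hi -> (forall x, lo <= u0 x <= hi) -> lo <= Sol M t x <= hi
    & forall M M' T, positive_subsolution G -> `|M| <= C -> `|M'| <= C ->
        phi M < phi M' -> 0 < T ->
        exists t x, 0 <= t <= T /\ phi (Sol M t x) < phi (Sol M' t x)].
Proof.
move=> C0 u0C; have [cphi mphi _ phi0] := phiI.
have [psi [B [p0 pL pB pc]]] := lipschitz_approximation C0 cphi mphi phi0.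
have [U [UU UN]] := free_ultrafilter.
exists (limit_solution G psi u0 U); split.
- by move=> M MC; exact: (@limit_solution_global _ _ G phi C B).
- by move=> M lo hi t x MC *; exact: (@limit_solution_itv _ _ G C B).
- by move=> M M' T *; exact: (@limit_solution_distinct _ _ G phi C B).
Qed.

Lemma global_solution_exists : bounded_function u0 ->
  exists u, global_bounded_solution G phi u0 u.
Proof.
move=> [K uK]; have u0C x : `|u0 x| <= `|K| := le_trans (uK x) (ler_norm K).
have [Sol [H _ _]] := euler_family (normr_ge0 K) u0C.
by exists (Sol 0); apply: H; rewrite normr0.
Qed.

(** Supplies boundary values whose images under [phi] are pairwise distinct once [phi b != 0]; all
    lie between 0 and [b], so that for zero initial data the solutions inherit the sign of [b]. *)
Lemma nonlinearity_value b (n : nat) : exists m,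
  (0 <= m <= b \/ b <= m <= 0) /\ phi m = phi b / n.+1%:R.
Proof.
have [cphi mphi _ phi0] := phiI.
have cI A : {within A, continuous phi} by exact: continuous_subspaceT.
have n1 : (n.+1%:R : R)^-1 <= 1 by rewrite invf_le1// ler1n.
have n0 : 0 <= (n.+1%:R : R)^-1 by rewrite invr_ge0.
case: (lerP 0 b) => b0.
  have p0 : 0 <= phi b by rewrite -phi0 mphi.
  have [|c cb cE] := @IVT _ phi 0 b (phi b / n.+1%:R) b0 (cI _).
    rewrite phi0 (min_idPl p0) (max_idPr p0) mulr_ge0//=.
    by rewrite -[leRHS]mulr1 ler_wpM2l.
  by exists c; split => //; left; move: cb; rewrite in_itv.
have p0 : phi b <= 0 by rewrite -phi0 mphi// ltW.
have [|c cb cE] := @IVT _ phi b 0 (phi b / n.+1%:R) (ltW b0) (cI _).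
  rewrite phi0 (min_idPl p0) (max_idPr p0) mulr_le0_ge0// andbT.
  by rewrite -[leLHS]mulr1 ler_wnM2l.
by exists c; split => //; right; move: cb; rewrite in_itv.
Qed.

Lemma infinitely_many_solutions b : positive_subsolution G ->
  bounded_function u0 -> phi b != 0 -> exists Us, separated_solutions G phi u0 Us /\
    ((forall x, u0 x = 0) ->
      (0 <= b -> forall n t x, 0 <= Us n t x) /\ (b <= 0 -> forall n t x, Us n t x <= 0)).
Proof.
move=> P [K uK] pb; pose C := `|K| + `|b|.
have C0 : 0 <= C by rewrite addr_ge0.
have u0C x : `|u0 x| <= C.
  by apply: (le_trans (uK x)); apply: (le_trans (ler_norm K)); rewrite lerDl.
have [Sol [gS itvS dS]] := euler_family C0 u0C.
have /choice[M MP] : forall n, exists m, (0 <= m <= b \/ b <= m <= 0) /\ phi m =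
    phi b / n.+1%:R.
  by move=> n; exact: nonlinearity_value.
have bC : `|b| <= C by rewrite lerDr.
have Mb n : (0 <= M n <= b) || (b <= M n <= 0) by apply/orP; have [] := MP n.
have MC n : `|M n| <= C.
  by move: bC; rewrite !ler_norml => bC; have /orP[] := Mb n; lra.
exists (fun n => Sol (M n)); split.
  split=> [n|m n mn T T0 E]; first exact: gS.
  have ne : phi (M m) != phi (M n).
    have [_ ->] := MP m; have [_ ->] := MP n; rewrite (inj_eq (mulfI pb)).
    by rewrite (inj_eq invr_inj) eqr_nat eqSS.
  case/orP: (lt_total ne) => lt.
    have [t [x [tT]]] := dS _ _ _ P (MC m) (MC n) lt T0.
    by rewrite (E t x tT) ltxx.
  have [t [x [tT]]] := dS _ _ _ P (MC n) (MC m) lt T0.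
  by rewrite (E t x tT) ltxx.
move=> u00; split=> b0 n t x.
  have u1 y : 0 <= u0 y <= C by rewrite u00 lexx.
  have M1 : 0 <= M n <= C.
    by have := MC n; rewrite ler_norml; have /orP[] := Mb n; lra.
  have N0 : - C <= 0 by rewrite oppr_le0.
  by have /andP[] := itvS (M n) 0 C t x (MC n) N0 (lexx 0) C0 (lexx C) M1 u1.
have u1 y : - C <= u0 y <= 0 by rewrite u00 lexx oppr_le0 C0.
have M1 : - C <= M n <= 0.
  by have := MC n; rewrite ler_norml; have /orP[] := Mb n; lra.
have N0 : - C <= 0 by rewrite oppr_le0.
by have /andP[] := itvS (M n) (- C) 0 t x (MC n) (lexx _) N0 (lexx 0) C0 M1 u1.
Qed.

End InfinitelyManySolutions.

(** * The comparison principle *)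

Section Heine.
Variables (R : realType) (U : set_system nat).
Hypotheses (UU : UltraFilter U) (UN : \oo `<=` U).

Lemma inv_small (e : R) : 0 < e -> \forall n \near U, n.+1%:R^-1 <= e.
Proof.
move=> e0; apply: UN; exists (Num.truncn e^-1) => // n /= en.
by rewrite invf_ple ?posrE// (le_trans (ltW (truncnS_gt _)))// ler_nat ltnS.
Qed.

(** Continuity is assumed along [U] only, the form in which dominated convergence delivers it; a
    failing sequence of pairs converges along [U] to a common limit. *)
Lemma heine (f : R -> R) (a b : R) :
  (forall (s : nat -> R) l, (forall n, a <= s n <= b) -> a <= l <= b ->
    s n @[n --> U] --> l -> f (s n) @[n --> U] --> f l) ->
  forall e, 0 < e -> exists2 d, 0 < d & forall s t, a <= s <= b -> a <= t <= b ->
    `|s - t| <= d -> `|f s - f t| <= e.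
Proof.
move=> fc e e0; case: (pselect (exists2 d, 0 < d & forall s t, a <= s <= b ->
  a <= t <= b -> `|s - t| <= d -> `|f s - f t| <= e)) => // no.
have /choice[p pP] : forall n : nat, exists p : R * R,
    [/\ a <= p.1 <= b, a <= p.2 <= b, `|p.1 - p.2| <= n.+1%:R^-1 & e < `|f p.1 - f p.2|].
  move=> n; case: (pselect (exists p : R * R, [/\ a <= p.1 <= b, a <= p.2 <= b,
    `|p.1 - p.2| <= n.+1%:R^-1 & e < `|f p.1 - f p.2|])) => // no'.
  case: no; exists n.+1%:R^-1; first by rewrite invr_gt0.
  move=> s t sab tab st; rewrite leNgt; apply/negP => fst; apply: no'.
  by exists (s, t).
have c1 : (p n).1 @[n --> U] --> lim ((p n).1 @[n --> U]).
  apply: (@ultra_cvg _ _ _ _ (`|a| + `|b|)) => n; have [/andP[pa pb] _ _ _] := pP n.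
  have := ler_norm (- a); have := ler_norm b; rewrite normrN => *.
  have := normr_ge0 a; have := normr_ge0 b.
  by rewrite ler_norml => *; apply/andP; split; lra.
set l := lim _ in c1.
have lab : a <= l <= b.
  by apply/andP; split; [apply: (cvgr_to_ge c1)|apply: (cvgr_to_le c1)];
    apply: nearW => n; have [/andP[pa pb] _ _ _] := pP n.
have c2 : (p n).2 @[n --> U] --> l.
  have d0 : (p n).1 - (p n).2 @[n --> U] --> (0 : R).
    apply/cvgrPdist_le => e' e'0; apply: filterS (inv_small e'0) => n hn.
    by rewrite sub0r normrN; have [_ _ h _] := pP n; exact: le_trans h hn.
  have c : (p n).1 - ((p n).1 - (p n).2) @[n --> U] --> l - 0 by exact: cvgB.
  by move: c; rewrite subr0; apply: cvg_ext => n; rewrite opprB addrC subrK.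
have f1 : f (p n).1 @[n --> U] --> f l.
  by apply: fc c1 => // n; have [] := pP n.
have f2 : f (p n).2 @[n --> U] --> f l.
  by apply: fc c2 => // n; have [] := pP n.
have c : `|f (p n).1 - f (p n).2| @[n --> U] --> `|f l - f l|.
  by apply: cvg_norm; exact: cvgB.
have : e <= `|f l - f l|.
  by apply: (cvgr_to_ge c); apply: nearW => n; have [_ _ _ /ltW] := pP n.
by rewrite subrr normr0 leNgt e0.
Qed.

End Heine.

Section VanishingPotential.
Variables (R : realType) (X : countType) (G : graph R X).
Local Notation laplacian := (Defs.laplacian G).

(* If [V] were positive somewhere, its part above a positive level would be a
   bounded subsolution. *)
Lemma potential_vanishes (V W : X -> R) (M : R) : ~ positive_subsolution G ->
  (forall x, 0 <= V x <= M) -> (forall x, W x <= - laplacian V x) ->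
  (forall e, 0 < e -> exists2 K, 0 < K & forall x, V x <= e + K * W x) ->
  forall x, W x <= 0.
Proof.
move=> nP VM WV VK; suff V0 : V = fun=> 0.
  by move=> x; apply: (le_trans (WV x)); rewrite V0 laplacian_cst mulr0 oppr0.
apply/funext => x0; have /andP[V0 VM0] := VM x0.
apply/le_anti; rewrite V0 andbT leNgt; apply/negP => Vx0; apply: nP.
pose s := V x0 / 2; have s0 : 0 < s by rewrite divr_gt0.
have M0 : 0 < M := lt_le_trans Vx0 VM0.
(* At this level the hypotheses read [V - s <= K * W <= - K * laplacian V], the subsolution
   inequality with constant [K^-1]. *)
have [K K0 KP] := VK s s0.
have bV : bounded_function V by exact: bounded_between VM.
pose g y := Num.max 0 (V y - s) / M.
have g01 y : 0 <= g y <= 1.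
  have /andP[v0 vM] := VM y.
  rewrite /g divr_ge0 ?ler_pdivrMr ?mul1r ?(ltW M0) ?le_max ?lexx//=.
  by rewrite ge_max (ltW M0)/=; lra.
have bg : bounded_function g by exact: bounded_between g01.
exists g, K^-1; split => //; first by rewrite invr_gt0.
  exists x0; rewrite /g divr_gt0// lt_max; apply/orP; right.
  by rewrite /s; lra.
move=> y; case: (lerP (V y) s) => Vy.
  have gy : g y = 0 by rewrite /g (elimT max_idPl _) ?mul0r// subr_le0.
  have := laplacian_le G y bg (fun z => proj1 (andP (g01 z))) (lexx 0).
  by rewrite gy subrr !mulr0.
pose D z := -1 * g z + (M^-1 * V z + - (M^-1 * s)).
have b1 : bounded_function (fun z => M^-1 * V z + - (M^-1 * s)).
  by apply: bounded_linear => //; exact: bounded_cst.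
have bD : bounded_function D by exact: bounded_linear.
have D0 z : D z <= 0.
  rewrite /D /g mulN1r addrC subr_le0 -mulrBr mulrC ler_pM2r ?invr_gt0//.
  by rewrite le_max lexx orbT.
have gE : g y = (V y - s) / M by rewrite /g (elimT max_idPr _)// subr_ge0 ltW.
have Dy : D y = 0 by rewrite /D gE; ring.
have := laplacian_ge G y bD D0 (lexx 0); rewrite Dy subrr mulr0 /D.
rewrite laplacian_linear// laplacian_linear//; last exact: bounded_cst.
rewrite laplacian_cst => H.
have k0 : 0 <= killing G y / mass G y * (M^-1 * s).
  by rewrite mulr_ge0 ?divr_ge0 ?killing_ge0 ?(ltW (mass_gt0 G y))// mulr_ge0 ?(ltW
      s0)// invr_ge0 ltW.
have l1 : M^-1 * laplacian V y <= - K^-1 * g y.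
  rewrite gE mulrC mulrA ler_pM2r ?invr_gt0// -[leLHS]opprK lerNl mulNr opprK mulrC.
  rewrite ler_pdivrMr// mulrC; apply: le_trans (_ : K * W y <= _).
    by have := KP y; lra.
  by rewrite ler_pM2l.
have alg (p q r z : R) : 0 <= -1 * p + (q - r) -> 0 <= r -> q <= z -> p <= z by lra.
by rewrite mulrN in H; exact: alg H k0 l1.
Qed.

End VanishingPotential.

(** For [a > 0] the positive part moves with [b], for [a < 0] it stays 0, and [d] is small enough
    that the sign of [a] decides; at [a = 0] both hypotheses apply. Half of [e] is left for the
    error of a difference quotient. *)
Lemma positive_part_increment (R : realType) (a r l e : R) : 0 < e ->
  (0 <= a -> r <= l) -> (a <= 0 -> 0 <= l) -> exists2 d, 0 < d &
  forall s b, 0 < s -> s < d -> b <= a + s * (r + e / 2) ->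
    Num.max 0 b <= Num.max 0 a + s * (l + e).
Proof.
move=> e0 rl l0; pose K := `|l| + `|r| + e.
have K0 : 0 < K by rewrite ltr_wpDl// addr_ge0.
exists (if a == 0 then 1 else `|a| / K).
  by case: eqVneq => // na; rewrite divr_gt0// normr_gt0.
move=> s b s0 sd sb; have sK : a != 0 -> s * K < `|a|.
  by move=> na; move: sd; rewrite (negPf na) ltr_pdivlMr.
have := ler_norm l; have := ler_norm (- l); rewrite normrN => hl1 hl2.
have hr := ler_norm r; have nl := normr_ge0 l; have nr := normr_ge0 r.
case: (ltgtP a 0) => ha.
- have sl : 0 <= s * (l + e) by rewrite mulr_ge0 ?addr_ge0 ?(ltW s0) ?(ltW e0) ?l0
      ?(ltW ha).
  have := sK (ltr0_neq0 ha); rewrite ltr0_norm// /K add0r ge_max sl /=.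
  have : s * (r + e / 2) <= s * (`|l| + `|r| + e) by rewrite ler_pM2l//; lra.
  by lra.
- have := sK (lt0r_neq0 ha); rewrite gtr0_norm// /K ge_max.
  have : s * (- (`|l| + `|r| + e)) <= s * (l + e) by rewrite ler_pM2l//; lra.
  have : s * (r + e / 2) <= s * (l + e) by rewrite ler_pM2l//; have := rl (ltW ha); lra.
  by rewrite mulrN => h1 h2 h3; apply/andP; split; lra.
- have sl : 0 <= s * (l + e) by rewrite mulr_ge0 ?addr_ge0 ?(ltW s0) ?(ltW e0) ?l0 ?ha.
  rewrite ha add0r ge_max sl/=; apply: (le_trans sb); rewrite ha add0r ler_pM2l//.
  by have := rl _; rewrite ha lexx => /(_ isT); lra.
Qed.

Section Comparison.
Variables (R : realType) (X : countType) (G : graph R X).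
Local Notation laplacian := (Defs.laplacian G).

Lemma laplacian_sum N (c : 'I_N -> R) (g : 'I_N -> X -> R) x :
  (forall k, bounded_function (g k)) ->
  bounded_function (fun y => \sum_(k < N) c k * g k y) /\
  laplacian (fun y => \sum_(k < N) c k * g k y) x = \sum_(k < N) c k * laplacian (g k) x.
Proof.
elim: N c g => [|N IHN] c g bg.
  have -> : (fun y => \sum_(k < 0) c k * g k y) = fun=> 0 by apply/funext => y;
      rewrite big_ord0.
  by rewrite big_ord0 laplacian_cst mulr0; split => //; exact: bounded_cst.
have -> : (fun y => \sum_(k < N.+1) c k * g k y) = fun y => c ord0 * g ord0 y +
    \sum_(k < N) c (lift ord0 k) * g (lift ord0 k) y.
  by apply/funext => y; rewrite big_ord_recl.
have [b1 E1] := IHN (fun k => c (lift ord0 k)) (fun k => g (lift ord0 k)) (fun k => bg _).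
by split; [exact: bounded_linear|rewrite laplacian_linear// E1 big_ord_recl].
Qed.

(** Summation by parts: the discrete form of [\int_0^T (1 + T - t) a' = a(T) + \int_0^T a] when
    [a(0) = 0]. *)
Lemma abel_weights (h : R) (a : nat -> R) n : a 0%N = 0 ->
  \sum_(k < n.+1) (1 + (n - k)%:R * h) * (a k.+1 - a k) =
  a n.+1 + h * \sum_(k < n.+1) a k.
Proof.
move=> a0; elim: n => [|n IHn].
  by rewrite !big_ord1 /= subnn mul0r addr0 mul1r a0 subr0 mulr0 addr0.
rewrite big_ord_recr/= subnn mul0r addr0 mul1r.
have -> : \sum_(i < n.+1) (1 + (n.+1 - i)%:R * h) * (a i.+1 - a i) =
    \sum_(i < n.+1) (1 + (n - i)%:R * h) * (a i.+1 - a i) + h * \sum_(i < n.+1) (a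
        i.+1 - a i).
  rewrite mulr_sumr -big_split/=; apply: eq_bigr => i _.
  by rewrite subSn -1?ltnS// -natr1; ring.
have -> : \sum_(i < n.+1) (a i.+1 - a i) = a n.+1.
  by rewrite -(big_mkord xpredT (fun i => a i.+1 - a i)) telescope_sumr// a0 subr0.
by rewrite IHn [\sum_(k < n.+2) _]big_ord_recr/=; ring.
Qed.

Variables (phi : R -> R) (T C : R) (u v : R -> X -> R) (U : set_system nat).
Hypotheses (phiI : nonlinearity phi) (T0 : 0 < T) (UU : UltraFilter U) (UN : \oo `<=` U).
Hypotheses (uC : forall t x, 0 <= t <= T -> `|u t x| <= C).
Hypotheses (vC : forall t x, 0 <= t <= T -> `|v t x| <= C).
Hypotheses (ur : time_regular T u) (vr : time_regular T v).
Hypothesis uv_le : forall t x, 0 < t < T -> gpme_operator G phi u t x <=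
    gpme_operator G phi v t x.
Hypothesis uv0 : forall x, u 0 x <= v 0 x.

Implicit Types (s t a b e l : R) (x y : X).

Let B := phi C - phi (- C).
Let w t x := u t x - v t x.
Let F t x := Num.max 0 (w t x).
Let psi t x := phi (u t x) - phi (v t x).
Let Psi t x := Num.max 0 (psi t x).
Let f t x := - laplacian (Psi t) x.
Let C0 x : 0 <= C.
Proof.
have t00 : 0 <= (0 : R) <= T by rewrite lexx (ltW T0).
exact: le_trans (normr_ge0 _) (uC x t00).
Qed.

Let mphi : {homo phi : s t / s <= t}. Proof. by have [] := phiI. Qed.

Let phi_le (r : R) : `|r| <= C -> phi (- C) <= phi r <= phi C.
Proof. by rewrite ler_norml => /andP[? ?]; rewrite !mphi. Qed.

Let Psi_itv t x : 0 <= t <= T -> 0 <= Psi t x <= B.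
Proof.
move=> tT; have := phi_le (uC x tT); have := phi_le (vC x tT); rewrite /Psi /psi /B.
by case: (lerP 0 (phi (u t x) - phi (v t x))); lra.
Qed.

Let F_itv t x : 0 <= t <= T -> 0 <= F t x <= 2 * C.
Proof.
move=> tT; have := uC x tT; have := vC x tT; rewrite /F /w !ler_norml.
by case: (lerP 0 (u t x - v t x)); lra.
Qed.

Let bPsi t : 0 <= t <= T -> bounded_function (Psi t).
Proof. by move=> tT; apply: (@bounded_between _ _ _ 0 B) => x; exact: Psi_itv. Qed.

Let bphi z t : (forall x, `|z t x| <= C) -> bounded_function (fun y => phi (z t y)).
Proof.
by move=> zC; apply: (@bounded_between _ _ _ (phi (- C)) (phi C)) => x; exact: phi_le.
Qed.

(* Kato's inequality at the points where [u >= v]. *)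
Let derivative_le t x : 0 < t < T -> 0 <= w t x ->
  derive1 (fun s => u s x) t - derive1 (fun s => v s x) t <= f t x.
Proof.
move=> /andP[t0 tT] wt; have tI : 0 <= t <= T by rewrite !ltW.
have tI' : 0 < t < T by rewrite t0.
have bu : bounded_function (fun y => phi (u t y)) by apply: bphi => y; exact: uC.
have bv : bounded_function (fun y => phi (v t y)) by apply: bphi => y; exact: vC.
have bP := bPsi tI.
pose D y := -1 * Psi t y + (1 * phi (u t y) + (-1 * phi (v t y) + 0)).
have b1 : bounded_function (fun y => -1 * phi (v t y) + 0).
  by apply: bounded_linear => //; exact: bounded_cst.
have b2 : bounded_function (fun y => 1 * phi (u t y) + (-1 * phi (v t y) + 0)).
  exact: bounded_linear.
have bD : bounded_function D by exact: bounded_linear.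
have D0 y : D y <= 0 by rewrite /D /Psi /psi; case: (lerP 0 (phi (u t y) - phi (v t
    y))); lra.
have Dx : D x = 0.
  have : 0 <= psi t x by rewrite subr_ge0 mphi// -subr_ge0.
  by rewrite /D /Psi => /max_idPr ->; rewrite /psi; ring.
have := laplacian_ge G x bD D0 (lexx 0); rewrite Dx subrr mulr0 /D.
rewrite laplacian_linear// laplacian_linear// laplacian_linear//; last exact: bounded_cst.
rewrite laplacian_cst mulr0 addr0 mul1r !mulN1r => H.
have := uv_le x tI'; rewrite /gpme_operator /f.
have alg (p q r s z : R) : 0 <= - p + (q - r) -> s + q <= z + r -> s - z <= - p by lra.
exact: alg H.
Qed.

(** The complementary case of Kato's inequality: where [u <= v], the function [Psi t] attains its
    minimum 0. *)
Let f_ge0 t x : 0 <= t <= T -> w t x <= 0 -> 0 <= f t x.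
Proof.
move=> tI wt; have P0 : Psi t x = 0.
  apply/max_idPl; rewrite /psi subr_le0; apply: mphi; rewrite -subr_le0; exact: wt.
have := laplacian_le G x (bPsi tI) (fun y => proj1 (andP (Psi_itv y tI))) (lexx 0).
by rewrite P0 subrr mulr0 /f oppr_ge0.
Qed.

Let w_continuous t x e : 0 <= t <= T -> 0 < e -> exists2 d, 0 < d &
  forall s, 0 <= s <= T -> `|s - t| < d -> `|w s x - w t x| <= e.
Proof.
move=> tI e0; have e2 : 0 < e / 2 by rewrite divr_gt0.
have tI' : `[0, T]%classic t by rewrite /= in_itv.
have [cu _ _] := ur x; have [cv _ _] := vr x.
have [d d0 dP] := (within_continuousP _ _).1 cu t tI' _ e2.
have [d' d'0 d'P] := (within_continuousP _ _).1 cv t tI' _ e2.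
exists (Num.min d d'); first by rewrite lt_min d0.
move=> s sI; rewrite lt_min => /andP[s1 s2]; have sI' : `[0, T]%classic s by
    rewrite /= in_itv.
have := dP s sI' s1; have := d'P s sI' s2; rewrite /w.
generalize (u s x) (u t x) (v s x) (v t x) => a b c p.
by rewrite !ler_norml; lra.
Qed.

Let F_lip s t x : `|F s x - F t x| <= `|w s x - w t x|.
Proof. exact: maxr_lipschitz. Qed.

(** The positive part [F] may fail to be differentiable, so the Dini lemma is applied to
    [F t x - t * l]. Derivatives of [u] and [v] are available only inside the time interval, hence
    [0 < a]; continuity adds [a = 0] afterwards. *)
Let increment_pos a b l x : 0 < a -> a <= b -> b <= T ->
  (forall s, a <= s <= b -> f s x <= l) -> F b x - b * l <= F a x - a * l.
Proof.
move=> a0 ab bT fl; pose D t := F t x - t * l; rewrite -/(D b) -/(D a).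
have l1 : 0 < `|l| + 1 by rewrite ltr_wpDl.
apply: dini_nonincreasing => // t /andP[ta tb] e e0.
  have tI : 0 <= t <= T by rewrite (le_trans tb)// (ltW (lt_trans a0 ta)).
  have e2 : 0 < e / 2 by rewrite divr_gt0.
  have [d d0 dP] := w_continuous x tI e2.
  exists (Num.min d (e / 2 / (`|l| + 1))); first by rewrite lt_min d0 !divr_gt0.
  move=> s /andP[ts st] as_; have sI : 0 <= s <= T by rewrite (le_trans (ltW a0) as_); lra.
  have tsd : t - s < d by apply: (@lt_le_trans _ _ (Num.min d (e / 2 / (`|l| +
      1)))); [lra|rewrite ge_min lexx].
  have tse : t - s < e / 2 / (`|l| + 1).
    by apply: (@lt_le_trans _ _ (Num.min d (e / 2 / (`|l| + 1))));
        [lra|rewrite ge_min lexx orbT].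
  have std : `|s - t| < d by rewrite ler0_norm ?subr_le0 ?(ltW st)// opprB.
  have := le_trans (F_lip s t x) (dP s sI std).
  have : `|(t - s) * l| <= e / 2.
    rewrite normrM gtr0_norm ?subr_gt0//.
    rewrite ltr_pdivlMr// in tse; have := normr_ge0 l; have : 0 < t - s by rewrite subr_gt0.
    by lra.
  rewrite /D; generalize (F s x) (F t x) => p q; rewrite !ler_norml mulrBl.
  by generalize (t * l) (s * l) => y z; lra.
have tI : 0 < t < T by rewrite (lt_le_trans a0 ta) (lt_le_trans tb).
have tI' : 0 <= t <= T by case/andP: tI => *; rewrite !ltW.
have [_ du _] := ur x; have [_ dv _] := vr x.
have e4 : 0 < e / 4 by rewrite divr_gt0.
have [d d0 dP] := near_derive (du t tI) e4; have [d' d'0 d'P] := near_derive (dv t tI) e4.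
set u' := derive1 _ t in dP; set v' := derive1 _ t in d'P.
have flt : f t x <= l by apply: fl; rewrite ta ltW.
have ws s : t < s -> s - t < d -> s - t < d' -> w s x <= w t x + (s - t) * (u' - v'
    + e / 2).
  move=> ts sd sd'; have E : `|s - t| = s - t by rewrite gtr0_norm ?subr_gt0.
  have h1 : `|v s x - v t x - (s - t) * v'| <= (s - t) * (e / 4).
    by rewrite -{2}E; apply: d'P; rewrite E.
  have h2 : `|u s x - u t x - (s - t) * u'| <= (s - t) * (e / 4).
    by rewrite -{2}E; apply: dP; rewrite E.
  move: h1 h2; rewrite /w; generalize (u s x) (u t x) (v s x) (v t x) => a1 a2 a3 a4.
  by rewrite !ler_norml; generalize (s - t) => r; rewrite !mulrDr; lra.
have uv' : 0 <= w t x -> u' - v' <= l by move=> wt; apply: le_trans flt;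
    exact: derivative_le.
have l0 : w t x <= 0 -> 0 <= l by move=> wt; apply: le_trans flt; exact: f_ge0.
have [d3 d30 d3P] := positive_part_increment e0 uv' l0.
exists (Num.min (Num.min d d') d3); first by rewrite !lt_min d0 d'0.
move=> s /andP[ts st] sb; have : s - t < Num.min (Num.min d d') d3 by lra.
rewrite !lt_min => /andP[/andP[sd sd'] s3].
have r0 : 0 < s - t by rewrite subr_gt0.
have H : F s x <= F t x + (s - t) * (l + e) := d3P (s - t) (w s x) r0 s3 (ws s ts sd sd').
have alg (p q y z k : R) : p <= q + (y - z) * (k + e) ->
    p - y * k <= q - z * k + e * (y - z) by rewrite mulrDr mulrBl [e * _]mulrC; lra.
exact: alg H.
Qed.

Let increment a b l x : 0 <= a -> a <= b -> b <= T ->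
  (forall s, a <= s <= b -> f s x <= l) -> F b x <= F a x + (b - a) * l.
Proof.
move=> a0 ab bT fl; move: a0; rewrite le_eqVlt => /orP[/eqP a0|a0]; last first.
  have := increment_pos a0 ab bT fl.
  by generalize (F b x) (F a x) => p q; rewrite mulrBl; lra.
move: ab fl; rewrite -a0 => b0 fl.
move: (b0); rewrite le_eqVlt => /orP[/eqP <-|{}b0]; first by rewrite subrr mul0r addr0.
apply/ler_addgt0Pr => e e0; have e2 : 0 < e / 2 by rewrite divr_gt0.
have l1 : 0 < `|l| + 1 by rewrite ltr_wpDl.
have tI : 0 <= (0 : R) <= T by rewrite lexx (ltW T0).
have [d d0 dP] := w_continuous x tI e2.
pose c := Num.min b (Num.min (d / 2) (e / 2 / (`|l| + 1))).
have c0 : 0 < c by rewrite !lt_min b0 !divr_gt0.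
have cb : c <= b by rewrite ge_min lexx.
have cd : c < d.
  by apply: (@le_lt_trans _ _ (d / 2)); [rewrite !ge_min lexx orbT|rewrite
      ltr_pdivrMr// ltr_pMr ?ltr1n].
have ce : c <= e / 2 / (`|l| + 1) by rewrite !ge_min lexx !orbT.
have cI : 0 <= c <= T by rewrite (ltW c0) (le_trans cb).
have fl' s : c <= s <= b -> f s x <= l.
  by move=> /andP[cs sb]; apply: fl; rewrite sb (le_trans (ltW c0)).
have cd' : `|c - 0| < d by rewrite subr0 gtr0_norm.
have h1 : `|F c x - F 0 x| <= e / 2 := le_trans (F_lip c 0 x) (dP c cI cd').
have h2 : F b x - b * l <= F c x - c * l := increment_pos c0 cb bT fl'.
have cl : - (c * l) <= e / 2.
  rewrite ler_pdivlMr// in ce; have := ler_norm (- l); rewrite normrN => ll.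
  have : c * - l <= c * `|l| by rewrite ler_pM2l.
  by rewrite mulrN; lra.
have alg (p q r y z : R) : `|q - r| <= e / 2 -> p - y <= q - z -> - z <= e / 2 ->
    p <= r + y + e by rewrite ler_norml; lra.
by rewrite subr0; exact: alg h1 h2 cl.
Qed.

Let Psi_cvg (s : nat -> R) l y : (forall n, 0 <= s n <= T) -> 0 <= l <= T ->
  s n @[n --> U] --> l -> Psi (s n) y @[n --> U] --> Psi l y.
Proof.
move=> sI lI sl.
have zc (z : R -> X -> R) : time_regular T z -> z (s n) y @[n --> U] --> z l y.
  move=> zr; have [cz _ _] := zr y; apply/cvgrPdist_le => e e0.
  have lI' : `[0, T]%classic l by rewrite /= in_itv.
  have [d d0 dP] := (within_continuousP _ _).1 cz l lI' _ e0.
  move/cvgrPdist_lt: sl => /(_ d d0); apply: filterS => n sd.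
  by rewrite distrC; apply: dP; [rewrite /= in_itv; exact: sI|rewrite distrC].
have [cphi _ _ _] := phiI.
have pc : psi (s n) y @[n --> U] --> psi l y.
  apply: cvgB; apply: continuous_cvg; first exact: cphi.
  - exact: zc.
  - exact: cphi.
  - exact: zc.
apply/cvgrPdist_le => e e0; move/cvgrPdist_le: pc => /(_ e e0).
by apply: filterS => n; apply: le_trans; exact: maxr_lipschitz.
Qed.

Let f_unif x e : 0 < e -> exists2 d, 0 < d & forall s t, 0 <= s <= T -> 0 <= t <= T ->
    `|s - t| <= d -> `|f s x - f t x| <= e.
Proof.
apply: (heine UU UN) => s l sI lI sl; apply: cvgN.
apply: (@laplacian_cvg _ _ G nat U _ (fun n => Psi (s n)) _ B).
  by apply: nearW => n y; have /andP[p0 p1] := Psi_itv y (sI n); rewrite ger0_norm.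
by move=> y; exact: Psi_cvg.
Qed.

(** A modulus of continuity in linear form: where [w <= d], uniform continuity of [phi] gives
    [Psi <= e]; where [w > d], the bound [B] on [Psi] is at most [F] times [|B| / d]. The constant
    depends on neither time nor vertex. *)
Let Psi_le e : 0 < e -> exists2 K, 0 < K & forall t x, 0 <= t <= T -> Psi t x <= e
    + K * F t x.
Proof.
move=> e0; have [cphi _ _ _] := phiI.
have [|d d0 dP] := @heine _ U UU UN phi (- C) C _ e e0.
  by move=> s l _ _ sl; apply: continuous_cvg sl; exact: cphi.
have B0 (x : X) : 0 <= B by rewrite subr_ge0 mphi//; have := C0 x; lra.
exists (`|B| / d + 1) => [|t x tI]; first by rewrite ltr_wpDl// divr_ge0// ltW.
have /andP[F0 _] := F_itv x tI; have /andP[_ PB] := Psi_itv x tI.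
have KF : 0 <= (`|B| / d + 1) * F t x by rewrite mulr_ge0// addr_ge0// divr_ge0// ltW.
case: (lerP (psi t x) 0) => p0.
  by rewrite {1}/Psi (max_idPl p0); exact: addr_ge0 (ltW e0) KF.
have wt : 0 < w t x.
  rewrite ltNge; apply/negP; rewrite subr_le0 => /mphi; rewrite -subr_le0.
  by rewrite leNgt p0.
have FE : F t x = w t x by apply/max_idPr/ltW.
case: (lerP (w t x) d) => wd.
  rewrite {1}/Psi (max_idPr (ltW p0)); apply: (@le_trans _ _ e); last by rewrite lerDl.
  apply: le_trans (ler_norm _) _; apply: dP; rewrite -?ler_norml ?uC ?vC//.
  by rewrite gtr0_norm.
apply: (le_trans PB); rewrite FE; have : `|B| / d * d <= `|B| / d * w t x.
  by rewrite ler_wpM2l ?divr_ge0// ltW.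
rewrite divfK ?gt_eqF// => H; apply: (le_trans (ler_norm B)); apply: (le_trans H).
rewrite mulrDl mul1r [leRHS]addrC -addrA lerDl; apply: addr_ge0; [exact: ltW|exact: ltW].
Qed.

Let h n : R := T / n.+1%:R.
Let tk n k : R := k%:R * h n.
(* The weights [1 + (T - t_(k+1))] turn the bound on the increments of [F] into
   one on [F T] plus the time integral of [F]. *)
Let c n k : R := h n * (1 + (n - k)%:R * h n).
(** Riemann sums replace time integrals, so the Laplacian only has to commute with finite sums; the
    limit along [U] comes last. *)
Let V n x := \sum_(k < n.+1) c n k * Psi (tk n k) x.
Let W n x := F T x + h n * \sum_(k < n.+1) F (tk n k) x.

Let h0 n : 0 < h n. Proof. by rewrite divr_gt0. Qed.

Let hn n : n.+1%:R * h n = T. Proof. by rewrite mulrC divfK. Qed.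

Let tkI n k : (k <= n.+1)%N -> 0 <= tk n k <= T.
Proof.
move=> kn; rewrite mulr_ge0 ?(ltW (h0 n))//= -(hn n) ler_pM2r ?h0//.
by rewrite ler_nat.
Qed.

Let c_itv n k : 0 <= c n k <= h n * (1 + T).
Proof.
have k0 : 0 <= (n - k)%:R * h n by rewrite mulr_ge0 ?(ltW (h0 n)).
rewrite /c mulr_ge0 ?(ltW (h0 n)) ?addr_ge0//= ler_pM2l ?h0// lerD2l -[leRHS](hn n).
by rewrite ler_pM2r ?h0// ler_nat (leq_trans (leq_subr _ _)).
Qed.

Let sum_c (a : nat -> R) n M : (forall k, (k <= n)%N -> 0 <= a k <= M) ->
  0 <= \sum_(k < n.+1) c n k * a k <= (1 + T) * (T * M).
Proof.
move=> aM; apply/andP; split.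
  apply: sumr_ge0 => k _; have /andP[c0 _] := c_itv n k.
  by have /andP[a0 _] := aM k (ltnSE (ltn_ord k)); rewrite mulr_ge0.
rewrite -(hn n); have -> : (1 + n.+1%:R * h n) * (n.+1%:R * h n * M) =
    \sum_(k < n.+1) (h n * (1 + T) * M) by rewrite sumr_const card_ord hn
        -mulr_natr -(hn n); ring.
apply: ler_sum => k _; have /andP[c0 c1] := c_itv n k.
by have /andP[a0 a1] := aM k (ltnSE (ltn_ord k)); exact: ler_pM.
Qed.

Let V_itv n x : 0 <= V n x <= (1 + T) * (T * B).
Proof.
exact: (@sum_c (fun k => Psi (tk n k) x) n B (fun k kn => Psi_itv x (tkI (leqW kn)))).
Qed.

Let V_laplacian n x : laplacian (V n) x = - \sum_(k < n.+1) c n k * f (tk n k) x.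
Proof.
have bP (k : 'I_n.+1) : bounded_function (Psi (tk n k)) by apply/bPsi/tkI/ltnW/ltn_ord.
have [_ E] := laplacian_sum (fun k : 'I_n.+1 => c n k) x bP.
rewrite /V E -sumrN; apply: eq_bigr => k _.
by rewrite /f mulrN opprK.
Qed.

(** On each small time interval, [f] at [x] is within [e'] of its value at the left end, which
    bounds the increment of [F]; [abel_weights] adds these bounds up. *)
Let W_le x e : 0 < e -> \forall n \near U, W n x <= - laplacian (V n) x + e.
Proof.
(* The coefficients [c n k] add up to at most [(1 + T) * T]. *)
move=> e0; pose e' := e / ((1 + T) * T).
have T1 : 0 < 1 + T by rewrite addr_gt0.
have e'0 : 0 < e' by rewrite divr_gt0// mulr_gt0.
have [d d0 dP] := f_unif x e'0.
have dT : 0 < d / T by rewrite divr_gt0.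
apply: filterS (inv_small UN dT) => n; rewrite ler_pdivlMr// mulrC -/(h n) => hd.
have F0 : F (tk n 0) x = 0.
  by rewrite /tk mul0r; apply/max_idPl; rewrite subr_le0.
have FT : F T x = F (tk n n.+1) x by rewrite /tk hn.
have := @abel_weights (h n) (fun k => F (tk n k) x) n F0.
rewrite /W FT => <-; rewrite V_laplacian opprK.
have se : \sum_(k < n.+1) c n k * e' <= e.
  have /andP[_] := @sum_c (fun=> e') n e' (fun k _ => introT andP (conj (ltW e'0)
      (lexx e'))).
  move=> /le_trans; apply; rewrite mulrA /e' mulrC divfK// gt_eqF//.
  by rewrite mulr_gt0.
apply: le_trans (lerD (lexx _) se); rewrite -big_split/=; apply: ler_sum => k _.
have kn : (k <= n)%N := ltnSE (ltn_ord k).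
have /andP[k0 k1] := tkI (ltnW (ltn_ord k)).
have /andP[s0 s1] := @tkI n k.+1 (ltn_ord k).
have st : tk n k.+1 = tk n k + h n by rewrite /tk -natr1 mulrDl mul1r.
have kk : tk n k <= tk n k.+1 by rewrite st lerDl ltW.
have fl s : tk n k <= s <= tk n k.+1 -> f s x <= f (tk n k) x + e'.
  move=> /andP[ks sk]; have sI : 0 <= s <= T by rewrite (le_trans k0)//= (le_trans sk).
  have kI : 0 <= tk n k <= T by rewrite k0.
  have sd : `|s - tk n k| <= d.
    by rewrite ger0_norm ?subr_ge0//; apply: le_trans hd; rewrite lerBlDr addrC -st.
  have := dP s (tk n k) sI kI sd; rewrite ler_norml => /andP[_].
  by rewrite lerBlDl.
have inc := increment k0 kk s1 fl.
have sth : tk n k.+1 - tk n k = h n by rewrite st addrC addKr.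
rewrite sth in inc.
have p0 : 0 <= 1 + (n - k)%:R * h n by rewrite addr_ge0// mulr_ge0 ?(ltW (h0 n)).
have : (1 + (n - k)%:R * h n) * (F (tk n k.+1) x - F (tk n k) x) <=
    (1 + (n - k)%:R * h n) * (h n * (f (tk n k) x + e')).
  by rewrite ler_wpM2l// lerBlDl.
move=> /le_trans; apply.
by rewrite /c le_eqVlt; apply/orP; left; apply/eqP; ring.
Qed.

Let V_le e : 0 < e -> exists2 K, 0 < K & forall n x, V n x <= e + K * W n x.
Proof.
move=> e0; have T1 : 0 < 1 + T by rewrite addr_gt0.
have e'0 : 0 < e / ((1 + T) * T) by rewrite divr_gt0// mulr_gt0.
have [K K0 KP] := Psi_le e'0; set e' := e / _ in KP.
have ee : (1 + T) * T * e' = e by rewrite mulrC divfK// gt_eqF// mulr_gt0.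
exists ((1 + T) * K) => [|n x]; first by rewrite mulr_gt0.
have TI : 0 <= T <= T by rewrite lexx ltW.
have /andP[FT0 _] := F_itv x TI.
apply: (@le_trans _ _ (\sum_(k < n.+1) (h n * (1 + T) * e' + h n * (1 + T) * K * F
    (tk n k) x))).
  apply: ler_sum => k _; have kI := tkI (ltnW (ltn_ord k)).
  have /andP[c0 c1] := c_itv n k; have /andP[P0 _] := Psi_itv x kI.
  apply: (@le_trans _ _ (h n * (1 + T) * Psi (tk n k) x)); first by rewrite ler_wpM2r.
  have -> : h n * (1 + T) * e' + h n * (1 + T) * K * F (tk n k) x =
      h n * (1 + T) * (e' + K * F (tk n k) x) by rewrite [RHS]mulrDr !mulrA.
  by rewrite ler_pM2l; [exact: KP|exact: mulr_gt0].
rewrite big_split/= sumr_const card_ord -mulr_natl -mulr_sumr.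
have -> : n.+1%:R * (h n * (1 + T) * e') = e by rewrite [LHS]mulrA [X in X *
    _]mulrA hn [T * _]mulrC.
rewrite /W lerD2l.
have -> : (1 + T) * K * (F T x + h n * \sum_(k < n.+1) F (tk n k) x) =
   (1 + T) * K * F T x + h n * (1 + T) * K * \sum_(k < n.+1) F (tk n k) x by ring.
by rewrite lerDr !mulr_ge0// ltW.
Qed.

(** The limits along [U] satisfy the hypotheses of [potential_vanishes], and [F T] lies below the
    limit of [W]. Only the final time is treated: an earlier positive time is the final time of a
    shorter interval. *)
Lemma comparison_at_end x : ~ positive_subsolution G -> u T x <= v T x.
Proof.
move=> nP; pose Vl y := lim (V n y @[n --> U]); pose Wl y := lim (W n y @[n --> U]).
have TI : 0 <= T <= T by rewrite lexx ltW.
have Vc y : V n y @[n --> U] --> Vl y.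
  apply: (@ultra_cvg _ _ _ _ ((1 + T) * (T * B))) => n.
  by have /andP[a b] := V_itv n y; rewrite ger0_norm.
have F1 n y : 0 <= \sum_(k < n.+1) F (tk n k) y.
  by apply: sumr_ge0 => k _; have /andP[] := F_itv y (tkI (ltnW (ltn_ord k))).
have WF n y : F T y <= W n y by rewrite lerDl mulr_ge0 ?(ltW (h0 n)).
have Wc y : W n y @[n --> U] --> Wl y.
  apply: (@ultra_cvg _ _ _ _ (2 * C + T * (2 * C))) => n.
  have /andP[a b] := F_itv y TI; rewrite ger0_norm; last exact: (le_trans a (WF n y)).
  have -> : T * (2 * C) = h n * (n.+1%:R * (2 * C)) by rewrite [RHS]mulrA [h n * _]mulrC hn.
  apply: lerD => //; rewrite ler_pM2l ?h0// mulr_natl.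
  rewrite -[n.+1 in leRHS]card_ord -sumr_const; apply: ler_sum => k _.
  by have /andP[] := F_itv y (tkI (ltnW (ltn_ord k))).
have Vl_itv y : 0 <= Vl y <= (1 + T) * (T * B).
  by apply/andP; split; [apply: (cvgr_to_ge (Vc y))|apply: (cvgr_to_le (Vc y))];
    apply: nearW => n; have /andP[] := V_itv n y.
have WVl y : Wl y <= - laplacian Vl y.
  have Lc : - laplacian (V n) y @[n --> U] --> - laplacian Vl y.
    apply: cvgN; apply: (@laplacian_cvg _ _ G nat U _ V _ ((1 + T) * (T * B))) => //.
    by apply: nearW => n z; have /andP[a b] := V_itv n z; rewrite ger0_norm.
  apply/ler_addgt0Pr => e e0.
  have Le : - laplacian (V n) y + e @[n --> U] --> - laplacian Vl y + e.
    by apply: cvgD => //; exact: cvg_cst.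
  exact: (ler_cvg_to (Wc y) Le (W_le y e0)).
have VKl e : 0 < e -> exists2 K, 0 < K & forall y, Vl y <= e + K * Wl y.
  move=> e0; have [K K0 KP] := V_le e0; exists K => // y.
  have Kc : e + K * W n y @[n --> U] --> e + K * Wl y.
    by apply: cvgD; [exact: cvg_cst|apply: cvgMl_tmp; exact: Wc].
  by apply: (ler_cvg_to (Vc y) Kc); apply: nearW => n; exact: KP.
have := potential_vanishes nP Vl_itv WVl VKl x => Wl0.
have FTl : F T x <= Wl x by apply: (cvgr_to_ge (Wc x)); exact: nearW.
have : w T x <= 0.
  by apply: le_trans Wl0; apply: le_trans FTl; rewrite /F le_max lexx orbT.
by rewrite subr_le0.
Qed.

End Comparison.

(** * From comparison to uniqueness and the equivalences *)

Section Uniqueness.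
Variables (R : realType) (X : countType) (G : graph R X).
Implicit Types (u v : R -> X -> R) (phi : R -> R).

Lemma time_regular_le T t u : t <= T -> time_regular T u -> time_regular t u.
Proof.
move=> tT ur x; have [cu du cdu] := ur x; split.
- apply: continuous_subspaceW cu => s /=; rewrite !in_itv/= => /andP[-> st].
  exact: le_trans st tT.
- by move=> s /andP[s0 st]; apply: du; rewrite s0 (lt_le_trans st).
- by move=> s /andP[s0 st]; apply: cdu; rewrite s0 (lt_le_trans st).
Qed.

Lemma comparison_of_no_subsolution phi T : ~ positive_subsolution G ->
  nonlinearity phi -> 0 < T -> comparison_principle G phi T.
Proof.
move=> nP phiI T0 u v [M uM] [M' vM] ur vr uv uv0 t x /andP[t0 tT].
move: t0; rewrite le_eqVlt => /orP[/eqP <-|t0]; first exact: uv0.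
have [U [UU UN]] := free_ultrafilter.
apply: (@comparison_at_end _ _ G phi t (Num.max M M') u v U) => //.
- move=> s y /andP[s0 st]; rewrite le_max uM// s0.
  exact: le_trans st tT.
- move=> s y /andP[s0 st]; rewrite le_max vM ?orbT// s0.
  exact: le_trans st tT.
- exact: time_regular_le ur.
- exact: time_regular_le vr.
- by move=> s y /andP[s0 st]; apply: uv; rewrite s0 (lt_le_trans st).
Qed.

Lemma comparison_unique phi T (u0 : X -> R) u v : comparison_principle G phi T ->
  bounded_solution G phi u0 T u -> bounded_solution G phi u0 T v -> eq_upto T u v.
Proof.
move=> cp [[_ ur ue u00] ub] [[_ vr ve v00] vb] t x tT.
by apply/le_anti/andP; split; apply: cp => //;
  do ?[by move=> s y sT; rewrite ue// ve]; move=> y; rewrite u00 v00.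
Qed.

Lemma global_bounded_solution_upto phi (u0 : X -> R) T u : 0 < T ->
  global_bounded_solution G phi u0 u -> bounded_solution G phi u0 T u.
Proof.
move=> T0 [us [M uM]]; split; first exact: us.
by exists M => t x /andP[t0 _]; exact: uM.
Qed.

Lemma nonlinearity_id : nonlinearity (@id R).
Proof.
by split=> //; [move=> x; exact: cvg_id|exists 0, 1; rewrite eq_sym oner_eq0].
Qed.

Lemma nonlinearity_neq0 phi s t : phi s != phi t -> phi s != 0 \/ phi t != 0.
Proof.
by move=> st; case: (eqVneq (phi s) 0) => [s0|]; [right; rewrite -s0 eq_sym|left].
Qed.

Lemma zero_solution phi T : phi 0 = 0 -> bounded_solution G phi (fun=> 0) T (fun _ _ => 0).
Proof.
move=> p0; have d0 : derive1 (fun=> 0 : R) = fun=> 0 by apply/funext => t;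
    exact: derive1_cst.
split; last by exists 0 => t x _; rewrite normr0.
split=> //.
- move=> t _ x; rewrite p0; have -> : (fun y => weight G x y * `|0 : R|) = fun=> 0.
    by apply/funext => y; rewrite normr0 mulr0.
  exact: rsummable0.
- move=> x; split.
  + by apply: continuous_subspaceT => t; exact: cvg_cst.
  + by move=> t _; exact: derivable_cst.
  + by move=> t _; rewrite d0; exact: cvg_cst.
- by move=> t x _; rewrite /gpme_operator d0 p0 laplacian_cst mulr0 addr0.
Qed.

End Uniqueness.

Theorem theorem6p2 (R : realType) (X : countType) (G : graph R X) :
  [/\ [<-> (* i *) stochastically_complete_at_infinity G ;
      (* ii *) forall (T : R) (u0 : X -> R) (phi : R -> R),
        0 < T -> bounded_function u0 -> nonlinearity phi ->
        exists2 u, bounded_solution G phi u0 T u &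
          forall v, bounded_solution G phi u0 T v -> eq_upto T u v ;
      (* iii *) exists (T0 : R) (u0 : X -> R) (phi : R -> R),
        [/\ 0 < T0, bounded_function u0, nonlinearity phi &
          forall u v, bounded_solution G phi u0 T0 u ->
            bounded_solution G phi u0 T0 v -> eq_upto T0 u v] ;
      (* iv *) exists (T0 : R) (phi : R -> R),
        [/\ 0 < T0, nonlinearity phi,
          bounded_solution G phi (fun=> 0) T0 (fun _ _ => 0) &
          forall u, bounded_solution G phi (fun=> 0) T0 u ->
            eq_upto T0 u (fun _ _ => 0)] ;
      (* v *) exists (T0 : R) (phi : R -> R),
        [/\ 0 < T0, nonlinearity phi & comparison_principle G phi T0] ;
      (* vi *) forall (u0 : X -> R) (phi : R -> R),
        bounded_function u0 -> nonlinearity phi ->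
        exists2 u, global_bounded_solution G phi u0 u &
          forall v, global_bounded_solution G phi u0 v -> eq_global u v],
    stochastically_complete_at_infinity G ->
      forall (phi : R -> R) (T : R), nonlinearity phi -> 0 < T ->
        comparison_principle G phi T
  & ~ stochastically_complete_at_infinity G ->
      (forall (u0 : X -> R) (phi : R -> R),
         bounded_function u0 -> nonlinearity phi ->
         exists U, separated_solutions G phi u0 U) /\
      (forall phi : R -> R, nonlinearity phi ->
         ((exists s t, [/\ 0 <= s, 0 <= t & phi s != phi t]) ->
          exists U, separated_solutions G phi (fun=> 0) U /\
            forall n t x, 0 <= t -> 0 <= U n t x) /\
         (~ (exists s t, [/\ 0 <= s, 0 <= t & phi s != phi t]) ->
          exists U, separated_solutions G phi (fun=> 0) U /\
            forall n t x, 0 <= t -> U n t x <= 0))].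
Proof.
have b0 : bounded_function (fun _ : X => 0 : R) by exact: bounded_cst.
have cp : stochastically_complete_at_infinity G -> forall (phi : R -> R) (T : R),
    nonlinearity phi -> 0 < T -> comparison_principle G phi T.
  by move=> /no_subsolution_of_complete nP phi T; exact: comparison_of_no_subsolution.
have sub : ~ stochastically_complete_at_infinity G -> positive_subsolution G.
  move=> nS; case: (pselect (positive_subsolution G)) => // nP.
  by case: nS; exact: complete_of_no_subsolution.
have inf (u0 : X -> R) (phi : R -> R) : ~ stochastically_complete_at_infinity G ->
    bounded_function u0 -> nonlinearity phi -> exists U, separated_solutions G phi u0 U.
  move=> nS bu phiI; have [_ _ [s [t /nonlinearity_neq0[p|p]]] _] := phiI.
    by have [U [HU _]] := infinitely_many_solutions phiI (sub nS) bu p; exists U.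
  by have [U [HU _]] := infinitely_many_solutions phiI (sub nS) bu p; exists U.
(* Uniqueness for a single choice of data already forces completeness: otherwise [inf] yields two
   distinct solutions for exactly these data. *)
have uniq (T : R) (u0 : X -> R) (phi : R -> R) : 0 < T -> bounded_function u0 ->
    nonlinearity phi -> (forall u v, bounded_solution G phi u0 T u ->
      bounded_solution G phi u0 T v -> eq_upto T u v) ->
          stochastically_complete_at_infinity G.
  move=> T0 bu phiI H; case: (pselect (stochastically_complete_at_infinity G)) => // nS.
  have [U [US Ud]] := inf u0 phi nS bu phiI.
  by case: (Ud 0%N 1%N isT T T0); apply: H; exact: global_bounded_solution_upto.
split=> //.
- tfae.
  + move=> S T u0 phi T0 bu phiI; have [u us] := global_solution_exists G phiI bu.
    exists u; first exact: global_bounded_solution_upto.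
    move=> v vs; apply: comparison_unique (cp S _ _ phiI T0) _ vs.
    exact: global_bounded_solution_upto.
  + move=> H; exists 1, (fun=> 0), id; split=> //; first exact: nonlinearity_id.
    have [u us uu] := H 1 (fun=> 0) id ltr01 b0 (nonlinearity_id R).
    by move=> v w vs ws t x tT; rewrite -(uu v vs t x tT) (uu w ws t x tT).
  + move=> [T [u0 [phi [T0 bu phiI /(uniq _ _ _ T0 bu phiI) S]]]].
    have zs : bounded_solution G id (fun=> 0) (1 : R) (fun _ _ => 0) by exact:
        zero_solution.
    exists 1, id; split=> //; first exact: nonlinearity_id.
    by move=> u us; apply: comparison_unique (cp S _ _ (nonlinearity_id R) ltr01) us zs.
  + move=> [T [phi [T0 phiI zs Z]]].
    have S : stochastically_complete_at_infinity G.
      apply: (uniq T (fun=> 0) phi T0 b0 phiI) => u v us vs t x tT.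
      by rewrite (Z u us t x tT) (Z v vs t x tT).
    by exists T, phi; split=> //; exact: cp.
  + move=> [T [phi [T0 phiI cpT]]] u0 psi bu psiI.
    have S : stochastically_complete_at_infinity G.
      by apply: (uniq T (fun=> 0) phi T0 b0 phiI) => u v; exact: comparison_unique.
    have [u us] := global_solution_exists G psiI bu; exists u => // v vs t x t0.
    (* The time [t] may be 0, while comparison needs an interval of positive length. *)
    have t1 : 0 < t + 1 by rewrite ltr_wpDl.
    apply: (comparison_unique (cp S _ _ psiI t1) (global_bounded_solution_upto t1 us)
      (global_bounded_solution_upto t1 vs)).
    by rewrite t0 lerDl ler01.
  + move=> H; case: (pselect (stochastically_complete_at_infinity G)) => // nS.
    have [U [US Ud]] := inf (fun=> 0) id nS b0 (nonlinearity_id R).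
    have [u us uu] := H (fun=> 0) id b0 (nonlinearity_id R).
    case: (Ud 0%N 1%N isT 1 ltr01) => t x /andP[t0 _].
    by rewrite -(uu _ (US 0%N) t x t0) (uu _ (US 1%N) t x t0).
- move=> nS; split=> [u0 phi|phi phiI]; first exact: inf.
  have [_ _ [s [t st]] p0] := phiI; split.
    move=> [s' [t' [s0 t0 st']]].
    have [b [bp b_0]] : exists b, phi b != 0 /\ 0 <= b.
      by have [p|p] := nonlinearity_neq0 st'; [exists s'|exists t'].
    have [U [HU /(_ (fun=> erefl)) [/(_ b_0) U0 _]]] :=
      infinitely_many_solutions phiI (sub nS) b0 bp.
    by exists U; split=> // n r x _; exact: U0.
  move=> no; have [b bp] : exists b, phi b != 0.
    by have [p|p] := nonlinearity_neq0 st; [exists s|exists t].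
  (* Here [phi] is constant, hence 0, on the nonnegative half-line. *)
  have b_0 : b <= 0.
    by rewrite leNgt; apply/negP => /ltW b_0; apply: no; exists b, 0; rewrite p0.
  have [U [HU /(_ (fun=> erefl)) [_ /(_ b_0) U0]]] :=
    infinitely_many_solutions phiI (sub nS) b0 bp.
  by exists U; split=> // n r x _; exact: U0.
Qed.
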